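(* Let $\Omega=B_1(0)$ be the unit ball in $\mathbb{R}^n$, $n>2$, $-\infty<a<\frac{n-2}{2}$, $a\le b\le a+1$, $d=1+a-b\in(0,1]$, $q=\frac{2n}{n-2d}$, $c>0$ and $0<\lambda<\lambda_1$. Then the functional $$E_\lambda(u)=\frac12\int_\Omega|x|^{-2a}|Du|^2\,dx-\frac1q\int_\Omega|x|^{-bq}|u|^q\,dx-\frac{\lambda}{2}\int_\Omega|x|^{-2(a+1)+c}|u|^2\,dx$$ satisfies the Palais–Smale condition in $\mathcal{D}_{a,R}^{1,2}(\Omega)$ at every energy level $M<\frac dn S_R(a,b)^{\frac{n}{2d}}$.
   Context: $\mathcal{D}_a^{1,2}(\Omega)$ is the completion of $C_0^\infty(\Omega)$ with respect to the norm $\|u\|=\left(\int_\Omega |x|^{-2a}|Du|^2\,dx\right)^{1/2}$; $\mathcal{D}_a^{1,2}(\mathbb{R}^n)$ is defined likewise with $\mathbb{R}^n$ in place of $\Omega$. $\mathcal{D}_{a,R}^{1,2}(\Omega)$ and $\mathcal{D}_{a,R}^{1,2}(\mathbb{R}^n)$ denote the subspaces of radial functions in $\mathcal{D}_a^{1,2}(\Omega)$ and $\mathcal{D}_a^{1,2}(\mathbb{R}^n)$ respectively. First eigenvalue: $\lambda_1=\inf\left\{\int_\Omega|x|^{-2a}|Du|^2\,dx : u\in\mathcal{D}_a^{1,2}(\Omega),\ \int_\Omega|x|^{-2(a+1)+c}|u|^2\,dx=1\right\}>0$. Radial best constant: $$S_R(a,b)=\inf_{u\in\mathcal{D}_{a,R}^{1,2}(\mathbb{R}^n)\setminus\{0\}}\frac{\int_{\mathbb{R}^n}|x|^{-2a}|Du|^2\,dx}{\left(\int_{\mathbb{R}^n}|x|^{-bq}|u|^q\,dx\right)^{2/q}}.$$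 The Palais–Smale condition at level $M$ in $\mathcal{D}_{a,R}^{1,2}(\Omega)$: every sequence $\{u_m\}\subset\mathcal{D}_{a,R}^{1,2}(\Omega)$ with $E_\lambda(u_m)\to M$ and $E_\lambda'(u_m)\to0$ in the dual space $(\mathcal{D}_{a,R}^{1,2}(\Omega))'$ (derivative of $E_\lambda$ restricted to $\mathcal{D}_{a,R}^{1,2}(\Omega)$) has a subsequence converging strongly in $\mathcal{D}_{a,R}^{1,2}(\Omega)$. *)

(* Defs.v *)
From HB Require Import structures.
From mathcomp Require Import all_boot all_order all_algebra.
From mathcomp Require Import all_classical all_reals all_analysis.
Set Implicit Arguments.
Unset Strict Implicit.
Unset Printing Implicit Defensive.
Import Order.TTheory GRing.Theory Num.Theory.
Import numFieldNormedType.Exports.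
Local Open Scope classical_set_scope.
Local Open Scope ring_scope.

(* The sigma-algebra generated by the coordinates, i.e. the Borel one. *)
Section measurable_rV.
Context {R : realType} (n : nat).

Let coors : 'I_n -> 'rV[R]_n -> R := fun i x => x ord0 i.

Let rV_set0 : g_sigma_preimage coors set0.
Proof. exact: sigma_algebra0. Qed.

Let rV_setC A : g_sigma_preimage coors A -> g_sigma_preimage coors (~` A).
Proof. exact: sigma_algebraC. Qed.

Let rV_bigcup (F : _^nat) : (forall i, g_sigma_preimage coors (F i)) ->
  g_sigma_preimage coors (\bigcup_i (F i)).
Proof. exact: sigma_algebra_bigcup. Qed.

HB.instance Definition _ := @isMeasurable.Build default_measure_display
  'rV[R]_n (g_sigma_preimage coors) rV_set0 rV_setC rV_bigcup.

Lemma measurable_coor (i : 'I_n) :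
  measurable_fun [set: 'rV[R]_n] (fun x => x ord0 i).
Proof.
move=> _ Y mY; rewrite setTI; apply: sub_sigma_algebra => /=.
rewrite -bigcup_seq/=; exists i => /=; first by rewrite mem_index_enum.
by exists Y => //; rewrite setTI.
Qed.

Lemma measurable_fun_coorP d (T : measurableType d) (f : T -> 'rV[R]_n) :
  (forall i, measurable_fun [set: T] (fun t => f t ord0 i)) ->
  measurable_fun [set: T] f.
Proof.
move=> mf; suff sub : g_sigma_preimage (fun i => coors i \o f) `<=` measurable.
  move: sub; rewrite g_sigma_preimage_comp => sub _ A mA.
  by apply: sub; exists A.
apply: smallest_sub; first exact: sigma_algebra_measurable.
move=> A; rewrite -bigcup_seq => -[i _ [B mB <-]].
exact: mf.
Qed.

End measurable_rV.

Section lebesgue_step.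
Context {R : realType} (n : nat).

Definition row_cons (p : measurableTypeR R * 'rV[R]_n) : 'rV[R]_n.+1 :=
  row_mx (p.1 : R)%:M p.2.

Definition row_uncons (x : 'rV[R]_n.+1) : measurableTypeR R * 'rV[R]_n :=
  ((lsubmx (x : 'rV[R]_(1 + n))) ord0 ord0, rsubmx (x : 'rV[R]_(1 + n))).

Lemma row_cons0 p : row_cons p ord0 ord0 = p.1.
Proof.
rewrite (_ : ord0 = @lshift 1 n ord0 :> 'I_n.+1); last exact/val_inj.
by rewrite [LHS](@row_mxEl _ 1 1 n) mxE eqxx.
Qed.

Lemma row_consS p (i : 'I_n) : row_cons p ord0 (lift ord0 i) = p.2 ord0 i.
Proof.
rewrite (_ : lift ord0 i = @rshift 1 n i :> 'I_n.+1); last exact/val_inj.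
by rewrite [LHS](@row_mxEr _ 1 1 n).
Qed.

Lemma row_consK : cancel row_cons row_uncons.
Proof.
case=> x v; rewrite /row_uncons /row_cons /= row_mxKl row_mxKr.
by rewrite mxE eqxx.
Qed.

Lemma row_unconsK : cancel row_uncons row_cons.
Proof.
move=> x; rewrite /row_uncons /row_cons /=.
set y : 'rV[R]_(1 + n) := x.
have -> : (lsubmx y ord0 ord0)%:M = lsubmx y.
  by apply/rowP => i; rewrite !ord1 [LHS]mxE eqxx.
exact: (@hsubmxK _ 1 1 n y).
Qed.

Lemma measurable_row_cons : measurable_fun setT row_cons.
Proof.
apply: measurable_fun_coorP => i; case: (unliftP ord0 i) => [j ->|->].
  rewrite [X in measurable_fun _ X](_ : _ =
      (fun x : 'rV[R]_n => x ord0 j) \o snd).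
    exact: measurableT_comp (measurable_coor j) measurable_snd.
  by apply/funext => p; rewrite row_consS.
rewrite [X in measurable_fun _ X](_ : _ = fst).
  exact: (@measurable_fst _ _ (measurableTypeR R)).
by apply/funext => p; rewrite row_cons0.
Qed.

Lemma measurable_row_uncons : measurable_fun setT row_uncons.
Proof.
apply: measurable_fun_pair.
  under eq_fun do rewrite mxE; exact: measurable_coor.
apply: measurable_fun_coorP => i.
under eq_fun do rewrite mxE; exact: measurable_coor.
Qed.

Variable m : {sigma_finite_measure set 'rV[R]_n -> \bar R}.

Definition lebesgue_step : set 'rV[R]_n.+1 -> \bar R :=
  pushforward (@lebesgue_measure R \x m)%E row_cons.

Let step0 : lebesgue_step set0 = 0%E.
Proof. by rewrite /lebesgue_step /pushforward preimage_set0 measure0. Qed.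

Let step_ge0 A : (0 <= lebesgue_step A)%E.
Proof. exact: (measure_ge0 (lebesgue_measure \x m)%E). Qed.

Let step_sigma_additive : semi_sigma_additive lebesgue_step.
Proof.
move=> F mF tF mUF; rewrite /lebesgue_step /pushforward preimage_bigcup.
apply: measure_semi_sigma_additive.
- by move=> k; rewrite -[X in measurable X]setTI; exact: measurable_row_cons.
- apply/trivIsetP => /= i j _ _ ij; rewrite -preimage_setI.
  by move/trivIsetP : tF => /(_ _ _ _ _ ij) ->//; rewrite preimage_set0.
- by rewrite -preimage_bigcup -[X in measurable X]setTI;
    exact: measurable_row_cons.
Qed.

HB.instance Definition _ := isMeasure.Build _ _ _ lebesgue_step
  step0 step_ge0 step_sigma_additive.

Let step_sigma_finite : sigma_finite setT lebesgue_step.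
Proof.
have /sigma_finiteP[F [TF ndF Foo]] := sigma_finiteT (@lebesgue_measure R).
have /sigma_finiteP[G [TG ndG Goo]] := sigma_finiteT m.
exists (fun k => row_uncons @^-1` (F k `*` G k)).
  rewrite -preimage_bigcup -[LHS](preimage_setT row_uncons); congr (_ @^-1` _).
  rewrite -setXTT TF TG predeqE => -[x y]; split.
    move=> [/= [i _ Fix] [j _ Gjy]]; exists (maxn i j) => //; split.
    - by move: x Fix; exact/subsetPset/ndF/leq_maxl.
    - by move: y Gjy; exact/subsetPset/ndG/leq_maxr.
  by move=> [i _ []/= ? ?]; split; exists i.
move=> k; have [mF Fk] := Foo k; have [mG Gk] := Goo k; split.
  rewrite -[X in measurable X]setTI; apply: measurable_row_uncons => //.
  exact: measurableX.
rewrite /lebesgue_step /pushforward -comp_preimage.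
rewrite (_ : row_uncons \o row_cons = id) ?preimage_id; last first.
  exact/funext/row_consK.
by rewrite product_measure1E// lte_mul_pinfty// ge0_fin_numE.
Qed.

HB.instance Definition _ :=
  Measure_isSigmaFinite.Build _ _ _ lebesgue_step step_sigma_finite.

End lebesgue_step.

Fixpoint lebesgue_rV {R : realType} (n : nat) :
    {sigma_finite_measure set 'rV[R]_n -> \bar R} :=
  match n with
  | 0 => @dirac _ 'rV[R]_0 0 R
  | k.+1 => lebesgue_step (lebesgue_rV k)
  end.

Lemma lebesgue_rV_box (R : realType) (n : nat) (A : 'I_n -> set R) :
  (forall i, measurable (A i)) ->
  lebesgue_rV n [set x : 'rV[R]_n | forall i, A i (x ord0 i)] =
  (\prod_(i < n) @lebesgue_measure R (A i))%E.
Proof.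
elim: n A => [|n IH] A mA.
  rewrite big_ord0 /= diracE (_ : _ \in _ = true)//.
  by apply/mem_set => /= -[].
rewrite big_ord_recl -IH//= /lebesgue_step /pushforward.
have mB : measurable [set x : 'rV[R]_n | forall i, A (lift ord0 i) (x ord0 i)].
  rewrite (_ : mkset _ = \bigcap_(i in [set: 'I_n])
      ([set: 'rV[R]_n] `&` (fun x => x ord0 i) @^-1` A (lift ord0 i))).
    apply: fin_bigcap_measurable => // i _.
    by apply: measurable_coor.
  by apply/seteqP; split=> x /= H i; [split=> //; exact: H|have [] := H i].
rewrite -product_measure1E; [|exact: mA|exact: mB].
congr (product_measure1 _ _ _).
apply/seteqP; split=> -[x v] /=.
  move=> H; split; first by have := H ord0; rewrite row_cons0.
  by move=> i; have := H (lift ord0 i); rewrite row_consS.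
move=> [Hx Hv] i; case: (unliftP ord0 i) => [j ->|->].
  by rewrite row_consS; exact: Hv.
by rewrite row_cons0.
Qed.

Section test_functions.
Context {R : realType} {n : nat}.
Implicit Types (f : 'rV[R]_n -> R) (Om : set 'rV[R]_n).

(* The norm of the normedModType ['rV[R]_n] is the sup norm. *)
Definition enorm (x : 'rV[R]_n) : R := Num.sqrt (\sum_(i < n) x ord0 i ^+ 2).

Definition open_unit_ball : set 'rV[R]_n := [set x | enorm x < 1].

Definition partial (i : 'I_n) f : 'rV[R]_n -> R :=
  fun x => 'D_(delta_mx ord0 i) f x.

Definition gradient f : 'rV[R]_n -> 'rV[R]_n := fun x => \row_i partial i f x.

Definition smooth f : Prop :=
  forall (s : seq 'I_n) (x : 'rV[R]_n), differentiable (foldr partial f s) x.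

Definition test_function Om f : Prop :=
  [/\ smooth f, compact (closure [set x | f x != 0]) &
      closure [set x | f x != 0] `<=` Om].

End test_functions.

Section weighted_space.
Context {R : realType} {n : nat}.
Implicit Types (a b c lam q s p : R) (Om : set 'rV[R]_n).

Notation mu := (@lebesgue_rV R n).

(* The second component plays the role of the gradient of the first: see D12. *)
Definition grad_pair : Type :=
  (('rV[R]_n -> R) * ('rV[R]_n -> 'rV[R]_n))%type.

Definition dirichlet a Om (g : 'rV[R]_n -> 'rV[R]_n) : \bar R :=
  (\int[mu]_(x in Om) (enorm x `^ (- 2 * a) * enorm (g x) ^+ 2)%:E)%E.

Definition power_integral s p Om (u : 'rV[R]_n -> R) : R :=
  \int[mu]_(x in Om) (enorm x `^ s * `|u x| `^ p).

(* D_a^{1,2}(Om), realised as a space of functions (up to null sets): u belongs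
   to it, with gradient g = Du, when test functions that are Cauchy for the norm
   converge to u almost everywhere and their gradients converge to g in
   L^2(|x|^(-2a)). For a < (n - 2) / 2 the weighted Hardy inequality shows that
   this is the abstract completion: every Cauchy sequence has a subsequence that
   converges almost everywhere, and the limit u determines g almost everywhere. *)
Definition D12 a Om : set grad_pair := [set w : grad_pair |
  [/\ measurable_fun Om w.1, measurable_fun Om w.2 &
    exists phi : nat -> 'rV[R]_n -> R,
      [/\ forall k, test_function Om (phi k),
          {ae mu, forall x, Om x -> phi k x @[k --> \oo] --> w.1 x} &
          dirichlet a Om (gradient (phi k) \- w.2) @[k --> \oo] --> 0%E]]].

Definition radial Om (u : 'rV[R]_n -> R) : Prop :=
  exists f : R -> R, {ae mu, forall x, Om x -> u x = f (enorm x)}.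

Definition D12rad a Om : set grad_pair := [set w : grad_pair | D12 a Om w /\ radial Om w.1].

(* [fine] loses nothing on D12: there the Dirichlet integral is finite by
   definition. The real-valued power integrals below are finite on D12 by the
   Caffarelli-Kohn-Nirenberg inequalities. *)
Definition D12norm a Om (w : grad_pair) : R :=
  Num.sqrt (fine (dirichlet a Om w.2)).

Definition lambda1 a c Om : R :=
  inf [set fine (dirichlet a Om w.2) | w in
    [set w : grad_pair | D12 a Om w /\ power_integral (- 2 * (a + 1) + c) 2 Om w.1 = 1]].

Definition S_R a b q : R :=
  inf [set fine (dirichlet a setT w.2) /
           power_integral (- b * q) q setT w.1 `^ (2 / q) | w in
    [set w : grad_pair | D12rad a setT w /\ ~ {ae mu, forall x, w.1 x = 0}]].

Definition energy a b c q lam Om (w : grad_pair) : R :=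
  2^-1 * fine (dirichlet a Om w.2)
  - q^-1 * power_integral (- b * q) q Om w.1
  - lam / 2 * power_integral (- 2 * (a + 1) + c) 2 Om w.1.

End weighted_space.

Section palais_smale.
Context {R : realType} {n : nat}.
Variables (a : R) (Om : set 'rV[R]_n).
Implicit Types (E L : @grad_pair R n -> R) (u v w : @grad_pair R n).

Notation V := (D12rad a Om).
Notation norm := (D12norm a Om).

(* L is the Frechet derivative at u of the restriction of E to D12rad. *)
Definition is_frechet E u L : Prop :=
  [/\ forall (k : R) v w, V v -> V w -> L (k *: v + w) = k * L v + L w,
      exists C : R, forall v, V v -> `|L v| <= C * norm v &
      forall e : R, 0 < e -> exists2 r : R, 0 < r & forall v, V v ->
        norm v <= r -> `|E (u + v) - E u - L v| <= e * norm v].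

Definition dual_norm L : \bar R :=
  ereal_sup [set `|L v|%:E | v in [set v | V v /\ norm v <= 1]].

Definition palais_smale E (M : R) : Prop :=
  forall u : nat -> @grad_pair R n,
    (forall m, V (u m)) ->
    E (u m) @[m --> \oo] --> M ->
    (exists L : nat -> @grad_pair R n -> R,
        (forall m, is_frechet E (u m) (L m)) /\
        dual_norm (L m) @[m --> \oo] --> 0%E) ->
    exists s : nat -> nat, {homo s : i j / (i < j)%N} /\
      exists2 w, V w & norm (u (s k) - w) @[k --> \oo] --> 0.

End palais_smale.

(* Main.v *)
Require Import Defs.
From mathcomp Require Import all_boot all_order all_algebra.
From mathcomp Require Import all_classical all_reals all_analysis.
From mathcomp Require Import measurable_realfun ring lra.
Set Implicit Arguments.
Unset Strict Implicit.
Unset Printing Implicit Defensive.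
Import Order.TTheory GRing.Theory Num.Theory.
Import numFieldNormedType.Exports.
Local Open Scope classical_set_scope.
Local Open Scope ring_scope.

(* A radial [w] in the energy space equals almost everywhere its spherical mean,
   which is an integral of its gradient outside a ball; hence
   [|w(x)|^2 <= K |x|^(2 + 2a - n) ||w||^2], and at each radius the value of [w] is
   a bounded functional. So weak convergence of a bounded sequence [u_m] to [w]
   implies convergence almost everywhere, and the pointwise bound with the Hardy
   inequality controls the critical and the lower order integrals; the latter
   converges by domination.

   Write [N], [B], [C] for the three integrals of the energy. Testing the derivative
   at [u_m] with [w] gives [N w - B w - lam C w = 0], so [E w >= 0]. Testing with
   [u_m] and splitting [B] as Brezis and Lieb do, [v_m = u_m - w] satisfies
   [N v_m - B v_m -> 0] and [(d/n) N v_m -> M - E w < (d/n) S_R^(n/(2d))]. The common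
   limit [l] of [N v_m] and [B v_m] satisfies [S_R l^(2/q) <= l], so [l = 0]. *)

(** * Weak sequential compactness in semi-inner product spaces *)

(** For radial functions compactness can be lost at the origin alone: evaluation at each positive
    radius is bounded, which replaces a compact embedding. There the pointwise bound gives
    [|x|^(-n)] for the critical density, which just fails to be integrable, whence the splitting of
    [B]; for the lower order density it gives [|x|^(c - n)], which is integrable.

    An element of the space is a pair of functions and not a class, so the energy form vanishes on
    pairs that are zero almost everywhere. Compactness is therefore proved for a semi-inner product
    on a set closed under linear combinations, with limits determined up to null vectors.

    Radiality is imposed on [w.1], while the approximating test functions need not be radial and
    [w.2] is known only as a limit of their gradients. The spherical mean is for this reason written
    in terms of [w.2], where it is visibly bounded, and identified with [w.1] afterwards. *)

Lemma diagonal_subsequence (R : realType) (x : nat -> nat -> R) :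
  (forall k, exists K : R, forall m, `|x k m| <= K) ->
  exists s : nat -> nat, {homo s : i j / (i < j)%N} /\
    forall k, exists l : R, x k (s m) @[m --> \oo] --> l.
Proof.
(* An ultrafilter finer than [\oo] gives the limits of all rows at once, so a single choice of
   indices serves every row. *)
move=> bx; have [U [UU ooU]] := ultraFilterLemma (F := \oo) _.
have FU : ProperFilter U := @ultra_proper _ _ UU.
have Ul k : exists l : R, forall e : R, 0 < e -> U [set m | `|x k m - l| < e].
  have [K xK] := bx k.
  pose G : set (set R) := x k @ U.
  have GU : ProperFilter G by exact: fmap_proper_filter.
  have GK : G `[- K, K]%classic.
    apply: (@filterS _ U _ setT); last exact: filterT.
    move=> m _ /=.
    by rewrite in_itv/= -ler_norml.
  have [l [_ lG]] := @segment_compact R (- K) K G _ GK.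
  exists l => e e0.
  have [//|nU] := in_ultra_setVsetC [set m | `|x k m - l| < e] UU.
  have [||z [/= zn zb]] := lG [set y | ~ (`|y - l| < e)] (ball l e).
  - exact: nU.
  - exact: nbhsx_ballx.
  - by case: zn; move: zb; rewrite /ball /= distrC.
have [l lU] := choice Ul.
(* Stage [k] handles the rows up to [k] with error [1 / (k + 1)]: a finite intersection of members
   of [U]. *)
have pick (k N : nat) : exists m, (N < m)%N /\
    forall i, (i <= k)%N -> `|x i m - l i| < k.+1%:R^-1.
  have : U [set m | forall i, (i <= k)%N -> `|x i m - l i| < k.+1%:R^-1].
    elim: {-2}k => [|j IH].
      apply: filterS (lU 0%N (k.+1%:R^-1) _); last by rewrite invr_gt0.
      by move=> m /= xm i; rewrite leqn0 => /eqP ->.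
    apply: filterS2 IH (lU j.+1 (k.+1%:R^-1) _); last by rewrite invr_gt0.
    move=> m /= xm1 xm2 i; rewrite leq_eqVlt => /predU1P[-> //|]; exact: xm1.
  have : U [set m | (N < m)%N] by apply: ooU; exact: nbhs_infty_gt.
  by move=> U1 U2; have [m [? ?]] := filter_ex (filterI U1 U2); exists m.
have [f fP] := choice (fun kN : nat * nat => pick kN.1 kN.2).
pose s := fix s k := if k is j.+1 then f (j.+1, s j) else f (0, 0)%N.
have s_lt k : (s k < s k.+1)%N by rewrite /=; exact: (fP (_, _)).1.
have sP k i : (i <= k)%N -> `|x i (s k) - l i| < k.+1%:R^-1.
  by case: k => [|k] /=; apply (fP (_, _)).2.
exists s; split; first exact: (homo_ltn ltn_trans).
move=> k; exists (l k); apply/cvgrPdist_lt => e e0.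
near=> m; rewrite distrC; apply: lt_le_trans (sP m k _) _.
  by near: m; exact: nbhs_infty_ge.
rewrite invf_ple ?posrE//; apply: le_trans (_ : m%:R <= _); last by rewrite ler_nat.
by near: m; exact: nbhs_infty_ger.
Unshelve. all: by end_near.
Qed.

Section semi_hilbert.
Context {R : realType} {X : lmodType R}.
Implicit Types (P : set X) (B : X -> X -> R) (l : X -> R) (v : nat -> X).

(** The laws are required on [P] only, and [B x x = 0] does not force [x = 0]: two pairs that agree
    almost everywhere remain distinct vectors. *)
Record semi_inner_product P B : Prop := SemiInnerProduct {
  sip_submod : forall (k : R) x y, P x -> P y -> P (k *: x + y) ;
  sip_sym : forall x y, P x -> P y -> B x y = B y x ;
  sip_linear : forall (k : R) x y z, P x -> P y -> P z ->
    B (k *: x + y) z = k * B x z + B y z ;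
  sip_ge0 : forall x, P x -> 0 <= B x x }.

(** Squaring avoids the norm; in particular [l] vanishes on the null vectors of [B], so it does not
    separate two limits of the same sequence. *)
Definition bounded_functional P B l : Prop :=
  (forall (k : R) x y, P x -> P y -> l (k *: x + y) = k * l x + l y) /\ exists C : R, forall x, P x -> l x ^+ 2 <= C * B x x.

Definition sip_complete P B : Prop := forall v, (forall i, P (v i)) ->
  (forall e : R, 0 < e -> exists K : nat, forall i j, (K <= i)%N -> (K <= j)%N ->
     B (v i - v j) (v i - v j) < e) ->
  exists2 w, P w & B (v i - w) (v i - w) @[i --> \oo] --> 0.

(* The midpoint-convex hull of a tail of the sequence. *)
Definition midpoint_hull v m : set X := [set x | forall Q : set X,
  (forall y z, Q y -> Q z -> Q (2^-1 *: (y + z))) ->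
  (forall i, (m <= i)%N -> Q (v i)) -> Q x].

Variables (P : set X) (B : X -> X -> R).
Hypothesis PB : semi_inner_product P B.
Implicit Types x y z : X.

Let N x := B x x.

Lemma sip_sub x y : P x -> P y -> P (x - y).
Proof.
by move=> Px Py; rewrite addrC -scaleN1r; apply: (sip_submod PB).
Qed.

Lemma sip_Bl x y z : P x -> P y -> P z -> B (x - y) z = B x z - B y z.
Proof.
move=> Px Py Pz; rewrite addrC -scaleN1r (sip_linear PB)//.
by rewrite mulN1r addrC.
Qed.

Lemma sip_Br x y z : P x -> P y -> P z -> B z (x - y) = B z x - B z y.
Proof.
move=> Px Py Pz; rewrite (sip_sym PB)//; last exact: sip_sub.
by rewrite sip_Bl// !(sip_sym PB Pz).
Qed.

Lemma sip_NB x y : P x -> P y -> N (x - y) = N x - 2 * B x y + N y.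
Proof.
move=> Px Py; rewrite /N sip_Bl ?sip_Br//; try exact: sip_sub.
by rewrite (sip_sym PB Py Px); ring.
Qed.

Lemma sip_P0 x : P x -> P 0.
Proof. by move=> Px; rewrite -(subrr x); exact: sip_sub. Qed.

Lemma sip_scale (k : R) x : P x -> P (k *: x).
Proof.
by move=> Px; rewrite -[_ *: _]addr0; apply: (sip_submod PB) => //; exact: sip_P0 Px.
Qed.

Lemma sip_B0l x z : P x -> P z -> B 0 z = 0.
Proof. by move=> Px Pz; rewrite -(subrr x) sip_Bl// subrr. Qed.

Lemma sip_Zl (k : R) x z : P x -> P z -> B (k *: x) z = k * B x z.
Proof.
move=> Px Pz; rewrite -[_ *: _]addr0 (sip_linear PB)//; last exact: sip_P0 Px.
by rewrite (sip_B0l Px Pz) addr0.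
Qed.

Lemma sip_add x y : P x -> P y -> P (x + y).
Proof. by move=> Px Py; rewrite -[x]scale1r; apply: (sip_submod PB). Qed.

Lemma sip_Dl x y z : P x -> P y -> P z -> B (x + y) z = B x z + B y z.
Proof.
by move=> Px Py Pz; rewrite -[x in LHS]scale1r (sip_linear PB)// mul1r.
Qed.

Lemma sip_mid x y : P x -> P y -> P (2^-1 *: (x + y)).
Proof. by move=> Px Py; apply/sip_scale/sip_add. Qed.

Lemma sip_cauchy_schwarz x y : P x -> P y -> B x y ^+ 2 <= N x * N y.
Proof.
move=> Px Py.
have H (t : R) : 0 <= t ^+ 2 * N x - 2 * t * B x y + N y.
  have Ptx : P (t *: x) by exact: sip_scale.
  have := sip_ge0 PB (sip_sub Ptx Py); rewrite -/(N _) sip_NB//.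
  rewrite /N !(sip_Zl _ Px)//  (sip_sym PB Px Ptx) (sip_Zl _ Px)//.
  by move=> /le_trans; apply; rewrite le_eqVlt; apply/orP; left; apply/eqP; ring.
have Nx := sip_ge0 PB Px; rewrite -/(N x) in Nx.
have [Nx0|Nx0] := eqVneq (N x) 0.
  rewrite Nx0 mul0r; have [->|B0] := eqVneq (B x y) 0; first by rewrite expr0n.
  (* On a null vector [x] the inequality [H] is affine in [t], and at this [t] its right-hand side
     would be [-1]. *)
  have := H ((N y + 1) / (2 * B x y)); rewrite Nx0.
  rewrite (_ : _ + N y = -1); first by rewrite lerNr oppr0 ler10.
  by field.
have {}Nx : 0 < N x by rewrite lt_neqAle eq_sym Nx0.
have := H (B x y / N x).
rewrite (_ : _ + N y = (N x * N y - B x y ^+ 2) / N x); last by field.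
by rewrite pmulr_lge0 ?invr_gt0// subr_ge0.
Qed.

Lemma bounded_functional_sip y : P y -> bounded_functional P B (B ^~ y).
Proof.
move=> Py; split; first by move=> k x z Px Pz; apply: (sip_linear PB).
by exists (N y) => x Px; rewrite mulrC; exact: sip_cauchy_schwarz.
Qed.

Lemma functionalB l x y : bounded_functional P B l -> P x -> P y ->
  l (x - y) = l x - l y.
Proof.
by move=> [lZ _] Px Py; rewrite addrC -scaleN1r lZ// mulN1r addrC.
Qed.

Lemma functional_mid l x y : bounded_functional P B l -> P x -> P y ->
  l (2^-1 *: (x + y)) = 2^-1 * (l x + l y).
Proof.
move=> [lZ _] Px Py.
have P0 := sip_P0 Px.
have l0 : l 0 = 0.
  by have := lZ (-1) 0 0 P0 P0; rewrite scaler0 addr0 mulN1r addNr.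
rewrite -[_ *: _]addr0 lZ//; last exact: sip_add.
by rewrite l0 addr0 -[x in LHS]scale1r lZ// mul1r.
Qed.

Lemma midpoint_hull_sub v m : (forall i, P (v i)) -> midpoint_hull v m `<=` P.
Proof. by move=> Pv x hx; apply: (hx P); [move=> y z; exact: sip_mid|move=> i _; exact: Pv]. Qed.

Lemma midpoint_hull_mid v m x y : midpoint_hull v m x -> midpoint_hull v m y ->
  midpoint_hull v m (2^-1 *: (x + y)).
Proof. by move=> hx hy Q Qm Qv; exact: Qm (hx Q Qm Qv) (hy Q Qm Qv). Qed.

Lemma midpoint_hullS v m p : (m <= p)%N -> midpoint_hull v p `<=` midpoint_hull v m.
Proof.
by move=> mp x hx Q Qm Qv; apply: (hx Q) => // i pi; apply: Qv; exact: leq_trans pi.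
Qed.

(** A half-space is closed under midpoints, so it is an admissible [Q] in the definition of the
    hull. *)
Lemma midpoint_hull_ge l v m (c : R) : bounded_functional P B l ->
  (forall i, P (v i)) -> (forall i, (m <= i)%N -> c <= l (v i)) ->
  forall x, midpoint_hull v m x -> c <= l x.
Proof.
move=> bl Pv cl x hx.
suff [] : [set x | P x /\ c <= l x] x by [].
apply: (hx [set x | P x /\ c <= l x]) => [y z /= [Py ly] [Pz lz]|i mi]; last by split; [exact: Pv|exact: cl].
split; first exact: sip_mid.
rewrite (functional_mid bl)//; lra.
Qed.

(* Almost norm-minimal elements of the decreasing hulls form a Cauchy sequence,
   by the parallelogram identity. *)
Lemma midpoint_hull_limit v (K : R) : sip_complete P B -> (forall i, P (v i)) ->
  (forall i, N (v i) <= K) ->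
  exists w h, [/\ P w, forall j, midpoint_hull v j (h j) &
    N (h j - w) @[j --> \oo] --> 0].
Proof.
move=> cP Pv vK.
pose A m := [set N x | x in midpoint_hull v m].
have lbA m : has_lbound (A m).
  exists 0 => _ [x hx <-]; apply: (sip_ge0 PB); exact: midpoint_hull_sub hx.
have A0 m : A m (N (v m)) by exists (v m) => // Q _; exact.
have iA m : has_inf (A m) by split; [exists (N (v m))|].
pose rho m := inf (A m).
have rho_nd : {homo rho : m p / (m <= p)%N >-> m <= p}.
  move=> m p mp; apply: lb_le_inf; first by case: (iA p).
  move=> _ [x hx <-]; apply: ge_inf => //; exists x => //.
  exact: midpoint_hullS hx.
have rhoK m : rho m <= K.
  by apply: le_trans (vK m); apply: ge_inf => //; exact: A0.
have exh m : exists x, midpoint_hull v m x /\ N x < rho m + m.+1%:R^-1.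
  have m0 : 0 < m.+1%:R^-1 :> R by rewrite invr_gt0.
  by have [_ [x hx <-] xr] := inf_adherent m0 (iA m); exists x.
have [h hP] := choice exh.
have Ph m : P (h m) by exact: midpoint_hull_sub (hP m).1.
have [|w Pw hw] := cP h Ph; last first.
  by exists w, h; split => // j; exact: (hP j).1.
(* The midpoint of [h i] and [h j] lies in the hull of index [i], so its [N] is at least [rho i];
   the parallelogram identity with [N (h j) < rho j + 1 / (j + 1)] gives the bound. *)
have est i j : (i <= j)%N -> N (h i - h j) <= 2 * (rho j - rho i) + 4 * i.+1%:R^-1.
  move=> ij; have hm : rho i <= N (2^-1 *: (h i + h j)).
    apply: ge_inf => //; exists (2^-1 *: (h i + h j)) => //.
    apply: midpoint_hull_mid; first exact: (hP i).1.
    exact: midpoint_hullS ij _ (hP j).1.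
  have Ns : N (2^-1 *: (h i + h j)) = 4^-1 * (N (h i) + 2 * B (h i) (h j) + N (h j)).
    have Pij : P (h i + h j) by exact: sip_add.
    have Pm : P (2^-1 *: (h i + h j)) by exact: sip_mid.
    rewrite /N (sip_Zl _ Pij)// (sip_sym PB Pij Pm) (sip_Zl _ Pij)//.
    rewrite sip_Dl// !(sip_sym PB (Ph _) Pij) !sip_Dl//.
    by rewrite (sip_sym PB (Ph j) (Ph i)); field.
  have ji : j.+1%:R^-1 <= i.+1%:R^-1 :> R.
    by rewrite lef_pV2 ?posrE// ler_nat.
  rewrite sip_NB//; have [_ hi] := hP i; have [_ hj] := hP j.
  rewrite Ns in hm; move: ji hi hj hm; set ei := i.+1%:R^-1; set ej := j.+1%:R^-1 => ji hi hj hm; lra.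
move=> e e0.
(* The hulls decrease, so their infima increase, and they stay below [K]. *)
have /cvg_ex[r rr] : cvgn rho.
  by apply: nondecreasing_is_cvgn => //; exists K => _ [m _ <-].
have : \forall m \near \oo, r - e / 8 < rho m /\ m.+1%:R^-1 < e / 8.
  near=> m; split.
    near: m; move/cvgrPdist_lt: rr => /(_ (e / 8)); rewrite divr_gt0// => /(_ isT).
    by apply: filterS => m; rewrite ltr_distl; lra.
  near: m; exact: near_infty_natSinv_lt (PosNum (divr_gt0 e0 _)).
case=> K0 _ KP; exists K0.
have rhor m : rho m <= r.
  by rewrite -(cvg_lim _ rr)//; apply: nondecreasing_cvgn_le => //; apply/cvg_ex; exists r.
have main i j : (K0 <= i)%N -> (i <= j)%N -> N (h i - h j) < e.
  move=> Ki ij; apply: le_lt_trans (est _ _ ij) _.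
  have [ri] := KP i Ki; have := rhor j; move: (i.+1%:R^-1) => t; lra.
move=> i j Ki Kj; have [ij|ji] := leqP i j; first exact: main.
by have := main j i Kj (ltnW ji); rewrite -/(N (h i - h j)) !sip_NB// (sip_sym PB (Ph j) (Ph i)); lra.
Unshelve. all: by end_near.
Qed.

Lemma functional_le l C x : (forall x, P x -> l x ^+ 2 <= C * B x x) ->
  P x -> forall e : R, 0 < e -> N x < e ^+ 2 / (`|C| + 1) -> `|l x| < e.
Proof.
move=> lC Px e e0 Nx.
have C1 : 0 < `|C| + 1 by rewrite ltr_pwDr.
rewrite -(ltr_pXn2r (_ : 0 < 2)%N) ?nnegrE ?normr_ge0 ?ltW// real_normK ?num_real//.
apply: le_lt_trans (lC _ Px) _.
apply: (@le_lt_trans _ _ ((`|C| + 1) * N x)).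
  apply: ler_wpM2r; first exact: (sip_ge0 PB).
  by apply: le_trans (ler_norm _) _; rewrite lerDl.
by rewrite mulrC -ltr_pdivlMr.
Qed.

Lemma functional_cvg l v w : bounded_functional P B l -> (forall i, P (v i)) ->
  P w -> N (v i - w) @[i --> \oo] --> 0 -> l (v i) @[i --> \oo] --> l w.
Proof.
move=> bl Pv Pw vw; have [lZ [C lC]] := bl.
apply/cvgrPdist_lt => e e0.
move/cvgrPdist_lt : vw => /(_ (e ^+ 2 / (`|C| + 1))) [].
  by rewrite divr_gt0 ?exprn_gt0// ltr_pwDr.
move=> K _ KP; exists K => // i /KP /=; rewrite sub0r normrN => vi.
rewrite distrC -(functionalB bl)//; apply: (functional_le lC) => //.
  exact: sip_sub.
by apply: le_lt_trans (ler_norm _) vi.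
Qed.

Lemma bounded_functionalN l : bounded_functional P B l ->
  bounded_functional P B (fun x => - l x).
Proof.
move=> [lZ [C lC]]; split => [k x y Px Py|]; first by rewrite lZ//; ring.
by exists C => x Px; rewrite sqrrN; exact: lC.
Qed.

(** A lower bound valid on a tail passes to the hulls of that tail and then to their strong limit:
    weak information on [v] is read off from the strong convergence of [h]. *)
Lemma midpoint_hull_limit_functional l v h w (c : R) :
  bounded_functional P B l -> (forall i, P (v i)) -> P w ->
  (forall j, midpoint_hull v j (h j)) -> N (h j - w) @[j --> \oo] --> 0 ->
  (\forall i \near \oo, c <= l (v i)) -> c <= l w.
Proof.
move=> bl Pv Pw hv hw [K _ KP].
have Ph j : P (h j) by exact: midpoint_hull_sub (hv j).
have lhw := functional_cvg bl Ph Pw hw.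
apply: (cvgr_to_ge lhw).
exists K => // j /= Kj.
by apply: (midpoint_hull_ge bl Pv _ (hv j)) => i ji; apply: KP => /=; exact: leq_trans ji.
Qed.

Lemma midpoint_hull_limit_cvg l v h w (c : R) :
  bounded_functional P B l -> (forall i, P (v i)) -> P w ->
  (forall j, midpoint_hull v j (h j)) -> N (h j - w) @[j --> \oo] --> 0 ->
  l (v i) @[i --> \oo] --> c -> l w = c.
Proof.
move=> bl Pv Pw hv hw vc; apply/eqP; rewrite eq_le; apply/andP; split.
  apply/ler_addgt0Pr => e e0.
  rewrite -lerN2.
  apply: (midpoint_hull_limit_functional (bounded_functionalN bl) Pv Pw hv hw).
  move/cvgrPdist_le : vc => /(_ e e0); apply: filterS => i.
  by rewrite ler_distl lerN2 => /andP[]; lra.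
apply/ler_addgt0Pr => e e0; rewrite -lerBlDr.
apply: (midpoint_hull_limit_functional bl Pv Pw hv hw).
move/cvgrPdist_le : vc => /(_ e e0); apply: filterS => i.
by rewrite ler_distl => /andP[]; lra.
Qed.

(** The indices [t] need not increase, so a sequence of bad indices can be used as it is chosen. *)
Lemma cvg_extract (u : nat -> R) (c : R) (t : nat -> nat) :
  (forall j, (j <= t j)%N) -> u i @[i --> \oo] --> c -> u (t i) @[i --> \oo] --> c.
Proof.
move=> jt uc; apply/cvgrPdist_lt => e e0; move/cvgrPdist_lt : uc => /(_ e e0)[K _ KP].
by exists K => // i /= Ki; apply: KP => /=; exact: leq_trans (jt i).
Qed.

(* If some functional failed to converge to its value at the limit [w], the hulls
   of a bad subsequence would have another limit [w'], whereas [w' - w] is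
   orthogonal to every [v k], hence to itself. *)
Theorem weak_compactness v (K : R) : sip_complete P B -> (forall i, P (v i)) ->
  (forall i, N (v i) <= K) ->
  exists s w, [/\ {homo s : i j / (i < j)%N}, P w &
    forall l, bounded_functional P B l -> l (v (s i)) @[i --> \oo] --> l w].
Proof.
move=> cP Pv vK.
(* Along [s] the products with each [v k] converge; this is what forces two hull limits to have the
   same product with every [v k]. *)
have [|s [s_mono sP]] := @diagonal_subsequence R (fun k m => B (v m) (v k)).
  move=> k; exists (K + 1) => m.
  have K0 : 0 <= K by apply: le_trans (vK 0%N); exact: (sip_ge0 PB).
  rewrite -(ler_pXn2r (_ : 0 < 2)%N) ?nnegrE ?normr_ge0 ?addr_ge0//.
  rewrite real_normK ?num_real//; apply: le_trans (sip_cauchy_schwarz _ _) _ => //.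
  apply: (@le_trans _ _ (K * K)).
    by apply: ler_pM => //; apply: (sip_ge0 PB).
  nra.
have Psv i : P (v (s i)) by exact: Pv.
have [w [h [Pw hw hwc]]] := midpoint_hull_limit cP Psv (fun i => vK (s i)).
exists s, w; split => //.
suff one_sided l : bounded_functional P B l -> forall e : R, 0 < e ->
    \forall i \near \oo, l (v (s i)) < l w + e.
  move=> l bl; apply/cvgrPdist_lt => e e0.
  have H1 := one_sided _ bl e e0.
  have H2 := one_sided _ (bounded_functionalN bl) e e0.
  apply: filterS2 H1 H2 => i h1 h2; rewrite distrC ltr_distl; apply/andP; split; lra.
move=> bl e e0; apply: contrapT => nH.
have ext N' : exists m, (N' <= m)%N /\ l w + e <= l (v (s m)).
  apply: contrapT => H; apply: nH; exists N' => // m /= N'm.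
  by rewrite ltNge; apply/negP => lm; apply: H; exists m.
have [t tP] := choice ext.
have Pstv i : P (v (s (t i))) by exact: Pv.
have [w' [h' [Pw' hw' hwc']]] := midpoint_hull_limit cP Pstv (fun i => vK (s (t i))).
have lw' : l w + e <= l w'.
  apply: (midpoint_hull_limit_functional bl Pstv Pw' hw' hwc').
  by exists 0%N => // i _; exact: (tP i).2.
have Pd : P (w' - w) by exact: sip_sub.
have orth k : B (v k) (w' - w) = 0.
  have [c vc] := sP k.
  rewrite (sip_sym PB)// sip_Bl//.
  rewrite (midpoint_hull_limit_cvg (bounded_functional_sip (Pv k)) Psv Pw hw hwc vc).
  rewrite (midpoint_hull_limit_cvg (bounded_functional_sip (Pv k)) Pstv Pw' hw' hwc'
    (c := c)) ?subrr//.
  by apply: (cvg_extract (u := fun i => B (v (s i)) (v k))) vc => j; exact: (tP j).1.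
have bd := bounded_functional_sip Pd.
have Bw : B w (w' - w) = 0.
  apply: (midpoint_hull_limit_cvg bd Psv Pw hw hwc).
  by under eq_fun do rewrite orth; exact: cvg_cst.
have Bw' : B w' (w' - w) = 0.
  apply: (midpoint_hull_limit_cvg bd Pstv Pw' hw' hwc').
  by under eq_fun do rewrite orth; exact: cvg_cst.
(* The limits [w] and [w'] differ by a null vector, on which [l] vanishes, whereas [lw'] separates
   them by [e]. *)
have Nd : B (w' - w) (w' - w) = 0 by rewrite sip_Bl// Bw Bw' subrr.
have [_ [C lC]] := bl.
have := lC _ Pd; rewrite Nd mulr0 => ld.
have : l (w' - w) = 0.
  by apply/eqP; rewrite -sqrf_eq0 eq_le ld sqr_ge0.
rewrite (functionalB bl)//; lra.
Unshelve. all: by end_near.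
Qed.

End semi_hilbert.

(** * Lebesgue measure on row vectors *)

Section integral_setT.
Context d (T : measurableType d) {R : realType} (mu : {measure set T -> \bar R}).
Local Open Scope ereal_scope.

Lemma ge0_integralTZ (f : T -> \bar R) (k : R) : measurable_fun setT f ->
  (forall x, 0 <= f x) -> (0 <= k)%R ->
  \int[mu]_x (k%:E * f x) = k%:E * \int[mu]_x f x.
Proof. by move=> mf f0 k0; rewrite ge0_integralZl. Qed.

End integral_setT.

Section scaling.
Context {R : realType}.
Local Open Scope ereal_scope.

Lemma measurable_scale1 (t : R) :
  measurable_fun setT (fun x : measurableTypeR R => (t * x)%R : measurableTypeR R).
Proof. by apply: measurable_funM => //; exact: measurable_id. Qed.

(** The image of Lebesgue measure under [x -> t x], multiplied by [t], gives each interval its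
    length; uniqueness of Lebesgue measure does the rest. *)
Lemma ge0_integral_scale1 (t : R) (F : R -> \bar R) : (0 < t)%R ->
  measurable_fun setT F -> (forall x, 0 <= F x) ->
  \int[lebesgue_measure]_x F (t * x)%R = t^-1%:E * \int[lebesgue_measure]_x F x.
Proof.
move=> t0 mF F0.
pose nu : {measure set (measurableTypeR R) -> \bar R} :=
  measure_function_pushforward__canonical__measure_function_Measure
    (@lebesgue_measure R) (measurable_scale1 t).
have t0' : (0 <= t)%R by exact: ltW.
have E : \int[lebesgue_measure]_x F x = t%:E * \int[lebesgue_measure]_x F (t * x)%R.
  transitivity (\int[mscale (NngNum t0') nu]_x F x).
    apply: eq_measure_integral => A mA _; apply: lebesgue_measure_unique => //.
    move=> _ [[a b]] _ <-.
    rewrite [RHS](_ : _ = t%:E * lebesgue_measure `](a / t)%R, (b / t)%R]%classic); last first.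
      congr (_ * lebesgue_measure _).
      apply/seteqP; split => x /=; rewrite !in_itv/= ltr_pdivrMr// ler_pdivlMr//;
        by rewrite ![(x * t)%R]mulrC.
    rewrite !lebesgue_measure_itv/= !lte_fin ltr_pM2r ?invr_gt0//.
    case: ifPn => _; last by rewrite mule0.
    by rewrite -!EFinD -EFinM; congr (_%:E); field; rewrite gt_eqF.
  rewrite ge0_integral_mscale//=; congr (_ * _).
  by rewrite /nu/= ge0_integral_pushforward//; exact: measurable_scale1.
rewrite E muleA -EFinM mulVf ?mul1e// gt_eqF//.
Qed.

Lemma measurable_scale n (t : R) : measurable_fun setT (fun x : 'rV[R]_n => t *: x).
Proof.
apply: measurable_fun_coorP => i; under eq_fun do rewrite mxE.
by apply: measurable_funM => //; exact: measurable_coor.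
Qed.

Lemma ge0_integral_rVS n (F : 'rV[R]_n.+1 -> \bar R) :
  measurable_fun setT F -> (forall x, 0 <= F x) ->
  \int[lebesgue_rV n.+1]_x F x =
  \int[lebesgue_measure]_x \int[lebesgue_rV n]_v F (row_cons (x, v)).
Proof.
move=> mF F0.
have mr := @measurable_row_cons R n.
transitivity (\int[measure_function_pushforward__canonical__measure_function_Measure
  (@lebesgue_measure R \x lebesgue_rV n) mr]_x F x).
  by apply: eq_measure_integral => A mA _.
rewrite (ge0_integral_pushforward mr)// preimage_setT fubini_tonelli1//; first exact: measurableT_comp.
  by move=> p; exact: F0.
Qed.

Lemma row_cons_scale n (t : R) x (v : 'rV[R]_n) :
  t *: row_cons (x, v) = row_cons ((t * x)%R, t *: v).
Proof.
apply/rowP => i; rewrite mxE; case: (unliftP ord0 i) => [j ->|->].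
  by rewrite !row_consS/= mxE.
by rewrite !row_cons0.
Qed.

Lemma measurable_row_cons2 n (y : R) :
  measurable_fun setT (fun v : 'rV[R]_n => row_cons (y, v)).
Proof.
apply: measurable_fun_coorP => i; case: (unliftP ord0 i) => [j ->|->].
  by under eq_fun do rewrite row_consS/=; exact: measurable_coor.
by under eq_fun do rewrite row_cons0/=; exact: measurable_cst.
Qed.

(** Induction on the dimension: the first coordinate contributes one factor [t^-1], and the
    remaining ones are scaled inside the inner integral. *)
Lemma ge0_integral_scale n (t : R) (F : 'rV[R]_n -> \bar R) : (0 < t)%R ->
  measurable_fun setT F -> (forall x, 0 <= F x) ->
  \int[lebesgue_rV n]_x F (t *: x) = (t ^- n)%:E * \int[lebesgue_rV n]_x F x.
Proof.
move=> t0; elim: n F => [|n IH] F mF F0.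
  rewrite expr0 invr1 mul1e; apply: eq_integral => x _; congr F.
  by apply/rowP => -[].
have mr := @measurable_row_cons R n.
have mFs : measurable_fun setT (fun x : 'rV[R]_n.+1 => F (t *: x)).
  exact: measurableT_comp (measurable_scale _).
have mFr : measurable_fun setT (fun p : measurableTypeR R * 'rV[R]_n => F (row_cons p)) by exact: measurableT_comp.
rewrite !ge0_integral_rVS//.
have mFx (y : R) : measurable_fun setT (fun v : 'rV[R]_n => F (row_cons (y, v))).
  by have := measurableT_comp mF (measurable_row_cons2 y).
pose G (x : measurableTypeR R) := \int[lebesgue_rV n]_v F (row_cons (x, v)).
have mG : measurable_fun setT G.
  by apply: (measurable_fun_fubini_tonelli_F (fun p => F (row_cons p))).
have G0 x : 0 <= G x by exact: integral_ge0.
transitivity (\int[lebesgue_measure]_x ((t ^- n)%:E * G (t * x)%R)).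
  apply: eq_integral => x _; rewrite /G -IH//.
  by apply: eq_integral => v _; rewrite row_cons_scale.
have mGt := measurableT_comp mG (measurable_scale1 t).
have tn0 : (0 <= t ^- n)%R by rewrite invr_ge0 exprn_ge0// ltW.
rewrite (ge0_integralTZ (@lebesgue_measure R) mGt (fun x => G0 _) tn0).
rewrite (ge0_integral_scale1 t0 mG)//.
by rewrite muleA -EFinM exprS invfM mulrC.
Qed.

End scaling.

#[local] Opaque lebesgue_rV.

(** * Euclidean structure and measurability on row vectors *)

Section row_vectors.
Context {R : realType} {n : nat}.
Implicit Types (x y : 'rV[R]_n) (t : R).

Definition dot x y : R := \sum_(i < n) x ord0 i * y ord0 i.

Lemma dotC x y : dot x y = dot y x.
Proof. by apply: eq_bigr => i _; rewrite mulrC. Qed.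

Lemma dotDl x y z : dot (x + y) z = dot x z + dot y z.
Proof. by rewrite -big_split; apply: eq_bigr => i _; rewrite mxE mulrDl. Qed.

Lemma dotZl t x y : dot (t *: x) y = t * dot x y.
Proof. by rewrite mulr_sumr; apply: eq_bigr => i _; rewrite mxE mulrA. Qed.

Lemma dotDr x y z : dot z (x + y) = dot z x + dot z y.
Proof. by rewrite !(dotC z) dotDl. Qed.

Lemma dotZr t x y : dot x (t *: y) = t * dot x y.
Proof. by rewrite !(dotC x) dotZl. Qed.

Lemma enorm_ge0 x : 0 <= enorm x. Proof. exact: sqrtr_ge0. Qed.

Lemma sqr_enorm x : enorm x ^+ 2 = dot x x.
Proof.
rewrite /enorm sqr_sqrtr; first by apply: eq_bigr => i _; rewrite expr2.
by apply: sumr_ge0 => i _; rewrite sqr_ge0.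
Qed.

Lemma enormZ t x : enorm (t *: x) = `|t| * enorm x.
Proof.
apply/eqP; rewrite -(eqrXn2 (_ : 0 < 2)%N) ?enorm_ge0 ?mulr_ge0 ?enorm_ge0//.
by rewrite exprMn !sqr_enorm dotZl dotZr real_normK ?num_real// mulrA expr2.
Qed.

Lemma enorm0 : enorm (0 : 'rV[R]_n) = 0.
Proof. by rewrite -(scale0r (0 : 'rV[R]_n)) enormZ normr0 mul0r. Qed.

Lemma enorm_eq0 x : (enorm x == 0) = (x == 0).
Proof.
apply/eqP/eqP => [x0|->]; last exact: enorm0.
have : dot x x = 0 by rewrite -sqr_enorm x0 expr0n.
move/eqP; rewrite psumr_eq0; last by move=> i _; rewrite -expr2 sqr_ge0.
move=> /allP xi; apply/rowP => i; rewrite mxE.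
by have := xi i (mem_index_enum _); rewrite /= -expr2 sqrf_eq0 => /eqP.
Qed.

Lemma enorm_gt0 x : (0 < enorm x) = (x != 0).
Proof. by rewrite lt_def enorm_ge0 andbT enorm_eq0. Qed.

Lemma coor_le_enorm x (i : 'I_n) : `|x ord0 i| <= enorm x.
Proof.
rewrite -(ler_pXn2r (_ : 0 < 2)%N) ?nnegrE ?enorm_ge0//.
rewrite sqr_enorm real_normK ?num_real// /dot (bigD1 i)//= -expr2 lerDl.
by apply: sumr_ge0 => j _; rewrite -expr2 sqr_ge0.
Qed.

Lemma dot_le x y : 2 * dot x y <= enorm x ^+ 2 + enorm y ^+ 2.
Proof.
rewrite !sqr_enorm -big_split mulr_sumr; apply: ler_sum => i _ /=.
have := sqr_ge0 (x ord0 i - y ord0 i); rewrite sqrrB !expr2 -mulr_natl; lra.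
Qed.

(* [t] is a free scaling parameter, for absorbing one of the two terms. *)
Lemma norm_dot_le t x y : 0 < t ->
  `|dot x y| <= (t * enorm x ^+ 2 + t^-1 * enorm y ^+ 2) / 2.
Proof.
move=> t0; pose s := Num.sqrt t.
have s0 : 0 < s by rewrite sqrtr_gt0.
have st : s ^+ 2 = t by rewrite sqr_sqrtr// ltW.
have key (e : R) : e ^+ 2 = 1 -> e * dot x y <= (t * enorm x ^+ 2 + t^-1 * enorm y ^+ 2) / 2.
  move=> e1; rewrite ler_pdivlMr//.
  have := dot_le (s *: x) ((e * s^-1) *: y).
  rewrite dotZl dotZr !sqr_enorm !(dotZl, dotZr).
  rewrite (_ : 2 * _ = e * dot x y * 2); last by field; rewrite gt_eqF.
  move/le_trans; apply; rewrite mulrA -expr2 st lerD2l.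
  by rewrite mulrA -expr2 exprMn e1 mul1r exprVn st.
rewrite ler_norml; apply/andP; split; last by rewrite -[dot x y]mul1r key ?expr1n.
by rewrite lerNl -mulN1r key// sqrrN expr1n.
Qed.

Lemma cauchy_schwarz_dot x y : `|dot x y| <= enorm x * enorm y.
Proof.
have [x0|x0] := eqVneq x 0.
  by rewrite x0 enorm0 mul0r /dot big1 ?normr0// => i _; rewrite mxE mul0r.
have [y0|y0] := eqVneq y 0.
  by rewrite y0 enorm0 mulr0 /dot big1 ?normr0// => i _; rewrite mxE mulr0.
have ex : 0 < enorm x by rewrite enorm_gt0.
have ey : 0 < enorm y by rewrite enorm_gt0.
apply: le_trans (norm_dot_le x y (_ : 0 < enorm y / enorm x)) _; first by rewrite divr_gt0.
rewrite le_eqVlt; apply/orP; left; apply/eqP; field.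
by rewrite !gt_eqF.
Qed.

Lemma sqr_enormD x y : enorm (x + y) ^+ 2 <= 2 * enorm x ^+ 2 + 2 * enorm y ^+ 2.
Proof.
rewrite [leLHS]sqr_enorm dotDl !dotDr -!sqr_enorm (dotC y x).
have := dot_le x y; lra.
Qed.

Lemma enormN x : enorm (- x) = enorm x.
Proof. by rewrite -scaleN1r enormZ normrN normr1 mul1r. Qed.

Lemma enorm_le_sum x : enorm x <= \sum_(i < n) `|x ord0 i|.
Proof.
rewrite -(ler_pXn2r (_ : 0 < 2)%N) ?nnegrE ?enorm_ge0 ?sumr_ge0//.
rewrite sqr_enorm expr2 mulr_suml /dot; apply: ler_sum => i _.
rewrite -expr2 -[_ ^+ 2]ger0_norm ?sqr_ge0// normrX expr2 ler_wpM2l//.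
by rewrite (bigD1 i)//= lerDl sumr_ge0.
Qed.

Lemma measurable_enorm : measurable_fun setT (@enorm R n).
Proof.
apply: measurableT_comp; first exact: continuous_measurable_fun (@sqrt_continuous R).
by apply: measurable_sum => i; apply: measurable_funX; exact: measurable_coor.
Qed.

Lemma measurable_dot d (T : measurableType d) (D : set T) (f g : T -> 'rV[R]_n) :
  measurable_fun D f -> measurable_fun D g -> measurable_fun D (fun z => dot (f z) (g z)).
Proof.
move=> mf mg; apply: measurable_sum => i; apply: measurable_funM.
  exact: (measurableT_comp (measurable_coor i) mf).
exact: (measurableT_comp (measurable_coor i) mg).
Qed.

Lemma measurable_rV_coorP d (T : measurableType d) (D : set T) (f : T -> 'rV[R]_n) :
  measurable D -> (forall i, measurable_fun D (fun z => f z ord0 i)) ->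
  measurable_fun D f.
Proof.
move=> mD mf; pose g (z : T) : 'rV[R]_n := \row_i ((fun z => f z ord0 i) \_ D) z.
apply: (@eq_measurable_fun _ _ _ _ D g).
  by move=> z zD; apply/rowP => i; rewrite mxE patchE zD.
apply: measurable_funTS; apply: measurable_fun_coorP => i.
under eq_fun do rewrite mxE.
by apply/(measurable_restrictT _ mD).
Qed.

(** The sigma-algebra is generated by coordinates, so [f] is approached by its values at points
    rounded down to the grid of mesh [1 / (k + 1)]: each rounded function is constant on countably
    many boxes, and continuity gives the pointwise limit. *)
Lemma continuous_measurable_rV (f : 'rV[R]_n -> R) : continuous f ->
  measurable_fun setT f.
Proof.
move=> cf.
pose disc (k : nat) (z : 'rV[int]_n) : 'rV[R]_n := \row_i ((z ord0 i)%:~R / k.+1%:R).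
pose fl (k : nat) x : 'rV[int]_n := \row_i Num.floor (x ord0 i * k.+1%:R).
apply: (@measurable_fun_cvg _ _ _ setT (fun k x => f (disc k (fl k x)))).
  move=> k _ Y mY; rewrite setTI.
  rewrite (_ : _ @^-1` _ = \bigcup_z (if f (disc k z) \in Y then
      \bigcap_(i in [set: 'I_n]) ([set: 'rV[R]_n] `&` (fun x => x ord0 i) @^-1`
        `[(z ord0 i)%:~R / k.+1%:R, ((z ord0 i)%:~R + 1) / k.+1%:R[%classic) else set0)).
    apply: countable_bigcupT_measurable => [|z]; first exact: countableP.
    case: ifPn => _; last exact: measurable0.
    apply: fin_bigcap_measurable => // i _.
    exact: measurable_coor.
  apply/seteqP; split => x /=.
    move=> Yx; exists (fl k x) => //; rewrite mem_set// => i _; split => //=.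
    rewrite in_itv/= mxE ler_pdivrMr// ltr_pdivlMr//.
    by rewrite -intrD1 floor_itv.
  move=> [z _]; case: ifPn => // /set_mem Yz H; rewrite (_ : fl k x = z)//.
  apply/rowP => i; have [_ /=] := H i I; rewrite in_itv/= mxE.
  rewrite ler_pdivrMr// ltr_pdivlMr// => h.
  by apply/eqP; rewrite floor_eq intrD1.
move=> x _; suff dx : (fun k => disc k (fl k x)) @ \oo --> x.
  exact: cvg_comp dx (cf x).
apply/cvg_ballP => e e0.
near=> k; split=> // i j; rewrite ord1 !mxE /ball/=.
have k0 : 0 < k.+1%:R :> R by [].
have := floor_itv (x ord0 j * k.+1%:R); rewrite intrD1 => /andP[h1 h2].
apply: (@le_lt_trans _ _ k.+1%:R^-1); last first.
  near: k; exact: near_infty_natSinv_lt (PosNum e0).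
rewrite ler_norml -(ler_pM2r k0) -[X in _ && X](ler_pM2r k0) mulNr mulrBl mulVf// divfK ?gt_eqF//.
by apply/andP; split; lra.
Unshelve. all: by end_near.
Qed.

End row_vectors.

Section measurable_compositions.
Context d (T : measurableType d) {R : realType} {n : nat} (D : set T).

Lemma measurable_fun_powR (f : T -> R) (p : R) : measurable_fun D f ->
  measurable_fun D (fun x => f x `^ p).
Proof. by move=> mf; exact: (measurableT_comp (@measurable_powR R p) mf). Qed.

Lemma measurable_fun_inv (f : T -> R) : measurable_fun D f ->
  measurable_fun D (fun x => (f x)^-1).
Proof.
(* The identity [y^-1 = y * (y^2)^-1] reduces the inverse to a power of a nonnegative number, and it
   holds at [0], where the inverse is [0]. *)
move=> mf; rewrite (_ : (fun x => _) = (fun x => f x * (f x ^+ 2) `^ (-1))).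
  by apply: measurable_funM => //; apply/measurable_fun_powR/measurable_funX.
apply/funext => x; have [->|fx] := eqVneq (f x) 0; first by rewrite mul0r invr0.
rewrite powR_inv1 ?sqr_ge0//; field; exact: fx.
Qed.

Lemma measurable_fun_norm (f : T -> R) : measurable_fun D f ->
  measurable_fun D (fun x => `|f x|).
Proof. by move=> mf; exact: (measurableT_comp (@normr_measurable R setT) mf). Qed.

Lemma measurable_fun_indic d' (U : measurableType d') (S : set U) (f : T -> U) :
  measurable S -> measurable_fun D f -> measurable_fun D (fun x => \1_S (f x) : R).
Proof.
move=> mS mf.
exact: (measurableT_comp (@measurable_indic _ U R setT S mS) mf).
Qed.

Lemma measurable_fun_enorm (f : T -> 'rV[R]_n) : measurable_fun D f ->
  measurable_fun D (fun x => enorm (f x)).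
Proof. by move=> mf; exact: (measurableT_comp measurable_enorm mf). Qed.

Lemma measurable_fun_scale (k : T -> R) (f : T -> 'rV[R]_n) :
  measurable_fun setT k -> measurable_fun setT f ->
  measurable_fun setT (fun x => k x *: f x).
Proof.
move=> mk mf; apply: measurable_fun_coorP => i; under eq_fun do rewrite mxE.
by apply: measurable_funM => //; exact: (measurableT_comp (measurable_coor i) mf).
Qed.

Lemma measurable_fun_coor (i : 'I_n) (f : T -> 'rV[R]_n) : measurable_fun D f ->
  measurable_fun D (fun x => f x ord0 i).
Proof. by move=> mf; exact: (measurableT_comp (measurable_coor i) mf). Qed.

Lemma measurable_fun_EFin (f : T -> R) : measurable_fun D f ->
  measurable_fun D (fun x => (f x)%:E).
Proof. by move=> mf; exact/measurable_EFinP. Qed.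

End measurable_compositions.

Ltac mfun := repeat first
  [ eassumption
  | exact: measurable_cst
  | exact: measurable_id
  | exact: measurable_fst
  | exact: measurable_snd
  | match goal with
    | |- measurable_fun _ (fun x => EFin (@?f x)) => apply: (@measurable_fun_EFin _ _ _ _ f)
    | |- measurable_fun _ (fun x => (@?f x * @?g x)%E) => apply: (@emeasurable_funM _ _ _ _ f g)
    | |- measurable_fun _ (fun x => (@?f x + @?g x)%E) => apply: (@emeasurable_funD _ _ _ _ f g)
    | |- measurable_fun _ (fun x => (@?f x * @?g x)%R) => apply: (@measurable_funM _ _ _ _ f g)
    | |- measurable_fun _ (fun x => (@?f x - @?g x)%R) => apply: (@measurable_funB _ _ _ _ f g)
    | |- measurable_fun _ (fun x => (@?f x + @?g x)%R) => apply: (@measurable_funD _ _ _ _ f g)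
    | |- measurable_fun _ (fun x => (- @?f x)%R) => apply: (@measurable_funN _ _ _ _ f)
    | |- measurable_fun _ (fun x => (@?f x)^-1%R) => apply: (@measurable_fun_inv _ _ _ _ f)
    | |- measurable_fun _ (fun x => (@?f x ^+ _)%R) => apply: (@measurable_funX _ _ _ _ f)
    | |- measurable_fun _ (fun x => (@?f x `^ _)%R) => apply: (@measurable_fun_powR _ _ _ _ f)
    | |- measurable_fun _ (fun x => (`|@?f x|)%R) => apply: (@measurable_fun_norm _ _ _ _ f)
    | |- measurable_fun _ (fun x => (enorm (@?f x))) => apply: (@measurable_fun_enorm _ _ _ _ _ f)
    | |- measurable_fun _ (fun x => (dot (@?f x) (@?g x))) => apply: (@measurable_dot _ _ _ _ _ f g)
    | |- measurable_fun _ (fun x => (@?f x *: @?g x)%R) => apply: (@measurable_fun_scale _ _ _ _ f g)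
    | |- measurable_fun _ (fun x => \1_?S (@?f x)) => apply: (@measurable_fun_indic _ _ _ _ _ _ S f)
    | mF : measurable_fun [set: _] ?F |- measurable_fun _ (fun x => ?F (@?f x)) =>
        apply: (@measurableT_comp _ _ _ _ _ _ F _ f mF)
    end ].

Section lebesgue_rV_facts.
Context {R : realType} {n : nat}.
Notation mu := (@lebesgue_rV R n).
Local Open Scope ereal_scope.

Lemma measurable_rV_box (I : set R) : measurable I ->
  measurable [set x : 'rV[R]_n | forall i, I (x ord0 i)].
Proof.
move=> mI; rewrite (_ : mkset _ = \bigcap_(i in [set: 'I_n])
    ([set: 'rV[R]_n] `&` (fun x => x ord0 i) @^-1` I)).
  apply: fin_bigcap_measurable => // i _.
  by apply: measurable_coor.
by apply/seteqP; split=> x /= H i; [split=> //; exact: H|have [] := H i].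
Qed.

Lemma lebesgue_rV_ball (k : R) : mu [set x | (enorm x < k)%R] < +oo.
Proof.
have mk : measurable [set x : 'rV[R]_n | (enorm x < k)%R].
  rewrite -[X in measurable X]setTI.
  exact: (measurable_fun_ltr measurable_enorm (@measurable_cst _ _ _ _ setT k)).
pose I : set R := `[(- k)%R, k]%classic.
apply: (@le_lt_trans _ _ (mu [set x : 'rV[R]_n | forall i, I (x ord0 i)])).
  apply: le_measure; rewrite ?inE//.
    exact: measurable_rV_box (measurable_itv _).
  move=> x /= xk i; rewrite /I/= in_itv/= -ler_norml.
  by apply: le_trans (coor_le_enorm x i) _; exact: ltW.
rewrite (@lebesgue_rV_box R n (fun=> I)); last by move=> i; exact: measurable_itv.
rewrite ltey_eq; apply/orP; left.
by apply: prode_fin_num => i _; rewrite /I lebesgue_measure_itv/=; case: ifPn.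
Qed.

Lemma lebesgue_rV_set1_0 : (0 < n)%N -> mu [set 0%R] = 0.
Proof.
case: n => // m _.
rewrite (_ : [set 0%R] = [set x : 'rV[R]_m.+1 | forall i, [set 0%R : R] (x ord0 i)]).
  rewrite (@lebesgue_rV_box R m.+1 (fun=> [set 0%R]))// big_ord_recl lebesgue_measure_set1 mul0e//.
apply/seteqP; split => x /=; first by move=> -> i; rewrite mxE.
by move=> H; apply/rowP => i; rewrite H mxE.
Qed.

End lebesgue_rV_facts.

(** * Polar coordinates *)

Section polar.
Context {R : realType} {n : nat}.
Notation mu := (@lebesgue_rV R n).
Notation leb := (@lebesgue_measure R).
Local Open Scope ereal_scope.

Definition shell : set 'rV[R]_n := [set y | (1 <= enorm y < 2)%R].

Lemma measurable_enorm_preimage (A : set R) : measurable A ->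
  measurable [set x : 'rV[R]_n | A (enorm x)].
Proof.
move=> mA; rewrite -[X in measurable X]setTI.
exact: (measurable_enorm measurableT mA).
Qed.

Lemma measurable_shell : measurable shell.
Proof.
rewrite (_ : shell = [set x : 'rV[R]_n | `[1%R, 2%R[%classic (enorm x)]).
  by apply: measurable_enorm_preimage; exact: measurable_itv.
by apply/seteqP; split => x; rewrite /shell/= in_itv.
Qed.

Let pos : set R := `]0%R, +oo[%classic.

Let mpos : measurable pos. Proof. exact: measurable_itv. Qed.

Let posE (s : R) : \1_pos s = (0 < s)%R%:R :> R.
Proof.
rewrite indicE; congr (_%:R : R)%R; congr nat_of_bool.
by apply/idP/idP => [/set_mem|s0]; [|apply/mem_set]; rewrite /pos/= in_itv/= andbT.
Qed.

Let kappa_fun (s : R) : R := (\1_(`[1%R, 2%R[%classic) (s^-1) * s ^- n * \1_pos s * s^-1)%R.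

(** The integral of [s^(-n-1)] over [1/2 < s <= 1]. It is the total weight received by a point [x]
    other than the origin when the shell is dilated by all [s > 0] with density [|x/s|^n / s];
    replacing [s] by [|x| s] shows that it does not depend on [x]. *)
Definition kappa : \bar R := \int[leb]_s (kappa_fun s)%:E.

(* Polar coordinates with the directions carried by the shell
   [1 <= |y| < 2] instead of the unit sphere; only Tonelli and scaling are used. *)
Theorem polar_coordinates (F : 'rV[R]_n -> \bar R) : (0 < n)%N ->
  measurable_fun setT F -> (forall x, 0 <= F x) ->
  kappa * \int[mu]_x F x =
  \int[mu]_y \int[leb]_r ((\1_shell y * (\1_pos r * r ^+ n.-1))%:E *
     F ((r / enorm y)%R *: y)).
Proof.
move=> n0 mF F0.
have mS := measurable_shell.
have eX (z : R) : (z ^+ n = z * z ^+ n.-1)%R by rewrite -exprS prednK.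
(* Both sides are the integral of [F (s *: y)] over [s > 0] and [y] in the shell with density [A]:
   the substitution [r = s |y|] in [s] gives the right-hand side, and [x = s *: y] in [y], which
   turns [A] into [C], the left-hand side. *)
pose A (s : measurableTypeR R) (y : 'rV[R]_n) : R :=
  (\1_shell y * enorm y ^+ n * (\1_pos s * s ^+ n.-1))%R.
pose C (s : measurableTypeR R) (x : 'rV[R]_n) : R :=
  (\1_shell (s^-1 *: x) * enorm (s^-1 *: x) ^+ n * \1_pos s * s^-1)%R.
have i0 (U : Type) (B : set U) (u : U) : (0 <= \1_B u :> R)%R by rewrite indicE.
have A0 s y : (0 <= A s y)%R.
  by rewrite /A posE; case: ltP => s0; rewrite ?(mul0r, mulr0)// mul1r
    !mulr_ge0 ?i0 ?exprn_ge0 ?enorm_ge0// ltW.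
have C0 s y : (0 <= C s y)%R.
  by rewrite /C posE; case: ltP => s0; rewrite ?(mul0r, mulr0)//
    !mulr_ge0 ?i0 ?exprn_ge0 ?enorm_ge0// ?invr_ge0 ltW.
have mA : measurable_fun setT (fun p : measurableTypeR R * 'rV[R]_n =>
    (A p.1 p.2)%:E * F ((p.1 : R) *: p.2)).
  by rewrite /A; mfun.
have mC : measurable_fun setT (fun p : measurableTypeR R * 'rV[R]_n =>
    (C p.1 p.2)%:E * F p.2).
  by rewrite /C; mfun.
transitivity (\int[mu]_y \int[leb]_s ((A s y)%:E * F (s *: y))); last first.
  apply: eq_integral => y _.
  have [yS|yS] := pselect (shell y); last first.
    rewrite [LHS]integral0_eq; last first.
      by move=> s _; rewrite /A indicE memNset// !mul0r mul0e.
    by rewrite integral0_eq// => s _; rewrite indicE memNset// !mul0r mul0e.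
  have y0 : (0 < enorm y)%R by case/andP: yS => + _; apply: lt_le_trans.
  pose h (r : measurableTypeR R) := (\1_shell y * (\1_pos r * r ^+ n.-1))%:E *
     F ((r / enorm y)%R *: y).
  have mh : measurable_fun setT h by rewrite /h; mfun.
  have h0 r : 0 <= h r.
    rewrite /h posE mule_ge0// lee_fin; case: ltP => r0; last by rewrite mul0r mulr0.
    by rewrite !mulr_ge0 ?i0// exprn_ge0// ltW.
  have yn : (enorm y != 0)%R by rewrite gt_eqF.
  rewrite -[RHS]/(\int[leb]_r h r).
  rewrite (_ : \int[leb]_r h r = (enorm y)%:E * ((enorm y)^-1%:E * \int[leb]_r h r));
    last by rewrite muleA -EFinM mulfV ?mul1e.
  rewrite -(ge0_integral_scale1 y0 mh h0).
  have mhs : measurable_fun setT (fun s : R => h (enorm y * s)%R).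
    exact: (measurableT_comp mh (measurable_scale1 (enorm y))).
  rewrite -(ge0_integralTZ leb mhs (fun=> h0 _) (ltW y0)).
  apply: eq_integral => s _; rewrite /h /A muleA -EFinM; congr (_%:E * F _).
    rewrite !posE pmulr_rgt0//; case: ltP => s0; last by rewrite !(mul0r, mulr0).
    rewrite exprMn eX; ring.
  by rewrite mulrC mulKf// gt_eqF.
have tA := fubini_tonelli (m1 := leb) (m2 := mu)
  (fun p : measurableTypeR R * 'rV[R]_n => (A p.1 p.2)%:E * F ((p.1 : R) *: p.2)) mA.
rewrite -{}tA; last by move=> p; rewrite mule_ge0// lee_fin.
have tC := fubini_tonelli (m1 := leb) (m2 := mu)
  (fun p : measurableTypeR R * 'rV[R]_n => (C p.1 p.2)%:E * F p.2) mC.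
transitivity (\int[leb]_s \int[mu]_x ((C s x)%:E * F x)); last first.
  apply: eq_integral => s _; have [s0|s0] := ltP 0%R s; last first.
    rewrite integral0_eq; last first.
      by move=> x _; rewrite /C posE ltNge s0 mulr0 mul0r mul0e.
    rewrite integral0_eq// => x _.
    by rewrite /A posE ltNge s0 mul0r mulr0 mul0e.
  pose H (x : 'rV[R]_n) := (A s (s^-1 *: x))%:E * F x.
  have mH : measurable_fun setT H by rewrite /H /A; mfun.
  have H0 x : 0 <= H x by rewrite mule_ge0// lee_fin.
  have sn0 : (0 <= s ^- n)%R by rewrite invr_ge0 exprn_ge0// ltW.
  transitivity (\int[mu]_x H (s *: x)); last first.
    by apply: eq_integral => y _; rewrite /H scalerA mulVf ?gt_eqF// scale1r.
  rewrite (ge0_integral_scale s0 mH H0) -(ge0_integralTZ mu mH H0 sn0).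
  apply: eq_integral => x _; rewrite /H muleA -EFinM; congr (_%:E * _).
  rewrite /A /C !posE s0 !mul1r !mulr1 (eX s).
  by field; rewrite ?expf_neq0 ?gt_eqF.
rewrite {}tC; last by move=> p; rewrite mule_ge0// lee_fin.
have k0 : 0 <= kappa.
  apply: integral_ge0 => s _; rewrite lee_fin /kappa_fun posE.
  case: ltP => s0; rewrite ?(mul0r, mulr0)// !mulr_ge0 ?i0// ?invr_ge0 ?exprn_ge0// ltW//.
rewrite -(ge0_integralZl mu measurableT mF (fun x _ => F0 x) k0).
apply: ge0_ae_eq_integral => //.
- exact: measurable_funeM.
- by apply: (measurable_fun_fubini_tonelli_G (fun p : measurableTypeR R * 'rV[R]_n =>
    (C p.1 p.2)%:E * F p.2)) => // p; rewrite mule_ge0// lee_fin.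
- by move=> x _; rewrite mule_ge0.
- by move=> x _; apply: integral_ge0 => s _; rewrite mule_ge0// lee_fin.
(* The origin lies on no dilate of the shell, so its weight is [0] instead of [kappa]; it is a null
   set. *)
exists [set 0%R]; split.
- rewrite (_ : [set 0%R] = [set x : 'rV[R]_n | [set 0%R : R] (enorm x)]).
    exact: measurable_enorm_preimage.
  apply/seteqP; split => x /=; first by move=> ->; rewrite enorm0.
  by move/eqP; rewrite enorm_eq0 => /eqP.
- exact: lebesgue_rV_set1_0.
move=> x /= /not_implyP[_]; apply: contra_notP => /eqP x0.
have ex : (0 < enorm x)%R by rewrite enorm_gt0.
have mCx : measurable_fun setT (fun s : R => (C s x)%:E) by rewrite /C; mfun.
rewrite (ge0_integralZr leb measurableT mCx) => //; last first.
  by move=> s _; rewrite lee_fin.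
congr (_ * _).
have xn : (enorm x != 0)%R by rewrite gt_eqF.
rewrite (_ : \int[leb]_s (C s x)%:E = (enorm x)%:E * ((enorm x)^-1%:E * \int[leb]_s (C s x)%:E));
  last by rewrite muleA -EFinM mulfV ?mul1e.
rewrite -(ge0_integral_scale1 ex mCx) => [|s]; last by rewrite lee_fin.
have mCs : measurable_fun setT (fun s : R => (C (enorm x * s)%R x)%:E).
  exact: (measurableT_comp mCx (measurable_scale1 (enorm x))).
rewrite -(ge0_integralTZ leb mCs _ (ltW ex)) => [|s]; last by rewrite lee_fin.
apply: eq_integral => s _; rewrite -EFinM; congr (_%:E).
rewrite /kappa_fun /C !posE pmulr_rgt0//; case: ltP => s0; last by rewrite !(mul0r, mulr0).
have En : enorm ((enorm x * s)^-1 *: x)%R = (s^-1)%R.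
  rewrite enormZ ger0_norm ?invr_ge0 ?mulr_ge0 ?ltW//.
  by field; rewrite !gt_eqF.
rewrite !mulr1 En exprVn (_ : \1_shell _ = \1_(`[1%R, 2%R[%classic) (s^-1)%R)%R.
  by field; rewrite !gt_eqF ?exprn_gt0.
rewrite !indicE; congr (_%:R : R)%R; congr nat_of_bool.
by apply/idP/idP => /set_mem h; apply/mem_set; move: h; rewrite /shell/= in_itv/= En.
Qed.

End polar.

(** * Integrals of powers on intervals and half-lines *)

Section one_dimensional_integrals.
Context {R : realType}.
Notation leb := (@lebesgue_measure R).

Lemma integral_is_derive (f F : R -> R) (u v : R) : u <= v ->
  (forall x, u <= x <= v -> is_derive x 1 F (f x)) ->
  (forall x, u <= x <= v -> {for x, continuous f}) ->
  (\int[leb]_(x in `[u, v]) (f x)%:E = (F v - F u)%:E)%E.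
Proof.
rewrite le_eqVlt => /predU1P[<- _ _|uv dF cf].
  by rewrite set_itv1 integral_set1 subrr.
have cF x : u <= x <= v -> {for x, continuous F}.
  move=> /dF dFx; apply/differentiable_continuous/derivable1_diffP.
  exact: ex_derive.
rewrite (@continuous_FTC2 _ f F u v)//.
- by apply: continuous_in_subspaceT => x /set_mem; rewrite /= in_itv/= => /cf.
- split.
  + by move=> x; rewrite in_itv/= => /andP[? ?]; apply: ex_derive; apply: dF; rewrite !ltW.
  + by apply: cvg_at_right_filter; apply: cF; rewrite lexx ltW.
  + by apply: cvg_at_left_filter; apply: cF; rewrite lexx ltW.
- move=> x; rewrite in_itv/= => /andP[? ?]; rewrite derive1E.
  by apply: derive_val; apply: dF; rewrite !ltW.
Qed.

Lemma integral_powR (p u v : R) : p != 0 -> 0 < u -> u <= v ->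
  (\int[leb]_(x in `[u, v]) (x `^ (p - 1))%:E = ((v `^ p - u `^ p) / p)%:E)%E.
Proof.
move=> p0 u0 uv; rewrite mulrBl.
apply: (@integral_is_derive (fun x : R => x `^ (p - 1)) (fun x : R => x `^ p / p)) => // x
  /andP[ux _]; have x0 : 0 < x by exact: lt_le_trans ux.
  have := is_derive1_powR p x0 => d.
  rewrite (_ : x `^ (p - 1) = p^-1 *: (p * x `^ (p - 1))); last first.
    by rewrite /GRing.scale/= mulrA mulVf// mul1r.
  rewrite (_ : (fun x : R => _) = p^-1 \*: (fun x => x `^ p)).
    exact: is_deriveZ.
  by apply/funext => y; rewrite mulrC.
apply/differentiable_continuous/derivable1_diffP.
exact: (@ex_derive _ _ _ _ _ _ _ (is_derive1_powR (p - 1) x0)).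
Qed.

Lemma integral_powR_bigcup_le (p c : R) (I : (set R)^nat) : nondecreasing_seq I ->
  (forall k, measurable (I k)) ->
  (forall k, \int[leb]_(x in I k) (x `^ p)%:E <= c%:E)%E ->
  (\int[leb]_(x in \bigcup_k I k) (x `^ p)%:E <= c%:E)%E.
Proof.
move=> ndI mI Ic.
have mf (D : set R) : measurable_fun D (fun x : R => (x `^ p)%:E) by mfun.
have f0 k x : I k x -> (0 <= (x `^ p)%:E)%E by rewrite lee_fin powR_ge0.
have H : ((\int[leb]_(x in I k) (x `^ p)%:E)%E @[k --> \oo] -->
    (\int[leb]_(x in \bigcup_k I k) (x `^ p)%:E)%E).
  by apply: ge0_nondecreasing_set_cvg_integral => // k; exact: mf.
rewrite -(cvg_lim _ H)//; apply: lime_le; first by apply/cvg_ex; eexists; exact: H.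
by apply: nearW => k; exact: Ic.
Qed.

Lemma integral_powR_le0 (p : R) : 0 < p ->
  (\int[leb]_(x in `]0%R, 1%R]) (x `^ (p - 1))%:E <= p^-1%:E)%E.
Proof.
move=> p0.
pose I (k : nat) : set R := `[k.+1%:R^-1, 1]%classic.
have -> : `]0%R, 1%R]%classic = \bigcup_k I k.
  apply/seteqP; split => x /=; last first.
    move=> [k _]; rewrite /I/= !in_itv/= => /andP[kx ->]; rewrite andbT.
    by apply: lt_le_trans kx; rewrite invr_gt0.
  rewrite in_itv/= => /andP[x0 x1].
  have [k _ kx] := near_infty_natSinv_lt (PosNum x0).
  exists k => //; rewrite /I/= in_itv/= x1 andbT ltW//; exact: (kx k (leqnn k)).
apply: integral_powR_bigcup_le => [|k|k]; last 2 first.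
- exact: measurable_itv.
- have k0 : 0 < k.+1%:R^-1 :> R by rewrite invr_gt0.
  rewrite integral_powR ?gt_eqF//; last by rewrite invf_le1// ler1n.
  by rewrite lee_fin powR1 ler_pdivrMr// mulVf ?gt_eqF// gerBl powR_ge0.
move=> k m km; apply/subsetPset => x; rewrite /I/= !in_itv/= => /andP[kx ->].
by rewrite andbT; apply: le_trans kx; rewrite lef_pV2 ?posrE// ler_nat.
Qed.

Lemma integral_powR_ley (p u : R) : 0 < p -> 0 < u ->
  (\int[leb]_(x in `[u, +oo[) (x `^ (- p - 1))%:E <= (u `^ (- p) / p)%:E)%E.
Proof.
move=> p0 u0.
pose I (k : nat) : set R := `[u, u + k%:R]%classic.
have -> : `[u, +oo[%classic = \bigcup_k I k.
  apply/seteqP; split => x /=; last first.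
    by move=> [k _]; rewrite /I/= !in_itv/= andbT => /andP[].
  rewrite in_itv/= andbT => ux.
  exists (Num.truncn (x - u)).+1 => //; rewrite /I/= in_itv/= ux -lerBlDl.
  by apply/ltW/truncnS_gt.
apply: integral_powR_bigcup_le => [|k|k]; last 2 first.
- exact: measurable_itv.
- rewrite integral_powR ?oppr_eq0 ?gt_eqF// ?lerDl//.
  rewrite lee_fin invrN mulrN -mulNr opprB ler_pM2r ?invr_gt0//.
  by rewrite gerBl powR_ge0.
move=> k m km; apply/subsetPset => x; rewrite /I/= !in_itv/= => /andP[->] /=.
by move=> /le_trans; apply; rewrite lerD2l ler_nat.
Qed.

End one_dimensional_integrals.

Section integral_indicator.
Context d (T : measurableType d) {R : realType} (mu : {measure set T -> \bar R}).
Local Open Scope ereal_scope.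

Lemma integral_indicM (D : set T) (f : T -> R) :
  \int[mu]_(x in D) (f x)%:E = \int[mu]_x (\1_D x * f x)%:E.
Proof.
rewrite integral_mkcond; apply: eq_integral => x _.
by rewrite patchE indicE; case: ifPn => _; rewrite ?mul1r ?mul0r.
Qed.

Lemma ge0_le_integralT (f g : T -> \bar R) : (forall x, 0 <= f x) ->
  measurable_fun setT f -> measurable_fun setT g ->
  (forall x, f x <= g x) -> \int[mu]_x f x <= \int[mu]_x g x.
Proof. by move=> f0 mf mg fg; apply: ge0_le_integral. Qed.

Lemma indic_ge0 (D : set T) (x : T) : (0 <= \1_D x :> R)%R.
Proof. by rewrite indicE. Qed.

Lemma indicT1 (D : set T) (x : T) : D x -> \1_D x = 1%R :> R.
Proof. by move=> Dx; rewrite indicE mem_set. Qed.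

Lemma indicF0 (D : set T) (x : T) : ~ D x -> \1_D x = 0%R :> R.
Proof. by move=> Dx; rewrite indicE memNset. Qed.

End integral_indicator.

(** * Integrals of functions of the Euclidean norm *)

Section radial_integrals.
Context {R : realType} {n : nat}.
Notation mu := (@lebesgue_rV R n).
Notation leb := (@lebesgue_measure R).
Local Open Scope ereal_scope.
Hypothesis n0 : (0 < n)%N.

Let pos : set R := `]0%R, +oo[%classic.
Let mpos : measurable pos. Proof. exact: measurable_itv. Qed.

Let Npos (s : R) : (s <= 0)%R -> ~ pos s.
Proof. by move=> s0; rewrite /pos/= in_itv/= andbT; apply/negP; rewrite -leNgt. Qed.

Let Ppos (s : R) : (0 < s)%R -> pos s.
Proof. by move=> s0; rewrite /pos/= in_itv/= andbT. Qed.

Let J : set R := `[1%R, 2%R[%classic.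
Let mJ : measurable J. Proof. exact: measurable_itv. Qed.

Let kf (s : R) : R := (\1_J (s^-1) * s ^- n * \1_pos s * s^-1)%R.

Let kf_ge0 s : (0 <= kf s)%R.
Proof.
rewrite /kf; have [s0|s0] := ltP 0%R s; last by rewrite (indicF0 (Npos s0)) !(mulr0, mul0r).
by rewrite !mulr_ge0 ?indic_ge0 ?invr_ge0 ?exprn_ge0 ?ltW.
Qed.

Let mkf : measurable_fun setT (fun s : R => (kf s)%:E).
Proof. by rewrite /kf; mfun. Qed.

Let kappaE : @kappa R n = \int[leb]_s (kf s)%:E. Proof. by []. Qed.

Lemma kappa_gt0 : 0 < @kappa R n.
Proof.
(* On [[3/4, 1]] the inverse [1/s] stays in [[1, 2[], so the integrand is [s^(-n-1) >= 1]. *)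
pose I : set R := `[(2^-1 + 4^-1)%R, 1%R]%classic.
have mI : measurable I by exact: measurable_itv.
apply: (@lt_le_trans _ _ (\int[leb]_s (\1_I s)%:E)).
  rewrite integral_indic// setIT [ltRHS]lebesgue_measure_itv/=.
  rewrite lte_fin ifT -?EFinB ?lte_fin; lra.
rewrite kappaE; apply: ge0_le_integralT => [s|||s]; [by rewrite lee_fin indic_ge0|by mfun|exact: mkf|].
rewrite lee_fin; have [sI|sI] := pselect (I s); last by rewrite indicF0// kf_ge0.
rewrite indicT1//; move: sI; rewrite /I/= in_itv/= => /andP[s1 s2].
have s0 : (0 < s)%R by lra.
rewrite /kf (indicT1 (Ppos s0)) indicT1 ?mulr1 ?mul1r; last first.
  rewrite /J/= in_itv/= invf_ge1// s2/= invf_plt ?posrE//; lra.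
by rewrite -exprVn -exprSr exprVn invf_ge1 ?exprn_gt0// exprn_ile1// ltW.
Qed.

Lemma kappa_lty : @kappa R n < +oo.
Proof.
pose I : set R := `[0%R, 1%R]%classic.
have mI : measurable I by exact: measurable_itv.
apply: (@le_lt_trans _ _ (\int[leb]_s ((2 ^+ n.+1)%:E * (\1_I s)%:E))).
  rewrite kappaE; apply: ge0_le_integralT => [s|||s]; [by rewrite lee_fin kf_ge0|exact: mkf|by mfun|].
  rewrite -EFinM lee_fin /kf.
  have [s0|s0] := ltP 0%R s; last first.
    by rewrite (indicF0 (Npos s0)) mulr0 mul0r mulr_ge0 ?indic_ge0 ?exprn_ge0.
  have [sI|sI] := pselect (J (s^-1)%R); last first.
    by rewrite indicF0// !mul0r mulr_ge0 ?indic_ge0 ?exprn_ge0.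
  move: (sI); rewrite /J/= in_itv/= invf_ge1// => /andP[s1 s2].
  rewrite (indicT1 (Ppos s0)) (indicT1 sI) indicT1 ?mulr1 ?mul1r; last first.
    by rewrite /I/= in_itv/= s1 ltW.
  by rewrite -exprVn -exprSr lerXn2r ?nnegrE ?invr_ge0 ?ltW.
have mi : measurable_fun setT (fun s : R => (\1_I s : R)%:E) by mfun.
have k0 : (0 <= 2 ^+ n.+1 :> R)%R by rewrite exprn_ge0.
rewrite (ge0_integralTZ leb mi _ k0) => [|s]; last by rewrite lee_fin indic_ge0.
rewrite integral_indic// setIT [X in _ * X]lebesgue_measure_itv/=.
by rewrite lte_fin ltr01 -EFinB -EFinM ltry.
Qed.

Lemma kappa_fin : @kappa R n = (fine (@kappa R n))%:E.
Proof. by rewrite fineK// ge0_fin_numE ?kappa_lty// ltW// kappa_gt0. Qed.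

Lemma shell_lty : mu shell < +oo.
Proof.
apply: le_lt_trans (@lebesgue_rV_ball R n 2).
apply: le_measure; rewrite ?inE.
- exact: measurable_shell.
- rewrite (_ : mkset _ = [set x : 'rV[R]_n | `]-oo, 2%R[%classic (enorm x)]).
    by apply: measurable_enorm_preimage; exact: measurable_itv.
  by apply/seteqP; split => x /=; rewrite in_itv.
- by move=> x /andP[].
Qed.

(** Consequence of the polar formula, since [F] does not see the direction [y]; the quotient of
    [mu shell] by [kappa] plays the role of the area of the unit sphere. *)
Lemma radial_integral (rho : R -> \bar R) : measurable_fun setT rho ->
  (forall r, 0 <= rho r) ->
  @kappa R n * \int[mu]_x rho (enorm x) =
  mu shell * \int[leb]_r ((\1_pos r * r ^+ n.-1)%:E * rho r).
Proof.
move=> mrho rho0.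
have mF : measurable_fun setT (fun x : 'rV[R]_n => rho (enorm x)).
  exact: (measurableT_comp mrho measurable_enorm).
rewrite polar_coordinates//.
have mS := @measurable_shell R n.
pose c := \int[leb]_r ((\1_pos r * r ^+ n.-1)%:E * rho r).
have p0 r : (0 <= \1_pos r * r ^+ n.-1)%R.
  have [r0|r0] := ltP 0%R r; first by rewrite mulr_ge0 ?indic_ge0// exprn_ge0// ltW.
  by rewrite (indicF0 (Npos r0)) mul0r.
have c0 : 0 <= c by apply: integral_ge0 => r _; rewrite mule_ge0// lee_fin.
have mk : measurable_fun setT (fun r : R => (\1_pos r * r ^+ n.-1)%:E * rho r) by mfun.
transitivity (\int[mu]_y ((\1_shell y)%:E * c)).
  apply: eq_integral => y _; have [yS|yS] := pselect (shell y); last first.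
    rewrite indicF0// mul0e integral0_eq// => r _.
    by rewrite mul0r mul0e.
  rewrite indicT1// mul1e; apply: eq_integral => r _.
  rewrite mul1r; have [r0|r0] := ltP 0%R r; last first.
    by rewrite (indicF0 (Npos r0)) mul0r !mul0e.
  congr (_ * rho _); case/andP: yS => y1 _.
  have y0 : (0 < enorm y)%R by apply: lt_le_trans y1.
  by rewrite enormZ ger0_norm ?divr_ge0 ?ltW// divfK// gt_eqF.
have mi : measurable_fun setT (fun y : 'rV[R]_n => (\1_shell y : R)%:E) by mfun.
rewrite (ge0_integralZr mu measurableT mi)//.
by congr (_ * _); rewrite integral_indic ?setIT.
Qed.

(** Were the shell null, the radial formula for the constant [1] would make the whole space null,
    although the unit cube has measure [1]. *)
Lemma shell_gt0 : 0 < mu shell.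
Proof.
rewrite lt_neqAle measure_ge0 andbT; apply/eqP => S0.
have := @radial_integral (cst 1) (@measurable_cst _ _ _ _ setT 1) (fun=> lee01).
rewrite -S0 mul0e integral_cst// mul1e => /eqP.
rewrite mule_eq0 gt_eqF ?kappa_gt0//= => /eqP muT.
pose I : set R := `[0%R, 1%R]%classic.
have : mu [set x : 'rV[R]_n | forall i, I (x ord0 i)] <= mu setT.
  apply: le_measure; rewrite ?inE//; exact: measurable_rV_box (measurable_itv _).
rewrite muT (@lebesgue_rV_box R n (fun=> I)); last by move=> i; exact: measurable_itv.
rewrite big1 => [|i _]; first by rewrite leNgt lte01.
by rewrite [LHS]lebesgue_measure_itv/= lte_fin ltr01 sube0.
Qed.

Lemma shell_fin : mu shell = (fine (mu shell))%:E.
Proof. by rewrite fineK// ge0_fin_numE ?shell_lty. Qed.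

Lemma radial_power_integral (I : set R) (p : R) : measurable I ->
  @kappa R n * \int[mu]_(x in [set x | I (enorm x)]) (enorm x `^ (p - n%:R))%:E =
  mu shell * \int[leb]_(r in I `&` pos) (r `^ (p - 1))%:E.
Proof.
move=> mI; pose rho r := (\1_I r * r `^ (p - n%:R))%:E.
have -> : \int[mu]_(x in [set x | I (enorm x)]) (enorm x `^ (p - n%:R))%:E =
    \int[mu]_x rho (enorm x).
  rewrite integral_indicM; apply: eq_integral => x _; rewrite /rho.
  have [xI|xI] := pselect (I (enorm x)); first by rewrite !indicT1.
  by rewrite !indicF0.
rewrite radial_integral => [||r]; last 2 first.
- by rewrite /rho; mfun.
- by rewrite lee_fin mulr_ge0 ?indic_ge0 ?powR_ge0.
rewrite [in RHS]integral_indicM; congr (_ * _); apply: eq_integral => r _.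
rewrite /rho -EFinM; congr (_%:E).
have [r0|r0] := ltP 0%R r; last first.
  by rewrite (indicF0 (Npos r0)) indicF0 ?mul0r// => -[_ /(Npos r0)].
rewrite (indicT1 (Ppos r0)) mul1r.
have -> : \1_(I `&` pos) r = \1_I r :> R.
  have [rI|rI] := pselect (I r); last by rewrite !indicF0// => -[].
  by rewrite !indicT1//; split => //; exact: Ppos.
rewrite mulrCA; congr (_ * _)%R.
rewrite -powR_mulrn ?ltW// -powRD; last by rewrite (gt_eqF r0) implybT.
congr (_ `^ _)%R; have -> : (n%:R = n.-1%:R + 1 :> R)%R by rewrite natr1 prednK.
ring.
Qed.

Lemma ball_power_integral (p : R) : (0 < p)%R ->
  \int[mu]_(x in open_unit_ball) (enorm x `^ (p - n%:R))%:E < +oo.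
Proof.
move=> p0; pose I : set R := `]-oo, 1%R[%classic.
have -> : @open_unit_ball R n = [set x | I (enorm x)].
  by apply/seteqP; split => x; rewrite /I/= in_itv.
have mI : measurable I by exact: measurable_itv.
have := radial_power_integral p mI.
have : \int[leb]_(r in I `&` pos) (r `^ (p - 1))%:E <= p^-1%:E.
  apply: le_trans (integral_powR_le0 p0); apply: ge0_subset_integral => //.
  - exact: measurableI.
  - by mfun.
  - by move=> r _; rewrite lee_fin powR_ge0.
  - move=> r; rewrite /I /pos/= !in_itv/= andbT => -[r1 ->] /=; exact: ltW.
move=> le1 E; rewrite ltNge leye_eq; apply/negP => /eqP Eoo.
move: E; rewrite Eoo gt0_muley ?kappa_gt0// => E.
suff : +oo < +oo :> \bar R by [].
rewrite [ltLHS]E; apply: le_lt_trans (_ : mu shell * p^-1%:E < +oo).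
  exact: lee_wpmul2l.
by rewrite shell_fin -EFinM ltry.
Qed.

Lemma exterior_power_integral (p u : R) : (0 < p)%R -> (0 < u)%R ->
  \int[mu]_(x in [set x | (u <= enorm x)%R]) (enorm x `^ (- p - n%:R))%:E <=
  (fine (mu shell) / fine (@kappa R n) / p * u `^ (- p))%:E.
Proof.
move=> p0 u0; pose I : set R := `[u, +oo[%classic.
have -> : [set x : 'rV[R]_n | (u <= enorm x)%R] = [set x | I (enorm x)].
  by apply/seteqP; split => x; rewrite /I/= in_itv/= andbT.
have mI : measurable I by exact: measurable_itv.
have := radial_power_integral (- p) mI.
have Ip : I `&` pos = I.
  rewrite setIidl// => x; rewrite /I /pos/= !in_itv/= !andbT; exact: lt_le_trans.
rewrite Ip kappa_fin shell_fin.
have k0 : (0 < fine (@kappa R n))%R by rewrite -lte_fin -kappa_fin kappa_gt0.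
have := integral_powR_ley p0 u0; rewrite -/I.
set A := \int[leb]_(r in I) _; set B := \int[mu]_(x in _) _ => leA E.
have -> : B = (fine (@kappa R n))^-1%:E * ((fine (@kappa R n))%:E * B).
  by rewrite muleA -EFinM mulVf ?gt_eqF// mul1e.
rewrite E; apply: (@le_trans _ _ ((fine (@kappa R n))^-1%:E * ((fine (mu shell))%:E *
    (u `^ (- p) / p)%:E))).
  apply: lee_wpmul2l; first by rewrite lee_fin invr_ge0 ltW.
  by apply: lee_wpmul2l => //; rewrite lee_fin fine_ge0.
by rewrite -!EFinM lee_fin le_eqVlt; apply/orP; left; apply/eqP; ring.
Qed.

End radial_integrals.

(** * Test functions and the Hardy inequality *)

Section test_function_calculus.
Context {R : realType} {n : nat}.
Implicit Types (f g : 'rV[R]_n -> R) (Om : set 'rV[R]_n).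

Lemma partialZD (k : R) f g (i : 'I_n) : (forall x, differentiable f x) ->
  (forall x, differentiable g x) ->
  partial i (k *: f + g) = k *: partial i f + partial i g.
Proof.
move=> df dg; apply/funext => x; rewrite /partial.
have dfx : derivable f x (delta_mx ord0 i) by exact: diff_derivable.
have dgx : derivable g x (delta_mx ord0 i) by exact: diff_derivable.
by rewrite deriveD ?deriveZ//; exact: derivableZ.
Qed.

Lemma foldr_partialZD (k : R) f g (s : seq 'I_n) : smooth f -> smooth g ->
  foldr (@partial R n) (k *: f + g) s = k *: foldr (@partial R n) f s + foldr (@partial R n) g s.
Proof.
move=> sf sg; elim: s => [//|i s /= ->].
by rewrite partialZD.
Qed.

Lemma smoothZD (k : R) f g : smooth f -> smooth g -> smooth (k *: f + g).
Proof.
move=> sf sg s x; rewrite foldr_partialZD//; apply: differentiableD; last exact: sg.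
by apply: differentiableZ; exact: sf.
Qed.

Lemma test_functionZD Om (k : R) f g : test_function Om f -> test_function Om g ->
  test_function Om (k *: f + g).
Proof.
move=> [sf cf fO] [sg cg gO].
have sub : closure [set x | (k *: f + g) x != 0] `<=`
    closure [set x | f x != 0] `|` closure [set x | g x != 0].
  rewrite -closureU; apply: closure_subset => x /= kfg.
  have [fx|] := eqVneq (f x) 0; last by left.
  have [gx|] := eqVneq (g x) 0; last by right.
  by move: kfg; rewrite (_ : (k *: f + g) x = k * f x + g x)// fx gx mulr0 addr0 eqxx.
split; first exact: smoothZD.
  apply: subclosed_compact (compactU cf cg) sub; exact: closed_closure.
by move=> x /sub [/fO|/gO].
Qed.

Lemma smooth_continuous f : smooth f -> continuous f.
Proof. by move=> sf x; apply: differentiable_continuous; exact: (sf [::]). Qed.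

Lemma smooth_partial_continuous f i : smooth f -> continuous (partial i f).
Proof. by move=> sf x; apply: differentiable_continuous; exact: (sf [:: i]). Qed.

Lemma smooth_measurable f : smooth f -> measurable_fun setT f.
Proof. move=> sf; apply: continuous_measurable_rV; exact: smooth_continuous. Qed.

Lemma gradient_measurable f : smooth f -> measurable_fun setT (gradient f).
Proof.
move=> sf; apply: measurable_fun_coorP => i; under eq_fun do rewrite mxE.
apply: continuous_measurable_rV; exact: smooth_partial_continuous.
Qed.

Lemma gradientZD (k : R) f g : smooth f -> smooth g ->
  gradient (k *: f + g) = k *: gradient f + gradient g.
Proof.
move=> sf sg; apply/funext => x; apply/rowP => i; rewrite !mxE.
rewrite partialZD; [by []|exact: (sf [::])|exact: (sg [::])].
Qed.

Lemma test_function_eq0 Om f x : test_function Om f -> ~ Om x -> f x = 0.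
Proof.
move=> [_ _ fO] Ox; apply/eqP; apply: contrapT => fx; apply: Ox; apply: fO.
by apply: subset_closure => /=; apply/negP.
Qed.

Lemma gradient_supp f x : ~ closure [set y | f y != 0] x -> gradient f x = 0.
Proof.
move=> nx; apply/rowP => i; rewrite !mxE /partial.
have nf : \forall y \near x, f y = cst 0 y.
  have oC : open (~` closure [set y | f y != 0]) by apply: closed_openC; exact: closed_closure.
  apply: filterS (open_nbhs_nbhs (conj oC nx)) => y ny.
  by apply/eqP; apply: contrapT => fy; apply: ny; apply: subset_closure => /=; apply/negP.
by rewrite (near_eq_derive _ nf) derive_cst.
Qed.

Lemma gradient_eq0 Om f x : test_function Om f -> ~ Om x -> gradient f x = 0.
Proof. by move=> [_ _ fO] Ox; apply: gradient_supp => /fO. Qed.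

Lemma continuous_compact_bound (A : set 'rV[R]_n) f : continuous f -> compact A ->
  exists K : R, forall x, A x -> `|f x| <= K.
Proof.
move=> cf cA.
have /compact_bounded [K [_ KP]] : compact (f @` A).
  by apply: continuous_compact => //; exact: continuous_subspaceT.
exists (K + 1) => x Ax; apply: (KP (K + 1)); last by exists x.
by rewrite ltrDl.
Qed.

Lemma test_function_bounded Om f : test_function Om f ->
  exists K : R, forall x, `|f x| <= K.
Proof.
move=> [sf cf _]; have [K KP] := continuous_compact_bound (smooth_continuous sf) cf.
exists (Num.max K 0) => x; have [->|fx] := eqVneq (f x) 0.
  by rewrite normr0 le_max lexx orbT.
by rewrite le_max KP//; exact: subset_closure.
Qed.

Lemma gradient_bounded Om f : test_function Om f ->
  exists K : R, forall x, enorm (gradient f x) <= K.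
Proof.
move=> [sf cf _].
have /choice[K KP] : forall i, exists K : R, forall x,
    closure [set x | f x != 0] x -> `|partial i f x| <= K.
  by move=> i; apply: continuous_compact_bound => //; exact: smooth_partial_continuous.
exists (\sum_(i < n) Num.max (K i) 0) => x; apply: le_trans (enorm_le_sum _) _.
have [cx|nx] := pselect (closure [set x | f x != 0] x).
  by apply: ler_sum => i _; rewrite mxE le_max KP.
by rewrite gradient_supp//; apply: ler_sum => i _; rewrite mxE normr0 le_max lexx orbT.
Qed.

Lemma derive_dot f x v : differentiable f x -> 'D_v f x = dot (gradient f x) v.
Proof.
move=> df; rewrite deriveE// [in LHS](row_sum_delta v) linear_sum/=; apply: eq_bigr => i _.
by rewrite linearZ/= mxE /partial deriveE// mulrC.
Qed.

Lemma is_derive_ray f y t : smooth f ->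
  is_derive (t : R) 1 (fun t : R => f (t *: y)) (dot (gradient f (t *: y)) y).
Proof.
move=> sf; have df := sf [::] (t *: y); rewrite -(derive_dot y df).
have /derivableP[D1 D2] := @diff_derivable _ _ _ f (t *: y) y df.
have E : (fun h : R => h^-1 *: (((fun t : R => f (t *: y)) \o shift t) (h *: 1) - f (t *: y))) =
    (fun h => h^-1 *: ((f \o shift (t *: y)) (h *: y) - f (t *: y))).
  apply/funext => h /=; congr (_ *: (f _ - _)).
  by rewrite (_ : h *: 1 = h) ?scalerDl//; exact: mulr1.
by split; rewrite /derivable /derive/= E.
Qed.

Lemma smooth_continuous_scale f y : smooth f ->
  continuous (fun t : R => f (t *: y)).
Proof.
move=> sf t; apply/differentiable_continuous/derivable1_diffP.
by have [] := is_derive_ray y t sf.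
Qed.

Lemma smooth_partial i f : smooth f -> smooth (partial i f).
Proof. by move=> sf s x; have := sf (rcons s i) x; rewrite foldr_rcons. Qed.

Lemma continuous_dot_ray f y : smooth f ->
  continuous (fun t : R => dot (gradient f (t *: y)) y).
Proof.
move=> sf t; rewrite /dot.
rewrite (_ : (fun _ => _) = \sum_(i < n) (fun t => partial i f (t *: y) * y ord0 i)).
  apply: (@big_ind _ (fun h : R -> R => {for t, continuous h})).
  - exact: cvg_cst.
  - by move=> g h cg ch; apply: continuousD.
  - move=> i _; apply: continuousM; last exact: cvg_cst.
    exact: (@smooth_continuous_scale (partial i f) y (smooth_partial i sf) t).
by apply/funext => u; rewrite fct_sumE; apply: eq_bigr => i _; rewrite mxE.
Qed.

End test_function_calculus.

(** * Test functions along rays *)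

Section rays.
Context {R : realType} {n : nat}.
Notation mu := (@lebesgue_rV R n).
Notation leb := (@lebesgue_measure R).
Notation Om := (@open_unit_ball R n).
Implicit Types (f : 'rV[R]_n -> R).

Lemma measurable_ball1 : measurable Om.
Proof.
rewrite (_ : Om = [set x | (`]-oo, 1%R[%classic : set R) (enorm x)]).
  by apply: measurable_enorm_preimage; exact: measurable_itv.
by apply/seteqP; split => x; rewrite /= in_itv.
Qed.

Lemma integral_ray (F : R -> R) (h : R -> R) (s T : R) : s <= T ->
  (forall t : R, is_derive t 1 F (h t)) -> continuous h ->
  (forall t, T <= t -> h t = 0) ->
  (\int[leb]_(t in `[s, +oo[) (h t)%:E = (F T - F s)%:E)%E.
Proof.
move=> sT dF ch h0.
have <- := @integral_is_derive _ h F s T sT (fun x _ => dF x) (fun x _ => ch x).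
rewrite [LHS]integral_indicM [RHS]integral_indicM; apply: eq_integral => t _.
have [tT|tT] := leP T t; first by rewrite h0// !mulr0.
congr (_ * _)%:E; rewrite !indicE; congr (_%:R); congr nat_of_bool.
apply/idP/idP => /set_mem H; apply/mem_set; move: H; rewrite /= !in_itv/= ?andbT.
  by move=> ->; exact: ltW.
by case/andP.
Qed.

Lemma out_of_ball (y : 'rV[R]_n) (t : R) : y != 0 -> (enorm y)^-1 <= t -> ~ Om (t *: y).
Proof.
rewrite -enorm_gt0 => y0 yt; have t0 : 0 < t by apply: lt_le_trans yt; rewrite invr_gt0.
rewrite /open_unit_ball/= enormZ gtr0_norm// => h.
by move: yt; rewrite leNgt -[X in (_ < X)]mul1r ltr_pdivlMr// h.
Qed.

Lemma ray_formula f (y : 'rV[R]_n) s : test_function Om f -> y != 0 ->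
  (\int[leb]_(t in `[s, +oo[) (dot (gradient f (t *: y)) y)%:E = (- f (s *: y))%:E)%E.
Proof.
move=> tf y0; have [sf _ _] := tf.
pose T := Num.max s (enorm y)^-1.
have sT : s <= T by rewrite le_max lexx.
have h0 t : T <= t -> dot (gradient f (t *: y)) y = 0.
  rewrite ge_max => /andP[_ yt].
  rewrite (gradient_eq0 tf); last exact: out_of_ball.
  by rewrite /dot big1// => i _; rewrite mxE mul0r.
rewrite (integral_ray sT (fun t => is_derive_ray y t sf) (@continuous_dot_ray _ _ f y sf) h0).
rewrite (test_function_eq0 tf) ?sub0r//; apply: out_of_ball => //.
by rewrite le_max lexx orbT.
Qed.

(** The fundamental theorem applied to [f^2] along the ray, which leaves the ball; the absolute
    value inside makes the integrand fit for Tonelli. *)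
Lemma ray_square f (y : 'rV[R]_n) : test_function Om f -> y != 0 ->
  ((f y ^+ 2)%:E <= \int[leb]_(t in `[1%R, +oo[)
     (`|2 * f (t *: y) * dot (gradient f (t *: y)) y|)%:E)%E.
Proof.
move=> tf y0; have [sf _ _] := tf.
pose T := Num.max 1 (enorm y)^-1.
pose h t := 2 * f (t *: y) * dot (gradient f (t *: y)) y.
have ch : continuous h.
  move=> t; apply: cvgM; last exact: (@continuous_dot_ray _ _ f y sf t).
  by apply: cvgM; [exact: cvg_cst|exact: (@smooth_continuous_scale _ _ f y sf t)].
have E : (\int[leb]_(t in `[1%R, +oo[) (h t)%:E = (- f y ^+ 2)%:E)%E.
  have sT : 1 <= T by rewrite le_max lexx.
  have h0 t : T <= t -> h t = 0.
    rewrite ge_max => /andP[_ yt].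
    by rewrite /h (test_function_eq0 tf) ?mulr0 ?mul0r//; exact: out_of_ball.
  have dh t : is_derive (t : R) 1 (fun t : R => f (t *: y) ^+ 2) (h t).
    have d := is_derive_ray y t sf.
    have [d1 d2] := @is_deriveX _ _ _ 2 _ _ _ d.
    by split; [exact: d1|exact: d2].
  rewrite (integral_ray sT dh ch h0).
  rewrite (test_function_eq0 tf) ?expr0n ?sub0r ?scale1r//; apply: out_of_ball => //.
  by rewrite le_max lexx orbT.
have mh : measurable_fun (`[1%R, +oo[%classic : set R) (EFin \o h).
  apply/measurable_EFinP; apply: measurable_funTS; exact: continuous_measurable_fun.
have := @le_abse_integral _ _ _ leb _ _ (measurable_itv _) mh.
by rewrite /= E/= normrN ger0_norm ?sqr_ge0.
Qed.

End rays.

Section hardy.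
Context {R : realType} {n : nat} (a : R).
Notation mu := (@lebesgue_rV R n).
Notation leb := (@lebesgue_measure R).
Notation Om := (@open_unit_ball R n).
Implicit Types (f : 'rV[R]_n -> R).
Hypothesis n_gt2 : (2 < n)%N.
Hypothesis a_lt : a < (n%:R - 2) / 2.
Local Open Scope ereal_scope.

(** The Hardy weight [|x|^(-2(a+1))] is [|x|^(gap - n)], so its integrability at the origin is the
    positivity of [gap], that is the hypothesis on [a]. *)
Definition gap : R := (n%:R - 2 - 2 * a)%R.

Lemma gap_gt0 : (0 < gap)%R. Proof. by have := a_lt; rewrite ltr_pdivlMr// => h; rewrite /gap subr_gt0 mulrC. Qed.

Definition hardy_integral (D : set 'rV[R]_n) (u : 'rV[R]_n -> R) : \bar R :=
  \int[mu]_(x in D) (enorm x `^ (- 2 * (a + 1)) * u x ^+ 2)%:E.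

Lemma ae_neq0 : {ae mu, forall x, x != 0%R}.
Proof.
exists [set 0%R]; split.
- rewrite (_ : [set 0%R] = [set x : 'rV[R]_n | [set 0%R : R] (enorm x)]).
    exact: measurable_enorm_preimage.
  apply/seteqP; split => x /=; first by move=> ->; rewrite enorm0.
  by move/eqP; rewrite enorm_eq0 => /eqP.
- by apply: lebesgue_rV_set1_0; exact: ltn_trans n_gt2.
- by move=> x /= /negP; rewrite negbK => /eqP.
Qed.

Let m1 := @measurable_ball1 R n.

(** Finiteness is what allows half of the Hardy integral to be absorbed into the left-hand side in
    [hardy_test]. *)
Lemma hardy_integral_test_lty f : test_function Om f -> hardy_integral Om f < +oo.
Proof.
move=> tf; have [K KP] := test_function_bounded tf; have [sf _ _] := tf.
have mf := smooth_measurable sf.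
apply: (@le_lt_trans _ _ (\int[mu]_(x in Om) ((K ^+ 2)%:E * (enorm x `^ (gap - n%:R))%:E))).
  apply: ge0_le_integral => //.
  - by move=> x _; rewrite lee_fin mulr_ge0 ?powR_ge0 ?sqr_ge0.
  - by apply: measurable_funTS; have := @measurable_enorm R n => me; mfun.
  - by apply: measurable_funTS; have := @measurable_enorm R n => me; mfun.
  move=> x _; rewrite -EFinM lee_fin mulrC (_ : gap - n%:R = - 2 * (a + 1))%R; last by rewrite /gap; ring.
  apply: ler_wpM2r; first exact: powR_ge0.
  by rewrite -real_normK ?num_real// lerXn2r ?nnegrE// (le_trans _ (KP x)).
rewrite ge0_integralZl//.
- apply: lte_mul_pinfty; rewrite ?lee_fin ?sqr_ge0//.
  by apply: ball_power_integral; [exact: ltn_trans n_gt2|exact: gap_gt0].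
- by apply: measurable_funTS; have := @measurable_enorm R n => me; mfun.
- by move=> x _; rewrite lee_fin powR_ge0.
- by rewrite lee_fin sqr_ge0.
Qed.

Lemma dirichlet_test_lty f : test_function Om f -> dirichlet a Om (gradient f) < +oo.
Proof.
move=> tf; have [K KP] := gradient_bounded tf; have [sf _ _] := tf.
have mf := gradient_measurable sf.
apply: (@le_lt_trans _ _ (\int[mu]_(x in Om) ((K ^+ 2)%:E * (enorm x `^ ((gap + 2) - n%:R))%:E))).
  apply: ge0_le_integral => //.
  - by move=> x _; rewrite lee_fin mulr_ge0 ?powR_ge0 ?sqr_ge0.
  - by apply: measurable_funTS; have := @measurable_enorm R n => me; mfun.
  - by apply: measurable_funTS; have := @measurable_enorm R n => me; mfun.
  move=> x _; rewrite -EFinM lee_fin mulrC (_ : gap + 2 - n%:R = - 2 * a)%R; last by rewrite /gap; ring.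
  apply: ler_wpM2r; first exact: powR_ge0.
  by rewrite lerXn2r ?nnegrE ?enorm_ge0// (le_trans _ (KP x))// enorm_ge0.
rewrite ge0_integralZl//.
- apply: lte_mul_pinfty; rewrite ?lee_fin ?sqr_ge0//.
  apply: ball_power_integral; first exact: ltn_trans n_gt2.
  by have := gap_gt0; lra.
- by apply: measurable_funTS; have := @measurable_enorm R n => me; mfun.
- by move=> x _; rewrite lee_fin powR_ge0.
- by rewrite lee_fin sqr_ge0.
Qed.

End hardy.

Section hardy_test.
Context {R : realType} {n : nat} (a : R).
Notation mu := (@lebesgue_rV R n).
Notation leb := (@lebesgue_measure R).
Notation Om := (@open_unit_ball R n).
Notation g := (@gap R n a).
Implicit Types (f : 'rV[R]_n -> R).
Hypothesis n_gt2 : (2 < n)%N.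
Hypothesis a_lt : a < (n%:R - 2) / 2.
Local Open Scope ereal_scope.

Let n0 : (0 < n)%N. Proof. exact: ltn_trans n_gt2. Qed.
Let m1 := @measurable_ball1 R n.
Let me := @measurable_enorm R n.
Let g0 : (0 < @gap R n a)%R. Proof. exact: gap_gt0. Qed.

Let w (x : 'rV[R]_n) : R := (enorm x `^ (- 2 * (a + 1)))%R.
Let w_ge0 x : (0 <= w x)%R. Proof. exact: powR_ge0. Qed.

Lemma integral_ballT (F : 'rV[R]_n -> R) : (forall x, ~ Om x -> F x = 0%R) ->
  \int[mu]_(x in Om) (F x)%:E = \int[mu]_x (F x)%:E.
Proof.
move=> F0; rewrite integral_indicM; apply: eq_integral => x _; congr (_%:E).
have [xO|xO] := pselect (Om x); first by rewrite indicT1// mul1r.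
by rewrite F0// mulr0.
Qed.

Let G f (z : 'rV[R]_n) : R := (w z * `|2 * f z * dot (gradient f z) z|)%R.

Let measurable_G f : test_function Om f -> measurable_fun setT (G f).
Proof.
move=> [sf _ _]; have mf := smooth_measurable sf; have mg := gradient_measurable sf.
by rewrite /G /w; mfun.
Qed.

(** After [ray_square] and an exchange of integrals, the substitution [z = t *: x] extracts a factor
    [t^(-g-1)] from the inner integral, and the integral of this factor over [t >= 1] is at most
    [g^-1]. *)
Let hardy_radial_bound f : test_function Om f ->
  hardy_integral a Om f <= (@gap R n a)^-1%:E * \int[mu]_z (G f z)%:E.
Proof.
move=> tf; have [sf _ _] := tf.
have mf := smooth_measurable sf; have mg := gradient_measurable sf.
rewrite /hardy_integral integral_ballT; last first.
  by move=> x /(test_function_eq0 tf) ->; rewrite expr0n mulr0.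
pose I : set R := `[1%R, +oo[%classic.
have mI : measurable I by exact: measurable_itv.
pose K (t : measurableTypeR R) (x : 'rV[R]_n) : R :=
  (\1_I t * (w x * `|2 * f (t *: x) * dot (gradient f (t *: x)) x|))%R.
have K0 t x : (0 <= K t x)%R by rewrite !mulr_ge0 ?indic_ge0.
have mK : measurable_fun setT (fun p : measurableTypeR R * 'rV[R]_n => (K p.1 p.2)%:E).
  by rewrite /K /w; mfun.
apply: (@le_trans _ _ (\int[mu]_x \int[leb]_t (K t x)%:E)).
  apply: ae_ge0_le_integral => //.
  - by move=> x _; rewrite lee_fin mulr_ge0 ?powR_ge0 ?sqr_ge0.
  - by rewrite /w; mfun.
  - by move=> x _; apply: integral_ge0 => t _; rewrite lee_fin.
  - by apply: (measurable_fun_fubini_tonelli_G (fun p : measurableTypeR R * 'rV[R]_n => (K p.1 p.2)%:E)) => // p; rewrite lee_fin.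
  apply: filterS (@ae_neq0 R n n_gt2) => x x0 _.
  rewrite EFinM; have := ray_square tf x0.
  rewrite -(@lee_pmul2l _ (w x)%:E)//; last by rewrite lte_fin powR_gt0 ?enorm_gt0.
  move/le_trans; apply; rewrite integral_indicM.
  set h := fun t : R => (\1_I t * `|2 * f (t *: x) * dot (gradient f (t *: x)) x|)%R.
  have mh : measurable_fun setT (fun t : R => (h t)%:E) by rewrite /h; mfun.
  rewrite -(ge0_integralTZ leb mh)// => [|t]; last by rewrite lee_fin mulr_ge0 ?indic_ge0.
  rewrite le_eqVlt; apply/orP; left; apply/eqP; apply: eq_integral => t _.
  by rewrite -EFinM /K /h; congr (_%:E); ring.
have := fubini_tonelli (m1 := leb) (m2 := mu)
  (fun p : measurableTypeR R * 'rV[R]_n => (K p.1 p.2)%:E) mK.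
move=> /= <-; last by move=> p; rewrite lee_fin.
have mG := measurable_G tf.
have G0 z : 0 <= (G f z)%:E by rewrite lee_fin mulr_ge0.
have mGE : measurable_fun setT (fun z => (G f z)%:E) by mfun.
have -> : \int[leb]_t \int[mu]_x (K t x)%:E =
    \int[leb]_t ((\1_I t * t `^ (- g - 1))%:E * \int[mu]_z (G f z)%:E).
  apply: eq_integral => t _; have [tI|tI] := pselect (I t); last first.
    rewrite indicF0// mul0r mul0e integral0_eq// => x _.
    by rewrite /K indicF0// mul0r.
  rewrite indicT1// mul1r.
  have t1 : (1 <= t)%R by move: tI; rewrite /I/= in_itv/= andbT.
  have t0 : (0 < t)%R by exact: lt_le_trans t1.
  have t2 : (0 <= t `^ (2 * a + 1))%R by exact: powR_ge0.
  have -> : (t `^ (- g - 1) = t `^ (2 * a + 1) * t ^- n)%R.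
    rewrite -powR_mulrn ?ltW// -powRN -powRD ?(gt_eqF t0) ?implybT//.
    by congr (_ `^ _)%R; rewrite /gap; ring.
  rewrite EFinM -muleA -(ge0_integral_scale t0 mGE G0).
  have mGt : measurable_fun setT (fun x : 'rV[R]_n => (G f (t *: x))%:E).
    exact: (measurableT_comp mGE (measurable_scale t)).
  rewrite -(ge0_integralTZ mu mGt _ t2)//.
  apply: eq_integral => x _; rewrite -EFinM; congr (_%:E).
  rewrite /K /G indicT1// mul1r /w enormZ (gtr0_norm t0) dotZr powRM ?enorm_ge0 ?ltW//.
  rewrite (mulrCA _ t) [in RHS]normrM (gtr0_norm t0).
  have -> : (t `^ (2 * a + 1) = t `^ (2 * (a + 1)) * t^-1)%R.
    rewrite -(powR_inv1 (ltW t0)) -powRD ?(gt_eqF t0) ?implybT//.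
    by congr (_ `^ _)%R; ring.
  have -> : (t `^ (- 2 * (a + 1)) = (t `^ (2 * (a + 1)))^-1)%R by rewrite mulNr powRN.
  by field; rewrite !gt_eqF ?powR_gt0.
have mI2 : measurable_fun setT (fun t : R => (\1_I t * t `^ (- g - 1))%:E) by mfun.
rewrite (ge0_integralZr leb measurableT mI2); last 2 first.
- by move=> t _; rewrite lee_fin mulr_ge0 ?indic_ge0 ?powR_ge0.
- exact: integral_ge0.
apply: lee_wpmul2r; first exact: integral_ge0.
by rewrite -integral_indicM; have := integral_powR_ley g0 ltr01; rewrite powR1 mul1r.
Qed.

Lemma hardy_test f : test_function Om f ->
  hardy_integral a Om f <= (4 / g ^+ 2)%:E * dirichlet a Om (gradient f).
Proof.
move=> tf; have [sf _ _] := tf.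
have mf := smooth_measurable sf; have mg := gradient_measurable sf.
have Hfin := hardy_integral_test_lty n_gt2 a_lt tf.
have Dfin := dirichlet_test_lty n_gt2 a_lt tf.
have H0 : 0 <= hardy_integral a Om f.
  by apply: integral_ge0 => x _; rewrite lee_fin mulr_ge0 ?powR_ge0 ?sqr_ge0.
have D0 : 0 <= dirichlet a Om (gradient f).
  by apply: integral_ge0 => x _; rewrite lee_fin mulr_ge0 ?powR_ge0 ?sqr_ge0.
(* With this parameter in Young's inequality the Hardy integral returns with coefficient
   [g^-1 * e = 1/2], and absorbing it leaves the constant [4 / g^2]. *)
pose e := (g / 2)%R.
have e0 : (0 < e)%R by rewrite divr_gt0.
have young (A B : R) : (2 * A * B <= e * A ^+ 2 + e^-1 * B ^+ 2)%R.
  rewrite -(ler_pM2l e0) (_ : e * (_ + _) = e ^+ 2 * A ^+ 2 + B ^+ 2)%R; last first.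
    by field; rewrite gt_eqF.
  by have := sqr_ge0 (e * A - B)%R; rewrite sqrrB exprMn -mulr_natl; nra.
have GHD : \int[mu]_z (G f z)%:E <= e%:E * hardy_integral a Om f + e^-1%:E * dirichlet a Om (gradient f).
  rewrite /hardy_integral /dirichlet !integral_ballT; last 2 first.
  - by move=> x /(gradient_eq0 tf) ->; rewrite enorm0 expr0n mulr0.
  - by move=> x /(test_function_eq0 tf) ->; rewrite expr0n mulr0.
  have mH : measurable_fun setT (fun x : 'rV[R]_n => (enorm x `^ (- 2 * (a + 1)) * f x ^+ 2)%:E) by mfun.
  have mD : measurable_fun setT (fun x : 'rV[R]_n => (enorm x `^ (- 2 * a) * enorm (gradient f x) ^+ 2)%:E).
    by mfun.
  rewrite -(ge0_integralTZ mu mH _ (ltW e0)) => [|x]; last by rewrite lee_fin mulr_ge0 ?powR_ge0 ?sqr_ge0.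
  have ei : (0 <= e^-1)%R by rewrite invr_ge0 ltW.
  rewrite -(ge0_integralTZ mu mD _ ei) => [|x]; last by rewrite lee_fin mulr_ge0 ?powR_ge0 ?sqr_ge0.
  pose h1 (x : 'rV[R]_n) := e%:E * (enorm x `^ (- 2 * (a + 1)) * f x ^+ 2)%:E.
  pose h2 (x : 'rV[R]_n) := e^-1%:E * (enorm x `^ (- 2 * a) * enorm (gradient f x) ^+ 2)%:E.
  have mh1 : measurable_fun setT h1 by rewrite /h1; mfun.
  have mh2 : measurable_fun setT h2 by rewrite /h2; mfun.
  have p1 x : setT x -> 0 <= h1 x.
    by move=> _; rewrite mule_ge0 ?lee_fin ?(ltW e0)// mulr_ge0 ?powR_ge0 ?sqr_ge0.
  have p2 x : setT x -> 0 <= h2 x.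
    by move=> _; rewrite mule_ge0 ?lee_fin// mulr_ge0 ?powR_ge0 ?sqr_ge0.
  rewrite -(ge0_integralD mu measurableT p1 mh1 p2 mh2) /h1 /h2.
  apply: ge0_le_integralT => [z|||z].
  - by rewrite lee_fin mulr_ge0.
  - by have := measurable_G tf => mG; mfun.
  - exact: (emeasurable_funD mh1 mh2).
  rewrite -!EFinM -EFinD lee_fin /G.
  have [->|z0] := eqVneq z 0%R.
    rewrite (_ : dot _ _ = 0%R) ?mulr0 ?normr0 ?mulr0; last by rewrite -(scale0r (0%R : 'rV[R]_n)) dotZr mul0r.
    by apply: addr_ge0; (apply: mulr_ge0; [by first [exact: ei|exact: ltW]|by rewrite mulr_ge0 ?powR_ge0 ?sqr_ge0]).
  have ez : (0 < enorm z)%R by rewrite enorm_gt0.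
  have -> : (enorm z `^ (- 2 * a) = w z * enorm z ^+ 2)%R.
    rewrite /w -powR_mulrn ?ltW// -powRD ?(gt_eqF ez) ?implybT//.
    by congr (_ `^ _)%R; ring.
  have key : (`|2 * f z * dot (gradient f z) z| <= e * f z ^+ 2 + e^-1 * (enorm z ^+ 2 * enorm (gradient f z) ^+ 2))%R.
    apply: (@le_trans _ _ (2 * `|f z| * (enorm (gradient f z) * enorm z))%R).
      by rewrite !normrM (ger0_norm (ler0n _ 2)) ler_wpM2l ?mulr_ge0 ?cauchy_schwarz_dot.
    rewrite -(real_normK (num_real (f z))).
    set A := `|f z|%R; set B := (enorm (gradient f z) * enorm z)%R.
    have -> : (enorm z ^+ 2 * enorm (gradient f z) ^+ 2 = B ^+ 2)%R by rewrite /B exprMn mulrC.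
    exact: young.
  rewrite (_ : (e * _ + _)%R = (w z * (e * f z ^+ 2 + e^-1 * (enorm z ^+ 2 * enorm (gradient f z) ^+ 2)))%R).
    by apply: ler_wpM2l.
  by rewrite /w; ring.
have Hb := hardy_radial_bound tf.
move: Hfin Dfin H0 D0 GHD Hb.
case: (hardy_integral a Om f) => [H| |] //; case: (dirichlet a Om _) => [D| |] // _ _.
rewrite !lee_fin => H0 D0 GHD Hb.
have : (H <= g^-1 * (e * H + e^-1 * D))%R.
  rewrite -lee_fin; apply: le_trans Hb _; rewrite EFinM; apply: lee_wpmul2l => //.
  by rewrite lee_fin invr_ge0 ltW.
have -> : ((g)^-1 * (e * H + e^-1 * D) = H / 2 + 2 / g ^+ 2 * D)%R.
  by rewrite /e; field; rewrite gt_eqF.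
have -> : (4 / g ^+ 2 * D = 2 * (2 / g ^+ 2 * D))%R by ring.
set C := (2 / _ * D)%R; lra.
Qed.

End hardy_test.

(** * The radial energy space *)

Section fatou_ae.
Context d (T : measurableType d) {R : realType} (mu : {measure set T -> \bar R}).
Local Open Scope ereal_scope.

Lemma fatou_ae (D : set T) (f_ : nat -> T -> \bar R) (f : T -> \bar R) (c : \bar R) :
  measurable D -> (forall k, measurable_fun D (f_ k)) -> measurable_fun D f ->
  (forall k x, D x -> 0 <= f_ k x) -> (forall x, D x -> 0 <= f x) ->
  {ae mu, forall x, D x -> f_ k x @[k --> \oo] --> f x} ->
  (\forall k \near \oo, \int[mu]_(x in D) f_ k x <= c) ->
  \int[mu]_(x in D) f x <= c.
Proof.
move=> mD mf_ mf f_0 f0 cv lec.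
have E : \int[mu]_(x in D) f x = \int[mu]_(x in D) limn_einf (f_^~ x).
  apply: ae_eq_integral => //.
  - rewrite (_ : (fun x => _) = (fun x => - limn_esup (fun k => - f_ k x))).
      apply: measurableT_comp => //; apply: measurable_fun_limn_esup => k.
      exact: measurableT_comp.
    by apply/funext => x; rewrite -limn_einfN; congr limn_einf; apply/funext => k /=; rewrite oppeK.
  - apply: filterS cv => x cvx Dx.
    by rewrite is_cvg_limn_einfE; [apply/esym/cvg_lim => //; exact: cvx|apply/cvg_ex; exists (f x); exact: cvx].
rewrite E; apply: le_trans (fatou mu mD mf_ f_0) _.
rewrite limn_einf_lim; apply: lime_le; first exact: is_cvg_einfs.
apply: filterS lec => k; apply: le_trans.
by apply: ereal_inf_lbound; exists k => /=.
Qed.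

End fatou_ae.

Lemma cvge0P {R : realType} (u : nat -> \bar R) : (forall k, (0 <= u k)%E) ->
  (u k @[k --> \oo] --> 0%E) <->
  (forall e : R, 0 < e -> \forall k \near \oo, (u k <= e%:E)%E).
Proof.
move=> u0; split => [/fine_cvgP[uf /cvgrPdist_le cu] e e0|H].
  apply: filterS2 uf (cu e e0) => k ufk; rewrite sub0r normrN => ue.
  by rewrite -(fineK ufk) lee_fin (le_trans (ler_norm _)).
apply/fine_cvgP; split.
  by apply: filterS (H 1 ltr01) => k uk; rewrite ge0_fin_numE// (le_lt_trans uk) ?ltry.
apply/cvgrPdist_le => e e0; apply: filterS (H e e0) => k uk.
rewrite sub0r normrN ger0_norm ?fine_ge0// -lee_fin fineK//.
by rewrite ge0_fin_numE// (le_lt_trans uk) ?ltry.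
Qed.

Section dirichlet_space.
Context {R : realType} {n : nat} (a : R).
Notation mu := (@lebesgue_rV R n).
Notation Om := (@open_unit_ball R n).
Hypothesis n_gt2 : (2 < n)%N.
Hypothesis a_lt : a < (n%:R - 2) / 2.
Implicit Types (g h : 'rV[R]_n -> 'rV[R]_n) (D : set 'rV[R]_n).
Local Open Scope ereal_scope.

Let m1 := @measurable_ball1 R n.
Let me := @measurable_enorm R n.
Let g0 : (0 < @gap R n a)%R. Proof. exact: gap_gt0. Qed.

Lemma measurable_dirichlet D g : measurable_fun D g ->
  measurable_fun D (fun x => (enorm x `^ (- 2 * a) * enorm (g x) ^+ 2)%:E).
Proof. by move=> mg; mfun. Qed.

Lemma dirichlet_ge0 D g : 0 <= dirichlet a D g.
Proof. by apply: integral_ge0 => x _; rewrite lee_fin mulr_ge0 ?powR_ge0 ?sqr_ge0. Qed.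

Lemma dirichletZ D (k : R) g : measurable D -> measurable_fun D g ->
  dirichlet a D (fun x => k *: g x) = (k ^+ 2)%:E * dirichlet a D g.
Proof.
move=> mD mg; rewrite /dirichlet -ge0_integralZl//.
- apply: eq_integral => x _; rewrite -EFinM; congr (_%:E).
  by rewrite enormZ exprMn real_normK ?num_real//; ring.
- exact: measurable_dirichlet.
- by move=> x _; rewrite lee_fin mulr_ge0 ?powR_ge0 ?sqr_ge0.
- by rewrite lee_fin sqr_ge0.
Qed.

Lemma measurable_rVD D g h : measurable D -> measurable_fun D g -> measurable_fun D h ->
  measurable_fun D (fun x => g x + h x)%R.
Proof.
move=> mD mg mh; apply: measurable_rV_coorP => // i; under eq_fun do rewrite mxE.
by apply: measurable_funD; apply: measurable_fun_coor.
Qed.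

Lemma measurable_rVZ D (k : R) g : measurable D -> measurable_fun D g ->
  measurable_fun D (fun x => k *: g x)%R.
Proof.
move=> mD mg; apply: measurable_rV_coorP => // i; under eq_fun do rewrite mxE.
by apply: measurable_funM => //; apply: measurable_fun_coor.
Qed.

Lemma measurable_rVB D g h : measurable D -> measurable_fun D g -> measurable_fun D h ->
  measurable_fun D (fun x => g x - h x)%R.
Proof.
move=> mD mg mh; under eq_fun do rewrite -scaleN1r.
by apply: measurable_rVD => //; exact: measurable_rVZ.
Qed.

Lemma dirichletD D g h : measurable D -> measurable_fun D g -> measurable_fun D h ->
  dirichlet a D (fun x => g x + h x)%R <= 2%:E * dirichlet a D g + 2%:E * dirichlet a D h.
Proof.
move=> mD mg mh; rewrite /dirichlet.
have Mg := measurable_dirichlet mg; have Mh := measurable_dirichlet mh.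
have p (f : 'rV[R]_n -> 'rV[R]_n) x : 0 <= (enorm x `^ (- 2 * a) * enorm (f x) ^+ 2)%:E.
  by rewrite lee_fin mulr_ge0 ?powR_ge0 ?sqr_ge0.
rewrite -(ge0_integralZl mu mD Mg (fun x _ => p g x))//.
rewrite -(ge0_integralZl mu mD Mh (fun x _ => p h x))//.
rewrite -ge0_integralD//.
- apply: ge0_le_integral => //.
  + by move=> x _; rewrite lee_fin mulr_ge0 ?powR_ge0 ?sqr_ge0.
  + exact: (measurable_dirichlet (measurable_rVD mD mg mh)).
  + by apply: emeasurable_funD; apply: measurable_funeM.
  + move=> x _; rewrite -!EFinM -EFinD lee_fin.
    have := ler_wpM2l (powR_ge0 (enorm x) (- 2 * a)) (sqr_enormD (g x) (h x)).
    by move/le_trans; apply; rewrite le_eqVlt; apply/orP; left; apply/eqP; ring.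
- by move=> x _; rewrite mule_ge0.
- exact: measurable_funeM.
- by move=> x _; rewrite mule_ge0.
- exact: measurable_funeM.
Qed.

Lemma dirichletN D g : dirichlet a D (fun x => - g x)%R = dirichlet a D g.
Proof. by apply: eq_integral => x _; rewrite enormN. Qed.

Lemma dirichletB_sym D g h :
  dirichlet a D (fun x => g x - h x)%R = dirichlet a D (fun x => h x - g x)%R.
Proof. by rewrite -dirichletN; apply: eq_integral => x _; rewrite opprB. Qed.

Lemma dirichlet_triangle D g h (k : 'rV[R]_n -> 'rV[R]_n) : measurable D ->
  measurable_fun D g -> measurable_fun D h -> measurable_fun D k ->
  dirichlet a D (fun x => g x - h x)%R <=
  2%:E * dirichlet a D (fun x => g x - k x)%R + 2%:E * dirichlet a D (fun x => k x - h x)%R.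
Proof.
move=> mD mg mh mk; rewrite (_ : dirichlet a D (fun x => g x - h x)%R =
  dirichlet a D (fun x => (g x - k x) + (k x - h x))%R).
  by apply: dirichletD => //; exact: measurable_rVB.
by apply: eq_integral => x _; rewrite addrA subrK.
Qed.

(** Some test function, whose energy is finite, lies at finite distance from [w]. *)
Lemma D12_lty w : D12 a Om w -> dirichlet a Om w.2 < +oo.
Proof.
move=> [m_u m_g [phi [tphi _ /cvge0P cv]]].
have [||k _ /(_ k (leqnn k)) /= le1] := cv _ 1%R.
- by move=> k; exact: dirichlet_ge0.
- by [].
have mgk : measurable_fun Om (gradient (phi k)).
  by apply: measurable_funTS; apply: gradient_measurable; case: (tphi k).
have -> : dirichlet a Om w.2 = dirichlet a Om (fun x => gradient (phi k) x +
    - (gradient (phi k) x - w.2 x))%R.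
  by apply: eq_integral => x _; rewrite opprB addrC subrK.
have mB := measurable_rVB m1 mgk m_g.
apply: le_lt_trans (dirichletD m1 mgk (h := fun x => - (gradient (phi k) x - w.2 x))%R _) _.
  by under eq_fun do rewrite -scaleN1r; exact: measurable_rVZ.
rewrite dirichletN; apply: lte_add_pinfty; apply: lte_mul_pinfty => //.
  exact: dirichlet_test_lty.
by apply: le_lt_trans le1 _; rewrite ltry.
Qed.

Lemma D12_fin w : D12 a Om w -> dirichlet a Om w.2 = (fine (dirichlet a Om w.2))%:E.
Proof. by move=> /D12_lty h; rewrite fineK// ge0_fin_numE ?dirichlet_ge0. Qed.

Lemma measurable_hardy D (u : 'rV[R]_n -> R) : measurable_fun D u ->
  measurable_fun D (fun x => (enorm x `^ (- 2 * (a + 1)) * u x ^+ 2)%:E).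
Proof. by move=> mu; mfun. Qed.

(** Fatou along the approximating test functions. The constant is twice that of [hardy_test] because
    energies of sums are compared through [dirichletD], which costs a factor [2]. *)
Lemma hardy_D12 w : D12 a Om w ->
  hardy_integral a Om w.1 <= (8 / @gap R n a ^+ 2)%:E * dirichlet a Om w.2.
Proof.
move=> Vw; have [m_u m_g [phi [tphi ae_phi cv]]] := Vw.
have Nw := D12_fin Vw; set N := fine _ in Nw.
have N0 : (0 <= N)%R by rewrite -lee_fin -Nw dirichlet_ge0.
set C := (8 / _)%R.
have C0 : (0 < C)%R by rewrite divr_gt0// exprn_gt0.
apply/lee_addgt0Pr => e e0.
have mphi k : measurable_fun Om (phi k).
  by apply: measurable_funTS; apply: smooth_measurable; case: (tphi k).
have mgphi k : measurable_fun Om (gradient (phi k)).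
  by apply: measurable_funTS; apply: gradient_measurable; case: (tphi k).
apply: (@fatou_ae _ _ _ mu Om
    (fun k x => (enorm x `^ (- 2 * (a + 1)) * phi k x ^+ 2)%:E)) => //.
- by move=> k; exact: measurable_hardy.
- exact: measurable_hardy.
- by move=> k x _; rewrite lee_fin mulr_ge0 ?powR_ge0 ?sqr_ge0.
- by move=> x _; rewrite lee_fin mulr_ge0 ?powR_ge0 ?sqr_ge0.
- apply: filterS ae_phi => x cvx Ox; apply: cvg_EFin; first exact: nearW.
  by apply: cvgM; [exact: cvg_cst|apply: cvgM; exact: cvx].
have eC : (0 < e / C)%R by rewrite divr_gt0.
have cv' := (cvge0P (fun k => dirichlet_ge0 _ _)).1 cv _ eC.
apply: filterS cv' => k le1.
apply: le_trans (hardy_test n_gt2 a_lt (tphi k)) _.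
have -> : dirichlet a Om (gradient (phi k)) = dirichlet a Om (fun x => w.2 x +
    (gradient (phi k) x - w.2 x))%R.
  by apply: eq_integral => x _; rewrite addrC subrK.
have mB := measurable_rVB m1 (mgphi k) m_g.
have := dirichletD m1 m_g mB; rewrite Nw.
move=> h; apply: (@le_trans _ _ ((C / 2)%:E * (2%:E * N%:E + 2%:E * (e / C)%:E))).
  rewrite (_ : 4 / _ = C / 2)%R; last by rewrite /C; field; rewrite gt_eqF.
  apply: lee_wpmul2l; first by rewrite lee_fin divr_ge0 ?ltW.
  by apply: le_trans h _; rewrite leeD2l//; apply: lee_wpmul2l.
rewrite -!(EFinM, EFinD) lee_fin le_eqVlt; apply/orP; left; apply/eqP.
by field; rewrite gt_eqF.
Qed.

End dirichlet_space.

(** * Almost everywhere limits of rapidly converging sequences *)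

Section fast_convergence.
Context d (T : measurableType d) {R : realType} (mu : {measure set T -> \bar R}).
Variables (D : set T) (w : T -> R).
Hypotheses (mD : measurable D) (mw : measurable_fun D w) (w_ge0 : forall x, 0 <= w x).

(** The series of the [4^j w h_j^2] has integral at most the sum of the [C 4^-j], so it is finite
    almost everywhere, and each of its terms is bounded by its sum. The rate [16^-j] thus pays one
    factor [4^j] for summability and one for the decay [h_j^2 = O(4^-j)]. *)
Lemma fast_bound_ae (h : nat -> T -> R) (C : R) :
  (forall j, measurable_fun D (h j)) ->
  (forall j, (\int[mu]_(x in D) (w x * h j x ^+ 2)%:E <= (C * 16^-1 ^+ j)%:E)%E) ->
  {ae mu, forall x, D x -> 0 < w x -> exists K, forall j, `|h j x| <= K * 2^-1 ^+ j}.
Proof.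
move=> mh hC.
have C0 : 0 <= C.
  have := hC 0%N; rewrite expr0 mulr1 -lee_fin => /(le_trans _); apply.
  by apply: integral_ge0 => x _; rewrite lee_fin mulr_ge0 ?sqr_ge0.
pose t j x : \bar R := ((4 ^+ j) * (w x * h j x ^+ 2))%:E.
have t0 j x : D x -> (0 <= t j x)%E by rewrite lee_fin mulr_ge0 ?exprn_ge0// mulr_ge0 ?sqr_ge0.
have mt j : measurable_fun D (t j).
  by have := mh j => mhj; rewrite /t; mfun.
pose S x := (\sum_(j <oo) t j x)%E.
have S0 x : D x -> (0 <= S x)%E by move=> Dx; apply: nneseries_ge0 => j _ _; exact: t0.
have mS : measurable_fun D S.
  by apply: ge0_emeasurable_sum => // j x Dx _; exact: t0.
have intS : (\int[mu]_(x in D) S x <= (2 * C)%:E)%E.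
  rewrite integral_nneseries//; apply: lime_le.
    by apply: is_cvg_nneseries => j _ _; apply: integral_ge0 => x; exact: t0.
  apply: nearW => N; apply: (@le_trans _ _ (\sum_(0 <= j < N) (C * 4^-1 ^+ j)%:E)%E).
    apply: lee_sum => j _.
    have -> : (C * 4^-1 ^+ j)%:E = ((4 ^+ j)%:E * (C * 16^-1 ^+ j)%:E)%E.
      by rewrite -EFinM mulrCA -exprMn; congr (C * _ ^+ _)%:E; lra.
    have mg : measurable_fun D (fun x => (w x * h j x ^+ 2)%:E).
      by have := mh j => mhj; mfun.
    have g0 x : D x -> (0 <= (w x * h j x ^+ 2)%:E)%E.
      by rewrite lee_fin mulr_ge0 ?sqr_ge0.
    have c0 : (0 <= (4 ^+ j : R)%:E)%E by rewrite lee_fin exprn_ge0.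
    have := ge0_integralZl mu mD mg g0 c0 => E.
    rewrite [leLHS](_ : _ = ((4 ^+ j)%:E * \int[mu]_(x in D) (w x * h j x ^+ 2)%:E)%E)//.
    exact: lee_wpmul2l.
  rewrite sumEFin lee_fin -mulr_sumr mulrC; apply: ler_wpM2r => //.
  suff : \sum_(0 <= j < N) (4^-1 : R) ^+ j <= 2 - 2 * 4^-1 ^+ N.
    by move/le_trans; apply; rewrite gerBl mulr_ge0// exprn_ge0.
  elim: N => [|N IH]; first by rewrite big_geq// expr0; lra.
  rewrite big_nat_recr//= exprS.
  have : 0 <= (4^-1 : R) ^+ N by rewrite exprn_ge0.
  by move: IH; set s := \sum_(0 <= j < N) _; set p := _ ^+ N => *; lra.
have iS : mu.-integrable D S.
  apply/integrableP; split => //.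
  under eq_integral => x /set_mem Dx do rewrite gee0_abs ?S0//.
  by apply: le_lt_trans intS _; rewrite ltry.
apply: filterS (integrable_ae mD iS) => x Sx Dx wx.
have {}Sx := Sx Dx.
pose K := Num.sqrt (fine (S x) / w x).
exists K => j.
have tS : (t j x <= S x)%E.
  apply: le_trans (nneseries_lim_ge j.+1 (u_ := fun j => t j x) (P := xpredT) (m := 0%N) _).
    rewrite big_nat_recr//= leeDr// sume_ge0// => i _; exact: t0.
  by move=> i _ _; exact: t0.
have {}tS : 4 ^+ j * (w x * h j x ^+ 2) <= fine (S x) by rewrite -lee_fin fineK.
have K0 : 0 <= K by exact: sqrtr_ge0.
rewrite -(ler_pXn2r (_ : 0 < 2)%N) ?nnegrE ?mulr_ge0 ?exprn_ge0//.
rewrite real_normK ?num_real// exprMn sqr_sqrtr; last first.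
  by rewrite divr_ge0 ?fine_ge0 ?S0.
rewrite mulrAC ler_pdivlMr// -exprM mulnC exprM.
rewrite (_ : (2^-1 ^+ 2) = 4^-1 :> R); last lra.
rewrite exprVn ler_pdivlMr ?exprn_gt0//.
by apply: le_trans tS; rewrite le_eqVlt; apply/orP; left; apply/eqP; ring.
Qed.

Lemma geometric_cvg0 (f : nat -> R) (K : R) : (forall j, `|f j| <= K * 2^-1 ^+ j) ->
  f j @[j --> \oo] --> 0.
Proof.
move=> fK; apply/norm_cvg0P.
apply: (@squeeze_cvgr _ _ _ _ (cst 0) (geometric K 2^-1)).
- by apply: nearW => j; rewrite normr_ge0 fK.
- exact: cvg_cst.
- by apply: cvg_geometric; rewrite ger0_norm; lra.
Qed.

Lemma geometric_is_cvg (f : nat -> R) (K : R) :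
  (forall j, `|f j.+1 - f j| <= K * 2^-1 ^+ j) -> cvgn f.
Proof.
move=> fK.
have c1 : cvgn (series (telescope f)).
  apply: normed_cvg; apply: (@series_le_cvg _ _ (geometric K 2^-1)).
  - by move=> j; rewrite normr_ge0.
  - by move=> j; apply: le_trans (fK j).
  - by move=> j /=; exact: fK.
  - by apply: is_cvg_geometric_series; rewrite ger0_norm; lra.
rewrite (_ : f = (fun j => f 0%N + series (telescope f) j)).
  by apply: is_cvgD => //; exact: is_cvg_cst.
by apply/funext => j; exact: eq_sum_telescope.
Qed.

(** The upper limit is measurable whether or not the sequence converges, and coincides with the
    limit where it does. *)
Definition seq_limit (f : nat -> T -> R) (x : T) : R :=
  fine (limn_esup (fun k => (f k x)%:E)).

Lemma measurable_seq_limit (f : nat -> T -> R) : (forall k, measurable_fun D (f k)) ->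
  measurable_fun D (seq_limit f).
Proof.
move=> mf; apply: (measurableT_comp (fine_measurable measurableT)).
by apply: measurable_fun_limn_esup => k; apply/measurable_EFinP.
Qed.

Lemma seq_limitP (f : nat -> T -> R) x : cvgn (fun k => f k x) ->
  f k x @[k --> \oo] --> seq_limit f x.
Proof.
move=> /cvg_ex[l fl]; rewrite /seq_limit.
have : (fun k => (f k x)%:E) @ \oo --> l%:E by apply: cvg_EFin => //; exact: nearW.
by move=> /cvg_limn_einf_sup[_ ->].
Qed.

End fast_convergence.

Section D12_structure.
Context {R : realType} {n : nat} (a : R).
Notation mu := (@lebesgue_rV R n).
Notation Om := (@open_unit_ball R n).
Hypothesis n_gt2 : (2 < n)%N.
Hypothesis a_lt : a < (n%:R - 2) / 2.
Implicit Types (g h : 'rV[R]_n -> 'rV[R]_n) (D : set 'rV[R]_n).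
Implicit Types (v w : @grad_pair R n).

Let m1 := @measurable_ball1 R n.
Let me := @measurable_enorm R n.

Lemma measurable_test D f : test_function Om f -> measurable_fun D f.
Proof. by move=> [sf _ _]; apply: measurable_funTS; exact: smooth_measurable. Qed.

Lemma measurable_test_gradient D f : test_function Om f -> measurable_fun D (gradient f).
Proof. by move=> [sf _ _]; apply: measurable_funTS; exact: gradient_measurable. Qed.

Lemma D12_test f : test_function Om f -> D12 a Om (f, gradient f).
Proof.
move=> tf; split; [exact: measurable_test|exact: measurable_test_gradient|].
exists (fun=> f); split => //; first by apply: aeW => x _; exact: cvg_cst.
apply/(cvge0P (fun=> dirichlet_ge0 _ _ _)) => e e0; apply: nearW => k /=.
rewrite [leLHS](_ : _ = 0%E) ?lee_fin ?ltW//.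
by apply: integral0_eq => x _; rewrite /= subrr enorm0 expr0n mulr0.
Qed.

Lemma D12ZD (k : R) v w : D12 a Om v -> D12 a Om w -> D12 a Om (k *: v + w).
Proof.
move=> [mv1 mv2 [phi [tphi phiv Dphi]]] [mw1 mw2 [psi [tpsi psiw Dpsi]]].
split.
- apply: (@measurable_funD _ _ _ Om (fun x => k * v.1 x) w.1) => //.
  exact: measurable_funM.
- apply: (@measurable_rVD _ _ Om (fun x => k *: v.2 x) w.2) => //.
  exact: measurable_rVZ.
exists (fun j => k *: phi j + psi j); split.
- by move=> j; exact: test_functionZD.
- apply: filterS2 phiv psiw => x pv pw Ox; apply: cvgD; last exact: pw.
  by apply: cvgZr; exact: pv.
apply/(cvge0P (fun=> dirichlet_ge0 _ _ _)) => e e0.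
have d0 j : (0 <= dirichlet a Om (gradient (phi j) \- v.2)%R)%E by exact: dirichlet_ge0.
have d0' j : (0 <= dirichlet a Om (gradient (psi j) \- w.2)%R)%E by exact: dirichlet_ge0.
have e1 : 0 < e / (4 * (k ^+ 2 + 1)).
  by rewrite divr_gt0// mulr_gt0// ltr_wpDl ?sqr_ge0.
have e2 : 0 < e / 4 by rewrite divr_gt0.
apply: filterS2 ((cvge0P d0).1 Dphi _ e1) ((cvge0P d0').1 Dpsi _ e2) => j h1 h2.
have mp := measurable_test_gradient (D := Om) (tphi j).
have mq := measurable_test_gradient (D := Om) (tpsi j).
have M1 := measurable_rVB m1 mp mv2.
have M2 := measurable_rVB m1 mq mw2.
rewrite (_ : dirichlet a Om (gradient (k *: phi j + psi j) \- (k *: v + w).2) =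
    dirichlet a Om (fun x => k *: (gradient (phi j) x - v.2 x) + (gradient (psi j) x - w.2 x))).
  apply: le_trans (dirichletD a m1 (measurable_rVZ k m1 M1) M2) _.
  rewrite (dirichletZ a k m1 M1).
  apply: (@le_trans _ _ (2%:E * ((k ^+ 2)%:E * (e / (4 * (k ^+ 2 + 1)))%:E) + 2%:E * (e / 4)%:E)%E).
    apply: leeD; apply: lee_wpmul2l => //.
    by apply: lee_wpmul2l => //; rewrite lee_fin sqr_ge0.
  rewrite -!(EFinM, EFinD) lee_fin.
  have k1 : 0 < k ^+ 2 + 1 by rewrite ltr_wpDl ?sqr_ge0.
  have : k ^+ 2 * (e / (4 * (k ^+ 2 + 1))) <= e / 4.
    rewrite invfM !mulrA ler_pdivrMr//.
    by rewrite -subr_ge0 (_ : _ - _ = e / 4) ?divr_ge0 ?ltW//; ring.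
  lra.
have [sp _ _] := tphi j; have [sq _ _] := tpsi j.
apply: eq_integral => x _; rewrite gradientZD//; congr (_ * enorm _ ^+ 2)%:E.
by apply/rowP => i; rewrite !mxE; ring.
Qed.

Lemma D12radZD (k : R) v w : D12rad a Om v -> D12rad a Om w -> D12rad a Om (k *: v + w).
Proof.
move=> [Dv [f fv]] [Dw [h hw]]; split; first exact: D12ZD.
exists (fun r => k * f r + h r); apply: filterS2 fv hw => x hv hw' Ox /=.
by rewrite -hv// -hw'.
Qed.

Lemma D12B v w : D12 a Om v -> D12 a Om w -> D12 a Om (v - w).
Proof. by move=> Dv Dw; rewrite addrC -scaleN1r; exact: D12ZD. Qed.

Definition inner v w : R :=
  \int[mu]_(x in Om) (enorm x `^ (- 2 * a) * dot (v.2 x) (w.2 x)).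

Lemma inner_integrable v w : D12 a Om v -> D12 a Om w ->
  mu.-integrable Om (fun x => (enorm x `^ (- 2 * a) * dot (v.2 x) (w.2 x))%:E).
Proof.
move=> Dv Dw; have [_ mv _] := Dv; have [_ mw _] := Dw.
apply/integrableP; split; first by mfun.
apply: (@le_lt_trans _ _ (dirichlet a Om v.2 + dirichlet a Om w.2)%E).
  have Mv := measurable_dirichlet a mv; have Mw := measurable_dirichlet a mw.
  have p g x : Om x -> (0 <= (enorm x `^ (- 2 * a) * enorm (g x) ^+ 2)%:E)%E.
    by move=> _; rewrite lee_fin mulr_ge0 ?powR_ge0 ?sqr_ge0.
  rewrite /dirichlet -(ge0_integralD mu m1 (p v.2) Mv (p w.2) Mw).
  apply: ge0_le_integral => //.
  - by apply: measurableT_comp => //; mfun.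
  - exact: emeasurable_funD.
  move=> x _; rewrite lee_fin normrM ger0_norm ?powR_ge0// -mulrDr.
  apply: ler_wpM2l; first exact: powR_ge0.
  have := norm_dot_le (v.2 x) (w.2 x) ltr01; rewrite invr1 !mul1r => /le_trans; apply.
  have := sqr_ge0 (enorm (v.2 x)); have := sqr_ge0 (enorm (w.2 x)); lra.
by apply: lte_add_pinfty; apply: D12_lty.
Qed.

Lemma innerE w : inner w w = fine (dirichlet a Om w.2).
Proof.
by congr fine; apply: eq_integral => x _; rewrite sqr_enorm.
Qed.

Lemma inner_sip : semi_inner_product (D12rad a Om) inner.
Proof.
split.
- by move=> k v w; exact: D12radZD.
- by move=> v w _ _; apply: eq_Rintegral => x _; rewrite dotC.
- move=> k u v w [Du _] [Dv _] [Dw _].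
  have iu := inner_integrable Du Dw; have iv := inner_integrable Dv Dw.
  rewrite /inner -RintegralZl// -RintegralD//.
    by apply: eq_Rintegral => x _; rewrite dotDl dotZl; ring.
  exact: (integrableZl m1 k iu).
- by move=> w _; rewrite innerE fine_ge0// dirichlet_ge0.
Qed.

End D12_structure.

(** * Completeness of the radial energy space *)

Section D12_complete.
Context {R : realType} {n : nat} (a : R).
Notation mu := (@lebesgue_rV R n).
Notation Om := (@open_unit_ball R n).
Hypothesis n_gt2 : (2 < n)%N.
Hypothesis a_lt : a < (n%:R - 2) / 2.
Implicit Types (g h : 'rV[R]_n -> 'rV[R]_n) (D : set 'rV[R]_n).
Implicit Types (v w : @grad_pair R n) (phi : nat -> 'rV[R]_n -> R).

Let m1 := @measurable_ball1 R n.
Let me := @measurable_enorm R n.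

Lemma ae_powR_enorm_gt0 (s : R) : {ae mu, forall x, 0 < enorm x `^ s}.
Proof.
by apply: filterS (@ae_neq0 R n n_gt2) => x x0; rewrite powR_gt0// enorm_gt0.
Qed.

Lemma ae_forall_ord (P : 'I_n -> 'rV[R]_n -> Prop) :
  (forall i, {ae mu, forall x, P i x}) -> {ae mu, forall x, forall i, P i x}.
Proof.
move=> H; suff : {ae mu, forall x, forall i, i \in enum 'I_n -> P i x}.
  by apply: filterS => x h i; apply: h; rewrite mem_enum.
elim: (enum 'I_n) => [|j s IH]; first by apply: aeW.
apply: filterS2 IH (H j) => x h hj i; rewrite inE => /predU1P[-> //|]; exact: h.
Qed.

Lemma cvg_coor_dot (f : nat -> 'rV[R]_n) (l : 'rV[R]_n) :
  (forall i, f k ord0 i @[k --> \oo] --> l ord0 i) ->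
  dot (f k) (f k) @[k --> \oo] --> dot l l.
Proof.
move=> fl; rewrite /dot; elim: (index_enum _) => [|i s IH].
  by under eq_fun do rewrite big_nil; rewrite big_nil; exact: cvg_cst.
under eq_fun do rewrite big_cons; rewrite big_cons.
by apply: cvgD => //; apply: cvgM; exact: fl.
Qed.

Section test_limit.
Variables (phi : nat -> 'rV[R]_n -> R) (C : R).
Hypothesis tphi : forall j, test_function Om (phi j).
Hypothesis phiC : forall j k, (j <= k)%N ->
  (dirichlet a Om (fun x => gradient (phi j) x - gradient (phi k) x)%R <= (C * 16^-1 ^+ j)%:E)%E.

Let u : 'rV[R]_n -> R := seq_limit phi.
Let g (x : 'rV[R]_n) : 'rV[R]_n :=
  \row_i seq_limit (fun j x => gradient (phi j) x ord0 i) x.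

Let ae_grad_cvg : {ae mu, forall x, Om x -> forall i,
  gradient (phi j) x ord0 i @[j --> \oo] --> g x ord0 i}.
Proof.
suff : {ae mu, forall x i, Om x ->
    gradient (phi j) x ord0 i @[j --> \oo] --> g x ord0 i}.
  by apply: filterS => x h Ox i; exact: h.
apply: ae_forall_ord => i.
pose h j (x : 'rV[R]_n) := gradient (phi j.+1) x ord0 i - gradient (phi j) x ord0 i.
have mgphi j := measurable_test_gradient (D := Om) (tphi j).
have mh j : measurable_fun Om (h j).
  by apply: measurable_funB; apply: measurable_fun_coor.
have mw : measurable_fun Om (fun x : 'rV[R]_n => enorm x `^ (- 2 * a)) by mfun.
have hC j : (\int[mu]_(x in Om) (enorm x `^ (- 2 * a) * h j x ^+ 2)%:E <= (C * 16^-1 ^+ j)%:E)%E.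
  apply: le_trans (phiC (leqnSn j)); rewrite dirichletB_sym.
  apply: ge0_le_integral => //.
  - by move=> x _; rewrite lee_fin mulr_ge0 ?powR_ge0 ?sqr_ge0.
  - by have := mh j => mhj; mfun.
  - by apply: measurable_dirichlet; exact: measurable_rVB.
  move=> x _; rewrite lee_fin; apply: ler_wpM2l; first exact: powR_ge0.
  rewrite -[leLHS]real_normK ?num_real// lerXn2r ?nnegrE ?enorm_ge0//.
  rewrite (_ : h j x = (gradient (phi j.+1) x - gradient (phi j) x) ord0 i) ?coor_le_enorm//.
  by rewrite /h !mxE.
apply: filterS2 (ae_powR_enorm_gt0 (- 2 * a))
  (fast_bound_ae m1 mw (fun x => powR_ge0 _ _) mh hC) => x w0 bx Ox.
have [K KP] := bx Ox w0; rewrite mxE; apply: seq_limitP.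
exact: geometric_is_cvg KP.
Qed.

(** Only the gradients are assumed close; Hardy's inequality, applied to the test function
    [phi j.+1 - phi j], carries the rate over to the functions. *)
Let ae_cvg : {ae mu, forall x, Om x -> phi j x @[j --> \oo] --> u x}.
Proof.
pose h j (x : 'rV[R]_n) := phi j.+1 x - phi j x.
have mphi j := measurable_test (D := Om) (tphi j).
have mh j : measurable_fun Om (h j) by apply: measurable_funB.
have mw : measurable_fun Om (fun x : 'rV[R]_n => enorm x `^ (- 2 * (a + 1))) by mfun.
have hC j : (\int[mu]_(x in Om) (enorm x `^ (- 2 * (a + 1)) * h j x ^+ 2)%:E <=
    (4 / @gap R n a ^+ 2 * C * 16^-1 ^+ j)%:E)%E.
  have th : test_function Om (-1 *: phi j + phi j.+1) by exact: test_functionZD.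
  have hE : h j = -1 *: phi j + phi j.+1.
    by apply/funext => x; rewrite /h -[RHS]/(-1 * phi j x + phi j.+1 x); ring.
  rewrite hE; apply: le_trans (hardy_test n_gt2 a_lt th) _.
  rewrite -mulrA [leRHS]EFinM; apply: lee_wpmul2l.
    by rewrite lee_fin divr_ge0// sqr_ge0.
  apply: le_trans (phiC (leqnSn j)); rewrite dirichletB_sym le_eqVlt; apply/orP; left.
  have [s1 _ _] := tphi j; have [s2 _ _] := tphi j.+1.
  apply/eqP; apply: eq_integral => x _; rewrite gradientZD//.
  by congr (_ * enorm _ ^+ 2)%:E; apply/rowP => i; rewrite !mxE; ring.
apply: filterS2 (ae_powR_enorm_gt0 (- 2 * (a + 1)))
  (fast_bound_ae m1 mw (fun x => powR_ge0 _ _) mh hC) => x w0 bx Ox.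
have [K KP] := bx Ox w0; apply: seq_limitP.
exact: geometric_is_cvg KP.
Qed.

(** The second component of the limit is the almost everywhere limit of the gradients, taken
    coordinate by coordinate, and is not obtained by differentiating the first. Fatou in the index
    [k] transfers the rate from pairs of terms to the limit. *)
Lemma test_limit : exists w, [/\ D12 a Om w,
  {ae mu, forall x, Om x -> phi j x @[j --> \oo] --> w.1 x} &
  forall j, (dirichlet a Om (fun x => gradient (phi j) x - w.2 x)%R <= (C * 16^-1 ^+ j)%:E)%E].
Proof.
have mphi j := measurable_test (D := Om) (tphi j).
have mgphi j := measurable_test_gradient (D := Om) (tphi j).
have mg : measurable_fun Om g.
  apply: measurable_rV_coorP => // i; under eq_fun do rewrite mxE.
  apply: measurable_seq_limit => k; exact: (measurable_fun_coor i (mgphi k)).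
have Dg j : (dirichlet a Om (fun x => gradient (phi j) x - g x)%R <= (C * 16^-1 ^+ j)%:E)%E.
  apply: (@fatou_ae _ _ _ mu Om (fun k x => (enorm x `^ (- 2 * a) *
    enorm (gradient (phi j) x - gradient (phi k) x) ^+ 2)%:E)) => //.
  - by move=> k; apply: measurable_dirichlet; exact: measurable_rVB.
  - by apply: measurable_dirichlet; exact: measurable_rVB.
  - by move=> k x _; rewrite lee_fin mulr_ge0 ?powR_ge0 ?sqr_ge0.
  - by move=> x _; rewrite lee_fin mulr_ge0 ?powR_ge0 ?sqr_ge0.
  - apply: filterS ae_grad_cvg => x cx Ox; apply: cvg_EFin; first exact: nearW.
    apply: cvgM; first exact: cvg_cst.
    rewrite sqr_enorm; under eq_fun do rewrite sqr_enorm.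
    apply: cvg_coor_dot => i; rewrite [in X in _ --> X]mxE.
    under eq_fun do rewrite mxE.
    apply: cvgD; first exact: cvg_cst.
    rewrite [in X in _ --> X]mxE; under eq_fun do rewrite mxE.
    by apply: cvgN; exact: cx.
  - by exists j => // k /= jk; exact: phiC.
exists (u, g); split => //; split => //=.
- by apply: measurable_seq_limit => k.
exists phi; split => //.
apply/(cvge0P (fun=> dirichlet_ge0 _ _ _)) => e e0.
have : C * 16^-1 ^+ j @[j --> \oo] --> (0 : R).
  by apply: cvg_geometric; rewrite ger0_norm; lra.
move/cvgrPdist_le => /(_ e e0); apply: filterS => j; rewrite sub0r normrN => h.
by apply: le_trans (Dg j) _; rewrite lee_fin; exact: le_trans (ler_norm _) h.
Qed.

End test_limit.

Lemma D12_approx w (e : R) : D12 a Om w -> 0 < e -> exists f, test_function Om f /\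
  (dirichlet a Om (fun x => gradient f x - w.2 x)%R <= e%:E)%E.
Proof.
move=> [_ _ [phi [tphi _ /(cvge0P (fun=> dirichlet_ge0 _ _ _)) /(_ e) cv]]] /cv[k _ /(_ k (leqnn k)) h].
by exists (phi k).
Qed.

Lemma inner_subE v w : D12 a Om v -> D12 a Om w ->
  (inner a (v - w) (v - w))%:E = dirichlet a Om (fun x => v.2 x - w.2 x)%R.
Proof.
move=> Dv Dw; rewrite innerE; apply/esym.
exact: (D12_fin n_gt2 a_lt (D12B Dv Dw)).
Qed.

(** Test functions close to a fast subsequence converge by [test_limit], and their limit serves for
    the whole Cauchy sequence. They need not be radial, but by Hardy's inequality they have the same
    almost everywhere limit as the subsequence, so the limit of the radial profiles is a profile of
    [w]. *)
Theorem D12rad_complete : sip_complete (D12rad a Om) (inner a).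
Proof.
move=> v Vv cauchy_v.
have Dv i : D12 a Om (v i) by case: (Vv i).
have mv i : measurable_fun Om (v i).2 by case: (Dv i).
have e0 j : 0 < (16^-1 : R) ^+ j by rewrite exprn_gt0.
have /choice[m mP] : forall j, exists K : nat, forall i i', (K <= i)%N -> (K <= i')%N ->
    inner a (v i - v i') (v i - v i') < 16^-1 ^+ j by move=> j; exact: cauchy_v.
have vE i i' j : (m j <= i)%N -> (m j <= i')%N ->
    (dirichlet a Om (fun x => (v i).2 x - (v i').2 x)%R <= (16^-1 ^+ j)%:E)%E.
  by move=> mi mi'; rewrite -(inner_subE (Dv i) (Dv i')) lee_fin ltW// mP.
have /choice[phi phiP] : forall j, exists f, test_function Om f /\
    (dirichlet a Om (fun x => gradient f x - (v (m j)).2 x)%R <= (16^-1 ^+ j)%:E)%E.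
  by move=> j; exact: D12_approx.
have tphi j := (phiP j).1.
have mgphi j := measurable_test_gradient (D := Om) (tphi j).
have tri (g h k : 'rV[R]_n -> 'rV[R]_n) (p q : R) : measurable_fun Om g -> measurable_fun Om h ->
    measurable_fun Om k -> (dirichlet a Om (fun x => g x - k x)%R <= p%:E)%E ->
    (dirichlet a Om (fun x => k x - h x)%R <= q%:E)%E ->
    (dirichlet a Om (fun x => g x - h x)%R <= (2 * p + 2 * q)%:E)%E.
  move=> mg mh mk gk kh; apply: le_trans (dirichlet_triangle a m1 mg mh mk) _.
  by rewrite [leRHS]EFinD (EFinM 2 p) (EFinM 2 q); apply: leeD; apply: lee_wpmul2l.
have sym (g h : 'rV[R]_n -> 'rV[R]_n) (p : \bar R) :
    (dirichlet a Om (fun x => g x - h x)%R <= p)%E -> (dirichlet a Om (fun x => h x - g x)%R <= p)%E.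
  by rewrite (dirichletB_sym a Om g h).
have le16 j k : (j <= k)%N -> (16^-1 : R) ^+ k <= 16^-1 ^+ j.
  by move=> jk; rewrite ler_wiXn2l//; lra.
(* Three uses of the triangle inequality for squares give [10 * 16^-j + 12 * 16^-k]. *)
have phiC j k : (j <= k)%N -> (dirichlet a Om (fun x => gradient (phi j) x - gradient (phi k) x)%R <=
    (22 * 16^-1 ^+ j)%:E)%E.
  move=> jk; pose i := maxn (m j) (m k).
  have h1 := vE (m j) i j (leqnn _) (leq_maxl _ _).
  have h2 := vE i (m k) k (leq_maxr _ _) (leqnn _).
  have h3 := tri _ _ _ _ _ (mv _) (mv _) (mv _) h1 h2.
  have h4 := sym _ _ _ (phiP k).2.
  have h5 := tri _ _ _ _ _ (mv _) (mgphi k) (mv _) h3 h4.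
  apply: le_trans (tri _ _ _ _ _ (mgphi j) (mgphi k) (mv _) (phiP j).2 h5) _.
  rewrite lee_fin; have := le16 _ _ jk; lra.
have [w [Dw ae_w gw]] := test_limit tphi phiC.
have mw : measurable_fun Om w.2 by case: Dw.
(* Here Hardy's inequality is used in the form for the completion, as [v (m j)] is not a test
   function. *)
have ae_v : {ae mu, forall x, Om x -> phi j x - (v (m j)).1 x @[j --> \oo] --> 0}.
  pose h j (x : 'rV[R]_n) := phi j x - (v (m j)).1 x.
  have mphi j := measurable_test (D := Om) (tphi j).
  have mv1 i : measurable_fun Om (v i).1 by case: (Dv i).
  have mh j : measurable_fun Om (h j) by apply: measurable_funB.
  have mW : measurable_fun Om (fun x : 'rV[R]_n => enorm x `^ (- 2 * (a + 1))) by mfun.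
  have hC j : (\int[mu]_(x in Om) (enorm x `^ (- 2 * (a + 1)) * h j x ^+ 2)%:E <=
      (8 / @gap R n a ^+ 2 * 16^-1 ^+ j)%:E)%E.
    have Dd := D12B (D12_test a (tphi j)) (Dv (m j)).
    have H := hardy_D12 n_gt2 a_lt Dd.
    have H' : (dirichlet a Om (fun x => gradient (phi j) x - (v (m j)).2 x)%R <= (16^-1 ^+ j)%:E)%E.
      exact: (phiP j).2.
    apply: (le_trans H); rewrite [leRHS]EFinM; apply: lee_wpmul2l.
      by rewrite lee_fin divr_ge0// sqr_ge0.
    exact: H'.
  apply: filterS2 (ae_powR_enorm_gt0 (- 2 * (a + 1)))
    (fast_bound_ae m1 mW (fun x => powR_ge0 _ _) mh hC) => x w0 bx Ox.
  by have [K KP] := bx Ox w0; exact: geometric_cvg0 KP.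
exists w.
  split => //.
  have /choice[f fP] : forall j, exists f : R -> R, {ae mu, forall x, Om x -> (v j).1 x = f (enorm x)}.
    by move=> j; case: (Vv j).
  exists (fun r => lim (f (m j) r @[j --> \oo])).
  have := ae_foralln (fun j => fP (m j)).
  move=> fE; apply: filterS3 ae_w ae_v fE => x xw xv xf Ox.
  apply/esym/cvg_lim => //.
  have -> : (fun j => f (m j) (enorm x)) = (fun j => phi j x - (phi j x - (v (m j)).1 x)).
    by apply/funext => j; rewrite -(xf j Ox); ring.
  rewrite -[w.1 x]subr0; apply: cvgB; [exact: xw|exact: xv].
apply/cvgrPdist_le => e e_gt0.
(* The two triangle inequalities below add up to [94 * 16^-j]. *)
have : 100 * 16^-1 ^+ j @[j --> \oo] --> (0 : R).
  by apply: cvg_geometric; rewrite ger0_norm; lra.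
move/cvgrPdist_le => /(_ e e_gt0)[j _ /(_ j (leqnn j))].
rewrite /= sub0r normrN ger0_norm ?mulr_ge0 ?exprn_ge0// => je.
exists (m j) => // i /= mi; rewrite sub0r normrN ger0_norm; last first.
  by rewrite innerE fine_ge0// dirichlet_ge0.
apply: le_trans je; rewrite -lee_fin (inner_subE (Dv i) Dw).
have h1 := vE i (m j) j mi (leqnn _).
have h2 := sym _ _ _ (phiP j).2.
have h3 := tri _ _ _ _ _ (mv _) mw (mgphi j) h2 (gw j).
apply: le_trans (tri _ _ _ _ _ (mv _) mw (mv _) h1 h3) _.
rewrite lee_fin; have := e0 j; lra.
Qed.

End D12_complete.

(** * Radial functions and spherical means *)

(** Taking [t = X / A] gives the claim, and when [A = 0] a large [t] shows that [X] vanishes. This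
    recovers Cauchy-Schwarz for integrals from a pointwise Young inequality with a free
    parameter. *)
Lemma le_sqr_of_amgm (R : realType) (X A B : R) : 0 <= X -> 0 <= A -> 0 <= B ->
  (forall t, 0 < t -> X <= (t * A + t^-1 * B) / 2) -> X ^+ 2 <= A * B.
Proof.
move=> X0 A0 B0 H; have [->|Xn] := eqVneq X 0; first by rewrite expr0n mulr_ge0.
have {Xn}X0 : 0 < X by rewrite lt_neqAle eq_sym Xn.
have [AE|An] := eqVneq A 0.
  have B1 : 0 < (B + 1) / X by rewrite divr_gt0// ltr_wpDl.
  have := H _ B1; rewrite AE mulr0 add0r invf_div ler_pdivlMr// mulrAC ler_pdivlMr ?ltr_wpDl//.
  by rewrite -mulrA ler_pM2l// => ?; lra.
have {An}A0 : 0 < A by rewrite lt_neqAle eq_sym An.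
have := H _ (divr_gt0 X0 A0); rewrite invf_div divfK ?gt_eqF// ler_pdivlMr// => h.
rewrite expr2 -ler_pdivlMr//.
have -> : A * B / X = A / X * B by ring.
lra.
Qed.

Section polar_signed.
Context {R : realType} {n : nat}.
Notation mu := (@lebesgue_rV R n).
Notation leb := (@lebesgue_measure R).
Local Open Scope ereal_scope.
Hypothesis n0 : (0 < n)%N.

Definition polar_density (p : measurableTypeR R * 'rV[R]_n) : R :=
  (\1_shell p.2 * (\1_(`]0%R, +oo[%classic : set R) p.1 * p.1 ^+ n.-1))%R.

Definition polar_point (p : measurableTypeR R * 'rV[R]_n) : 'rV[R]_n :=
  (p.1 / enorm p.2)%R *: p.2.

Lemma measurable_polar_density : measurable_fun setT polar_density.
Proof.
have mS := @measurable_shell R n.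
have mI : measurable (`]0%R, +oo[%classic : set R) by exact: measurable_itv.
by rewrite /polar_density; mfun.
Qed.

Lemma measurable_polar_point : measurable_fun setT polar_point.
Proof. by rewrite /polar_point; mfun. Qed.

Lemma polar_density_ge0 p : (0 <= polar_density p)%R.
Proof.
rewrite /polar_density; have [s0|s0] := ltP 0%R p.1.
  by rewrite mulr_ge0 ?indic_ge0// mulr_ge0 ?indic_ge0// exprn_ge0// ltW.
rewrite (indicF0 (x := p.1)) ?mul0r ?mulr0//= in_itv/= andbT.
by apply/negP; rewrite -leNgt.
Qed.

Lemma polar_product (F : 'rV[R]_n -> \bar R) :
  measurable_fun setT F -> (forall x, 0 <= F x) ->
  @kappa R n * \int[mu]_x F x =
  \int[leb \x mu]_p ((polar_density p)%:E * F (polar_point p)).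
Proof.
move=> mF F0; rewrite polar_coordinates// fubini_tonelli2//.
- have md := measurable_polar_density; have mp := measurable_polar_point.
  by mfun.
- by move=> p; rewrite mule_ge0// lee_fin polar_density_ge0.
Qed.

(** The kernel of the radial mean changes sign, so the polar formula is extended from nonnegative
    functions by treating positive and negative parts; multiplication by the nonnegative density
    respects them. *)
Lemma polar_product_integrable (F : 'rV[R]_n -> R) :
  mu.-integrable setT (EFin \o F) ->
  (leb \x mu).-integrable setT (fun p => (polar_density p * F (polar_point p))%:E) /\
  @kappa R n * \int[mu]_x (F x)%:E =
  \int[leb \x mu]_p (polar_density p * F (polar_point p))%:E.
Proof.
move=> iF; have /integrableP[mF' fF] := iF.
have mF : measurable_fun setT F by apply/measurable_EFinP.
have md := measurable_polar_density; have mp := measurable_polar_point.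
have mK : measurable_fun setT (fun p => (polar_density p * F (polar_point p))%:E) by mfun.
split.
  apply/integrableP; split => //.
  have := @polar_product (fun x => `|(F x)%:E|).
  move=> /(_ _ _) E.
  rewrite (_ : \int[_]_x _ = \int[leb \x mu]_p ((polar_density p)%:E * `|(F (polar_point p))%:E|)).
    rewrite -E//; last exact: measurableT_comp.
    by rewrite kappa_fin// lte_mul_pinfty// lee_fin fine_ge0// ltW// kappa_gt0.
  apply: eq_integral => p _; rewrite EFinM abseM gee0_abs// lee_fin.
  exact: polar_density_ge0.
pose K (p : measurableTypeR R * 'rV[R]_n) := (polar_density p * F (polar_point p))%:E.
have Ep := polar_product (measurable_funepos mF') (fun x => funepos_ge0 (EFin \o F) x).
have En := polar_product (measurable_funeneg mF') (fun x => funeneg_ge0 (EFin \o F) x).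
have kf : @kappa R n \is a fin_num by rewrite kappa_fin.
have iE := integralE mu setT (EFin \o F).
have ad := integrable_add_def measurableT iF.
transitivity (@kappa R n * \int[mu]_x (EFin \o F)^\+ x - @kappa R n * \int[mu]_x (EFin \o F)^\- x).
  by rewrite -muleBr// -iE.
have KE := integralE (leb \x mu) setT K.
apply: etrans (esym KE); rewrite Ep En.
congr (_ - _); apply: eq_integral => p _; rewrite ?funeposE ?funenegE /K /=.
  by rewrite EFinM maxe_pMr ?lee_fin ?polar_density_ge0// mule0.
by rewrite maxe_pMr ?lee_fin ?polar_density_ge0// mule0 -EFinM mulrN.
Qed.

Lemma polar_coordinates_signed (F : 'rV[R]_n -> R) :
  mu.-integrable setT (EFin \o F) ->
  @kappa R n * \int[mu]_x (F x)%:E =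
  \int[mu]_y \int[leb]_r (polar_density (r, y) * F (polar_point (r, y)))%:E.
Proof.
move=> iF; have [iK ->] := polar_product_integrable iF.
by rewrite -integral21_prod_meas1.
Qed.

End polar_signed.

Section radial_mean.
Context {R : realType} {n : nat} (a : R).
Notation mu := (@lebesgue_rV R n).
Notation Om := (@open_unit_ball R n).
Hypothesis n_gt2 : (2 < n)%N.
Hypothesis a_lt : a < (n%:R - 2) / 2.
Implicit Types (v w : @grad_pair R n) (r : R).

Let m1 := @measurable_ball1 R n.
Let me := @measurable_enorm R n.
Let n0 : (0 < n)%N. Proof. exact: ltn_trans n_gt2. Qed.
Notation gam := (@gap R n a).
Let g0 : 0 < gam. Proof. exact: gap_gt0. Qed.
Notation kap := (fine (@kappa R n)).
Notation ms := (fine (mu shell)).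

Lemma fine_kappa_gt0 : 0 < kap.
Proof. by rewrite -lte_fin -kappa_fin// kappa_gt0. Qed.

Lemma fine_shell_gt0 : 0 < ms.
Proof. by rewrite -lte_fin -shell_fin shell_gt0. Qed.

Definition exterior r : set 'rV[R]_n := [set x | r <= enorm x].

Lemma measurable_exterior r : measurable (exterior r).
Proof.
rewrite (_ : exterior r = [set x | (`[r, +oo[%classic : set R) (enorm x)]).
  by apply: measurable_enorm_preimage; exact: measurable_itv.
by apply/seteqP; split => x; rewrite /exterior/= in_itv/= andbT.
Qed.

(** The radial derivative times [|x|^(1-n)]: in polar coordinates this power cancels the density
    [r^(n-1)] and leaves integrals along rays. *)
Definition radial_kernel (g : 'rV[R]_n -> 'rV[R]_n) r (x : 'rV[R]_n) : R :=
  \1_(exterior r) x * (dot (g x) x * enorm x `^ (- n%:R)).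

Lemma measurable_radial_kernel D g r : measurable_fun D g ->
  measurable_fun D (radial_kernel g r).
Proof. by move=> mg; have mE := measurable_exterior r; rewrite /radial_kernel; mfun. Qed.

(** The square of the prefactor of [radial_mean], times the constant of [exterior_power_integral]
    for the exponent [gam]. *)
Definition mean_const : R := (kap / ms) ^+ 2 * (ms / kap / gam).

Lemma mean_const_ge0 : 0 <= mean_const.
Proof.
by rewrite mulr_ge0 ?sqr_ge0// !divr_ge0 ?ltW// ?fine_shell_gt0 ?fine_kappa_gt0.
Qed.

Lemma radial_kernel_le w r (t : R) : D12 a Om w -> 0 < r -> 0 < t ->
  (\int[mu]_(x in Om) `|radial_kernel w.2 r x|%:E <=
   ((t * inner a w w + t^-1 * (ms / kap / gam * r `^ (- gam))) / 2)%:E)%E.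
Proof.
move=> Dw r0 t0; have [_ mw _] := Dw; have mE := measurable_exterior r.
pose h1 (x : 'rV[R]_n) := ((t / 2)%:E * (enorm x `^ (- 2 * a) * enorm (w.2 x) ^+ 2)%:E)%E.
pose h2 (x : 'rV[R]_n) := ((t^-1 / 2)%:E * (\1_(exterior r) x * enorm x `^ (- gam - n%:R))%:E)%E.
have Mw := measurable_dirichlet a mw.
have mh1 : measurable_fun Om h1 by rewrite /h1; mfun.
have mh2 : measurable_fun Om h2 by rewrite /h2; mfun.
have p1 x : Om x -> (0 <= h1 x)%E.
  by move=> _; apply: mule_ge0; rewrite lee_fin; [rewrite divr_ge0 ?ltW|rewrite mulr_ge0 ?powR_ge0 ?sqr_ge0].
have p2 x : Om x -> (0 <= h2 x)%E.
  by move=> _; apply: mule_ge0; rewrite lee_fin; [rewrite divr_ge0 ?invr_ge0 ?ltW|rewrite mulr_ge0 ?powR_ge0 ?indic_ge0].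
apply: (@le_trans _ _ (\int[mu]_(x in Om) (h1 x + h2 x))%E).
  apply: ge0_le_integral => //.
  - by have := measurable_radial_kernel r mw => mk; mfun.
  - exact: emeasurable_funD.
  move=> x _; rewrite /h1 /h2 -!(EFinM, EFinD) lee_fin /radial_kernel.
  have [xE|xE] := pselect (exterior r x); last first.
    rewrite indicF0// !mul0r normr0 mulr0 addr0; apply: mulr_ge0.
      by rewrite divr_ge0 ?ltW.
    by rewrite mulr_ge0 ?powR_ge0 ?sqr_ge0.
  rewrite indicT1// !mul1r.
  have x0 : 0 < enorm x by exact: lt_le_trans xE.
  rewrite normrM (ger0_norm (powR_ge0 _ _)).
  (* This weight in Young's inequality turns the first term into the energy density and the second
     into [|x|^(-gam-n)], which is integrable at infinity. *)
  have s0 : 0 < t * enorm x `^ (n%:R - 2 * a) by rewrite mulr_gt0// powR_gt0.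
  have H := norm_dot_le (w.2 x) x s0.
  apply: (le_trans (ler_wpM2r (powR_ge0 _ _) H)).
  rewrite le_eqVlt; apply/orP; left; apply/eqP.
  have -> : enorm x `^ (- 2 * a) = enorm x `^ (n%:R - 2 * a) * enorm x `^ (- n%:R).
    by rewrite -powRD ?(gt_eqF x0) ?implybT//; congr (_ `^ _); ring.
  have -> : enorm x `^ (- gam - n%:R) =
      (enorm x `^ (n%:R - 2 * a))^-1 * enorm x ^+ 2 * enorm x `^ (- n%:R).
    rewrite -powRN -powR_mulrn ?ltW// -!powRD ?(gt_eqF x0) ?implybT//.
    by congr (_ `^ _); rewrite /gap; ring.
  by field; rewrite !gt_eqF// powR_gt0.
rewrite ge0_integralD// mulrDl EFinD; apply: leeD.
  have c0 : (0 <= (t / 2)%:E)%E by rewrite lee_fin divr_ge0 ?ltW.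
  have pM (x : 'rV[R]_n) : Om x -> (0 <= (enorm x `^ (- 2 * a) * enorm (w.2 x) ^+ 2)%:E)%E.
    by move=> _; rewrite lee_fin mulr_ge0 ?powR_ge0 ?sqr_ge0.
  have -> := ge0_integralZl mu m1 Mw pM c0.
  rewrite -/(dirichlet a Om w.2) (D12_fin n_gt2 a_lt Dw) -innerE -EFinM lee_fin.
  by rewrite le_eqVlt; apply/orP; left; apply/eqP; ring.
have mk : measurable_fun Om (fun x : 'rV[R]_n => (\1_(exterior r) x * enorm x `^ (- gam - n%:R))%:E).
  by mfun.
have c0 : (0 <= (t^-1 / 2)%:E)%E by rewrite lee_fin divr_ge0 ?invr_ge0 ?ltW.
have pk (x : 'rV[R]_n) : Om x -> (0 <= (\1_(exterior r) x * enorm x `^ (- gam - n%:R))%:E)%E.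
  by move=> _; rewrite lee_fin mulr_ge0 ?powR_ge0 ?indic_ge0.
have -> := ge0_integralZl mu m1 mk pk c0.
rewrite (_ : t^-1 * _ / 2 = (t^-1 / 2) * (ms / kap / gam * r `^ (- gam))); last by ring.
rewrite [leRHS]EFinM; apply: lee_wpmul2l => //.
apply: le_trans (exterior_power_integral n0 g0 r0).
rewrite [leRHS]integral_indicM; apply: ge0_subset_integral => //.
- by have mE' : measurable [set x : 'rV[R]_n | r <= enorm x] := mE; mfun.
- by move=> x _; rewrite lee_fin mulr_ge0 ?powR_ge0 ?indic_ge0.
Qed.

Lemma radial_kernel_integrable w r : D12 a Om w -> 0 < r ->
  mu.-integrable Om (fun x => (radial_kernel w.2 r x)%:E).
Proof.
move=> Dw r0; have [_ mw _] := Dw; apply/integrableP; split.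
  by have := measurable_radial_kernel r mw => mk; mfun.
by apply: le_lt_trans (radial_kernel_le Dw r0 ltr01) _; rewrite ltry.
Qed.

(* Averaging [f(r y) = - \int_r^oo grad f(t y) . y dt] over the directions [y] shows
   that for a test function this is the mean over the sphere of radius [r]. *)
Definition radial_mean w r : R :=
  - (kap / ms) * \int[mu]_(x in Om) radial_kernel w.2 r x.

Lemma radial_meanZD (k : R) v w r : D12 a Om v -> D12 a Om w -> 0 < r ->
  radial_mean (k *: v + w) r = k * radial_mean v r + radial_mean w r.
Proof.
move=> Dv Dw r0; rewrite /radial_mean.
have iv := radial_kernel_integrable Dv r0; have iw := radial_kernel_integrable Dw r0.
rewrite (_ : \int[mu]_(x in Om) radial_kernel (k *: v + w).2 r x =
   k * (\int[mu]_(x in Om) radial_kernel v.2 r x) + \int[mu]_(x in Om) radial_kernel w.2 r x).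
  by ring.
rewrite -(RintegralZl k m1 iv) -RintegralD//; last exact: (integrableZl m1 k iv).
apply: eq_Rintegral => x _; rewrite /radial_kernel.
rewrite (_ : (k *: v + w).2 x = k *: v.2 x + w.2 x)// dotDl dotZl; ring.
Qed.

(** Cauchy-Schwarz, by optimising [t] in [radial_kernel_le]. The bound holds at every radius,
    whereas the values of [w.1] are meaningful almost everywhere only; this makes evaluation at a
    radius a functional. *)
Lemma radial_mean_sqr w r : D12 a Om w -> 0 < r ->
  radial_mean w r ^+ 2 <= mean_const * r `^ (- gam) * inner a w w.
Proof.
move=> Dw r0; rewrite exprMn sqrrN /mean_const -2!mulrA.
apply: ler_wpM2l; first exact: sqr_ge0.
rewrite -[leLHS]real_normK ?num_real//.
rewrite (_ : ms / kap / gam * _ = inner a w w * (ms / kap / gam * r `^ (- gam))); last by ring.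
apply: le_sqr_of_amgm.
- exact: normr_ge0.
- by rewrite innerE fine_ge0// dirichlet_ge0.
- by rewrite mulr_ge0 ?powR_ge0 ?divr_ge0// ?ltW// ?fine_shell_gt0 ?fine_kappa_gt0.
move=> t t0; rewrite -lee_fin; apply: le_trans (radial_kernel_le Dw r0 t0).
have iw := radial_kernel_integrable Dw r0.
rewrite EFin_normr_Rintegral//.
by apply: le_abse_integral => //; case/integrableP : iw.
Qed.

Lemma radial_mean_functional r : 0 < r ->
  bounded_functional (D12rad a Om) (inner a) (fun w => radial_mean w r).
Proof.
move=> r0; split.
  by move=> k v w [Dv _] [Dw _]; exact: radial_meanZD.
by exists (mean_const * r `^ (- gam)) => w [Dw _]; exact: radial_mean_sqr.
Qed.

End radial_mean.

(** * Slices over spheres and null sets *)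

Section polar_slices.
Context {R : realType} {n : nat}.
Notation mu := (@lebesgue_rV R n).
Notation leb := (@lebesgue_measure R).
Hypothesis n0 : (0 < n)%N.
Let mS := @measurable_shell R n.

Lemma measurable_polar_slice (F : 'rV[R]_n -> \bar R) (r : R) : measurable_fun setT F ->
  measurable_fun setT (fun y : 'rV[R]_n => F (polar_point (r, y))).
Proof.
move=> mF; have mP := @measurable_polar_point R n.
exact: (measurableT_comp mF (measurableT_comp mP (measurable_pair1 r))).
Qed.

Lemma polar_slice (F : 'rV[R]_n -> \bar R) (r : R) : measurable_fun setT F ->
  (forall x, (0 <= F x)%E) ->
  (\int[mu]_y ((polar_density (r, y))%:E * F (polar_point (r, y))) =
  (\1_(`]0%R, +oo[%classic : set R) r * r ^+ n.-1)%:E *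
    \int[mu]_(y in shell) F (polar_point (r, y)))%E.
Proof.
move=> mF F0; rewrite [in RHS]integral_mkcond -ge0_integralZl//.
- apply: eq_integral => y _; rewrite patchE /polar_density/= indicE.
  by case: ifPn => _; rewrite ?mul1r ?mul0r ?mul0e ?mule0.
- apply/(measurable_restrict _ mS measurableT); rewrite setTI.
  exact: (measurable_funS measurableT (@subsetT _ _) (measurable_polar_slice r mF)).
- by move=> y _; apply: erestrict_ge0.
- rewrite lee_fin; have [r0|r0] := ltP 0 r; first by rewrite mulr_ge0 ?indic_ge0// exprn_ge0 ?ltW.
  by rewrite indicF0 ?mul0r//= in_itv/= andbT; apply/negP; rewrite -leNgt.
Qed.

Lemma polar_le (F G : 'rV[R]_n -> \bar R) :
  measurable_fun setT F -> measurable_fun setT G ->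
  (forall x, (0 <= F x)%E) -> (forall x, (0 <= G x)%E) ->
  {ae leb, forall r : R, 0 < r -> (\int[mu]_(y in shell) F (polar_point (r, y)) <=
     \int[mu]_(y in shell) G (polar_point (r, y)))%E} ->
  (\int[mu]_x F x <= \int[mu]_x G x)%E.
Proof.
move=> mF mG F0 G0 FG.
have md := @measurable_polar_density R n; have mp := @measurable_polar_point R n.
have mK (H : 'rV[R]_n -> \bar R) : measurable_fun setT H ->
    measurable_fun setT (fun p => (polar_density p)%:E * H (polar_point p))%E.
  by move=> mH; mfun.
have pK (H : 'rV[R]_n -> \bar R) : (forall x, (0 <= H x)%E) ->
    forall p, (0 <= (polar_density p)%:E * H (polar_point p))%E.
  by move=> H0 p; rewrite mule_ge0// lee_fin polar_density_ge0.
have k0 := @kappa_gt0 R n; have kf := @kappa_fin R n.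
have k0' : 0 < fine (@kappa R n) by rewrite -lte_fin -kf.
suff : (@kappa R n * \int[mu]_x F x <= @kappa R n * \int[mu]_x G x)%E.
  by rewrite kf lee_pmul2l// lte_fin.
rewrite !polar_product// (fubini_tonelli1 _ (mK _ mF) (pK _ F0)).
rewrite (fubini_tonelli1 _ (mK _ mG) (pK _ G0)).
apply: ae_ge0_le_integral => //.
- by move=> r _; apply: integral_ge0 => y _; exact: (pK F F0 (r, y)).
- exact: (measurable_fun_fubini_tonelli_F _ (mK _ mF) (pK _ F0)).
- by move=> r _; apply: integral_ge0 => y _; exact: (pK G G0 (r, y)).
- exact: (measurable_fun_fubini_tonelli_F _ (mK _ mG) (pK _ G0)).
apply: (@filterS _ _ (ae_filter_ringOfSetsType leb) _ _ _ FG) => r FGr _; rewrite /fubini_F !polar_slice//.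
have [r0|r0] := ltP 0 r.
  by rewrite lee_wpmul2l// ?FGr// lee_fin mulr_ge0 ?indic_ge0// exprn_ge0 ?ltW.
by rewrite indicF0 ?mul0r ?mul0e//= in_itv/= andbT; apply/negP; rewrite -leNgt.
Qed.

(** The indicator of the exceptional set has integral [0]; written in polar coordinates, this
    integral vanishes slice by slice for almost every radius. *)
Lemma polar_ae (P : 'rV[R]_n -> Prop) : {ae mu, forall x, P x} ->
  {ae leb, forall r : R, 0 < r -> {ae mu, forall y, shell y -> P (polar_point (r, y))}}.
Proof.
move=> [N [mN N0 NP]].
pose F (x : 'rV[R]_n) : \bar R := (\1_N x)%:E.
have mF : measurable_fun setT F by rewrite /F; mfun.
have F0 x : (0 <= F x)%E by rewrite lee_fin indic_ge0.
have md := @measurable_polar_density R n; have mp := @measurable_polar_point R n.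
have mK : measurable_fun setT (fun p => (polar_density p)%:E * F (polar_point p))%E by mfun.
have pK p : (0 <= (polar_density p)%:E * F (polar_point p))%E.
  by rewrite mule_ge0// lee_fin polar_density_ge0.
have := polar_product n0 mF F0.
have IF : (\int[mu]_x F x = 0)%E by rewrite integral_indic// setIT; exact: N0.
rewrite IF mule0 (fubini_tonelli1 _ mK pK) => /esym E.
pose G := fubini_F mu (fun p => (polar_density p)%:E * F (polar_point p))%E.
have mG : measurable_fun setT G := measurable_fun_fubini_tonelli_F _ mK pK.
have G0 r : (0 <= G r)%E by apply: integral_ge0 => y _; exact: (pK (r, y)).
have : (\int[leb]_(x in setT) `|G x| = 0)%E.
  by rewrite -[RHS]E; apply: eq_integral => r _; rewrite gee0_abs.
move=> /(ae_eq_integral_abs leb measurableT mG); apply: (@filterS _ _ (ae_filter_ringOfSetsType leb)) => r /(_ I) Gr r0.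
move: Gr; rewrite /G /fubini_F polar_slice//= indicT1; last by rewrite /= in_itv/= r0.
have mFr : measurable_fun shell (fun y : 'rV[R]_n => F (polar_point (r, y))).
  exact: (measurable_funS measurableT (@subsetT _ _) (measurable_polar_slice r mF)).
move=> /eqP; rewrite mul1r mule_eq0 eqe gt_eqF ?exprn_gt0//= => /eqP Ir.
have : (\int[mu]_(y in shell) `|F (polar_point (r, y))| = 0)%E.
  by rewrite -[RHS]Ir; apply: eq_integral => y _; rewrite gee0_abs.
move=> /(ae_eq_integral_abs mu mS mFr); apply: filterS => y Fy yS.
have := Fy yS; rewrite /F => -[]; case: (pselect (N (polar_point (r, y)))) => Ny.
  by rewrite indicT1// => /eqP; rewrite oner_eq0.
by move=> _; apply: contrapT => nP; apply: Ny; exact: NP.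
Qed.

End polar_slices.

Section spherical_mean.
Context {R : realType} {n : nat} (a : R).
Notation mu := (@lebesgue_rV R n).
Notation leb := (@lebesgue_measure R).
Notation Om := (@open_unit_ball R n).
Hypothesis n_gt2 : (2 < n)%N.
Hypothesis a_lt : a < (n%:R - 2) / 2.
Implicit Types (r s : R) (f : 'rV[R]_n -> R).

Let n0 : (0 < n)%N. Proof. exact: ltn_trans n_gt2. Qed.
Let mS := @measurable_shell R n.
Notation ms := (fine (mu shell)).
Notation kap := (fine (@kappa R n)).
Let ms0 : 0 < ms := fine_shell_gt0 n_gt2.

Definition spherical_mean f r : R :=
  (\int[mu]_(y in shell) f (polar_point (r, y))) / ms.

Lemma shell_bounded_integrable f (K : R) : measurable_fun shell f ->
  (forall y, shell y -> `|f y| <= K) -> mu.-integrable shell (EFin \o f).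
Proof.
move=> mf fK; apply: measurable_bounded_integrable => //; first exact: shell_lty.
by exists K; split; rewrite ?num_real// => M KM y yS; apply: le_trans (fK _ yS) (ltW KM).
Qed.

Lemma polar_slice_integrable f (K : R) r : measurable_fun setT f ->
  (forall x, `|f x| <= K) -> mu.-integrable shell (fun y => (f (polar_point (r, y)))%:E).
Proof.
move=> mf fK; apply: (@shell_bounded_integrable (fun y => f (polar_point (r, y))) K) => //.
have mF : measurable_fun setT (EFin \o f) by apply/measurable_EFinP.
apply/measurable_EFinP.
exact: (measurable_funS measurableT (@subsetT _ _) (measurable_polar_slice r mF)).
Qed.

Lemma measurable_spherical_mean f (K : R) : measurable_fun setT f ->
  (forall x, `|f x| <= K) -> measurable_fun setT (spherical_mean f).
Proof.
move=> mf fK; have mp := @measurable_polar_point R n.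
(* Adding the bound [K] makes the integrand nonnegative, so Tonelli gives measurability in the
   radius. *)
pose h (p : measurableTypeR R * 'rV[R]_n) : \bar R :=
  (\1_shell p.2 * (f (polar_point p) + K))%:E.
have mfp : measurable_fun setT (fun p => f (polar_point p)) by exact: (measurableT_comp mf mp).
have mh : measurable_fun setT h by rewrite /h; mfun.
have h0 p : (0 <= h p)%E.
  rewrite lee_fin mulr_ge0 ?indic_ge0//.
  by have := fK (polar_point p); rewrite ler_norml => /andP[+ _]; rewrite -subr_ge0 opprK addrC.
rewrite (_ : spherical_mean f = fun r => fine (fubini_F mu h r) / ms - K).
  have mF : measurable_fun setT (fubini_F mu h) := measurable_fun_fubini_tonelli_F _ mh h0.
  have mF' := measurableT_comp (fine_measurable measurableT) mF.
  by apply: measurable_funB => //; apply: measurable_funM.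
apply/funext => r; rewrite /spherical_mean /fubini_F /h/=.
have iK : mu.-integrable shell (EFin \o cst K).
  by apply: (@shell_bounded_integrable _ `|K|).
have -> : fine (\int[mu]_y (\1_shell y * (f (polar_point (r, y)) + K))%:E) =
    \int[mu]_(y in shell) (f (polar_point (r, y)) + K).
  by rewrite /Rintegral integral_indicM.
rewrite RintegralD//; last exact: polar_slice_integrable mf fK.
rewrite Rintegral_cst//; field; exact: lt0r_neq0.
Qed.

Lemma spherical_mean_jensen f (K c : R) r : measurable_fun setT f ->
  (forall x, `|f x| <= K) ->
  ((ms * (spherical_mean f r - c) ^+ 2)%:E <=
   \int[mu]_(y in shell) ((f (polar_point (r, y)) - c) ^+ 2)%:E)%E.
Proof.
move=> mf fK; pose m := spherical_mean f r - c.
have i1 := polar_slice_integrable r mf fK.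
have ic (k : R) : mu.-integrable shell (EFin \o cst k) by apply: (@shell_bounded_integrable _ `|k|).
(* The tangent line to the square at [m], evaluated at [f - c]. Since [m] is the mean of [f - c],
   its integral is exactly [ms * m ^+ 2]. *)
pose h (y : 'rV[R]_n) := 2 * m * f (polar_point (r, y)) - (2 * m * c + m ^+ 2).
have iz : mu.-integrable shell (fun y => (2 * m * f (polar_point (r, y)))%:E).
  exact: (integrableZl mS (2 * m) i1).
have ih : mu.-integrable shell (EFin \o h) by exact: (integrableB mS iz (ic (2 * m * c + m ^+ 2))).
have mfs : measurable_fun shell (fun y => f (polar_point (r, y))).
  by apply/measurable_EFinP; case/integrableP : i1.
have i2 : mu.-integrable shell (EFin \o (fun y => (f (polar_point (r, y)) - c) ^+ 2)).
  apply: (@shell_bounded_integrable _ ((K + `|c|) ^+ 2)); first by mfun.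
  move=> y _; rewrite normrX lerXn2r ?nnegrE//.
  - by rewrite addr_ge0// (le_trans _ (fK 0)).
  - by apply: le_trans (ler_normB _ _) _; rewrite lerD2r.
rewrite (_ : ms * m ^+ 2 = \int[mu]_(y in shell) h y).
  have -> : (\int[mu]_(y in shell) ((f (polar_point (r, y)) - c) ^+ 2)%:E =
     (\int[mu]_(y in shell) ((f (polar_point (r, y)) - c) ^+ 2))%:E)%E.
    by rewrite /Rintegral fineK//; exact: integrable_fin_num.
  rewrite lee_fin; apply: le_Rintegral => //.
  move=> y _; rewrite /h -subr_ge0.
  rewrite (_ : _ - _ = (f (polar_point (r, y)) - c - m) ^+ 2) ?sqr_ge0//; ring.
rewrite /h RintegralB//; last exact: ic.
rewrite RintegralZl// Rintegral_cst//.
have -> : \int[mu]_(y in shell) f (polar_point (r, y)) = ms * (m + c).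
  by rewrite /m /spherical_mean; field; exact: lt0r_neq0.
ring.
Qed.

(** In polar coordinates the kernel reduces, for each direction, to the derivative of [f] along the
    ray beyond radius [r], and [ray_formula] integrates it to [- f]. *)
Lemma spherical_mean_test f r : test_function Om f -> 0 < r ->
  spherical_mean f r = radial_mean (f, gradient f) r.
Proof.
move=> tf r0; have Df := D12_test a tf.
pose F (x : 'rV[R]_n) := \1_Om x * radial_kernel (gradient f) r x.
have mO := @measurable_ball1 R n.
have iF : mu.-integrable setT (EFin \o F).
  have := radial_kernel_integrable n_gt2 a_lt Df r0.
  rewrite -[X in mu.-integrable X](setTI Om) => /(integrable_restrict mu mO measurableT _).
  rewrite (_ : _ \_ Om = EFin \o F)//; apply/funext => x.
  by rewrite patchE /F/= indicE; case: ifPn => _; rewrite ?mul1r ?mul0r.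
have := polar_coordinates_signed n0 iF.
have -> : (\int[mu]_x (F x)%:E = \int[mu]_(x in Om) (radial_kernel (gradient f) r x)%:E)%E.
  by rewrite [RHS]integral_indicM.
have [K fK] := test_function_bounded tf.
have mf : measurable_fun setT f := measurable_test tf.
have i1 := polar_slice_integrable r mf fK.
have -> : (\int[mu]_y \int[leb]_t (polar_density (t, y) * F (polar_point (t, y)))%:E =
    - \int[mu]_(y in shell) (f (polar_point (r, y)))%:E)%E.
  rewrite -integralN; last exact: integrable_add_def i1.
  rewrite [RHS]integral_mkcond; apply: eq_integral => y _; rewrite patchE.
  case: ifPn => yS; last first.
    by apply: integral0_eq => t _; rewrite /polar_density/= indicE (negbTE yS) !mul0r.
  have {}yS : shell y by move: yS; rewrite inE.
  have y1 : 0 < enorm y by move: yS => /andP[y1 _]; exact: lt_le_trans y1.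
  have yn : y != 0 by rewrite -enorm_gt0.
  pose z := (enorm y)^-1 *: y.
  have zn : z != 0 by rewrite scaler_eq0 invr_eq0 negb_or gt_eqF.
  have z1 : enorm z = 1 by rewrite enormZ gtr0_norm ?invr_gt0// mulVf// gt_eqF.
  have pz t : polar_point (t, y) = t *: z by rewrite /z scalerA.
  rewrite -EFinN pz -(ray_formula _ tf zn) [RHS]integral_mkcond.
  apply: eq_integral => t _; rewrite pz patchE /polar_density/= (indicT1 yS) mul1r.
  have [t0|t0] := ltP 0 t; last first.
    rewrite ifF; last by apply/negP; rewrite inE/= in_itv/= andbT => /(lt_le_trans r0); rewrite ltNge t0.
    by rewrite indicF0 ?mul0r//= in_itv/= andbT; apply/negP; rewrite -leNgt.
  rewrite (indicT1 (x := t)) ?mul1r; last by rewrite /= in_itv/= t0.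
  have tz : enorm (t *: z) = t by rewrite enormZ z1 mulr1 gtr0_norm.
  have [tO|tO] := pselect (Om (t *: z)); last first.
    rewrite /F indicF0// mul0r mulr0 (gradient_eq0 tf tO).
    by rewrite /dot big1 ?if_same// => i _; rewrite mxE mul0r.
  rewrite /F indicT1// mul1r /radial_kernel tz dotZr.
  have [rt|rt] := leP r t.
    rewrite ifT; last by rewrite inE/= in_itv/= rt.
    rewrite indicT1 /exterior/= ?tz// mul1r; congr (_%:E).
    rewrite powRN powR_mulrn ?ltW// -[in t ^- n](prednK n0) exprS; field.
    by rewrite !gt_eqF ?exprn_gt0.
  rewrite ifF; last by apply/negP; rewrite inE/= in_itv/= andbT leNgt rt.
  by rewrite indicF0 ?mul0r ?mulr0// /exterior/= tz; apply/negP; rewrite -ltNge.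
rewrite kappa_fin => E; rewrite /spherical_mean /radial_mean /=.
have E' : kap * (\int[mu]_(x in Om) radial_kernel (gradient f) r x) = - \int[mu]_(y in shell) f (polar_point (r, y)).
  have := congr1 fine E; rewrite fineM// ?fineN//.
  apply: integrable_fin_num => //; exact: (radial_kernel_integrable n_gt2 a_lt Df r0).
by rewrite mulNr mulrAC E' mulNr opprK.
Qed.

End spherical_mean.

(** * Radial functions coincide with their radial mean *)

Section representation.
Context {R : realType} {n : nat} (a : R).
Notation mu := (@lebesgue_rV R n).
Notation leb := (@lebesgue_measure R).
Notation Om := (@open_unit_ball R n).
Hypothesis n_gt2 : (2 < n)%N.
Hypothesis a_lt : a < (n%:R - 2) / 2.
Implicit Types (r s : R) (f : 'rV[R]_n -> R) (w : @grad_pair R n).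

Let n0 : (0 < n)%N. Proof. exact: ltn_trans n_gt2. Qed.
Let mS := @measurable_shell R n.
Let m1 := @measurable_ball1 R n.
Let me := @measurable_enorm R n.
Notation ms := (fine (mu shell)).
Let ms0 : 0 < ms := fine_shell_gt0 n_gt2.
Notation gam := (@gap R n a).

Lemma enorm_polar_point r (y : 'rV[R]_n) : 0 < r -> shell y -> enorm (polar_point (r, y)) = r.
Proof.
move=> r0 /andP[y1 _]; have y0 : 0 < enorm y by exact: lt_le_trans y1.
by rewrite /polar_point/= enormZ gtr0_norm ?divr_gt0// divfK// gt_eqF.
Qed.

(* Among the functions of [enorm x], the spherical mean is the closest to [f]
   on almost every sphere. *)
Lemma spherical_mean_closest (s K : R) f (u : 'rV[R]_n -> R) :
  measurable_fun setT f -> (forall x, `|f x| <= K) -> measurable_fun setT u ->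
  radial setT u ->
  (\int[mu]_x (enorm x `^ s * (spherical_mean f (enorm x) - u x) ^+ 2)%:E <=
   \int[mu]_x (enorm x `^ s * (f x - u x) ^+ 2)%:E)%E.
Proof.
move=> mf fK m_u [h uh].
have mM : measurable_fun setT (fun x : 'rV[R]_n => spherical_mean f (enorm x)).
  exact: (measurableT_comp (measurable_spherical_mean n_gt2 mf fK) me).
have p (g : 'rV[R]_n -> R) x : (0 <= (enorm x `^ s * (g x - u x) ^+ 2)%:E)%E.
  by rewrite lee_fin mulr_ge0 ?powR_ge0 ?sqr_ge0.
apply: (polar_le n0 _ _ (p _) (p _)); [by mfun|by mfun|].
have uh' : {ae mu, forall x, u x = h (enorm x)} by apply: filterS uh => x; apply.
apply: (@filterS _ _ (ae_filter_ringOfSetsType leb) _ _ _ (polar_ae n0 uh')) => r ur r0.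
have {}ur := ur r0.
have mslice (g : 'rV[R]_n -> R) : measurable_fun setT g -> measurable_fun shell (fun y : 'rV[R]_n =>
    (enorm (polar_point (r, y)) `^ s * (g (polar_point (r, y)) - u (polar_point (r, y))) ^+ 2)%:E).
  move=> mg; have mF : measurable_fun setT (fun x => (enorm x `^ s * (g x - u x) ^+ 2)%:E) by mfun.
  exact: (measurable_funS measurableT (@subsetT _ _) (measurable_polar_slice r mF)).
have mfr : measurable_fun shell (fun y : 'rV[R]_n => ((f (polar_point (r, y)) - h r) ^+ 2)%:E).
  have mF : measurable_fun setT (fun x => ((f x - h r) ^+ 2)%:E) by mfun.
  exact: (measurable_funS measurableT (@subsetT _ _) (measurable_polar_slice r mF)).
apply: (@le_trans _ _ ((r `^ s)%:E * (ms * (spherical_mean f r - h r) ^+ 2)%:E)%E).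
  rewrite (@ae_eq_integral _ _ _ mu shell (cst (r `^ s * (spherical_mean f r - h r) ^+ 2)%:E))//.
  - rewrite integral_cst// [X in (_ * X)%E]shell_fin -!EFinM lee_fin le_eqVlt; apply/orP; left.
    by apply/eqP; ring.
  - exact: (mslice (fun x => spherical_mean f (enorm x))).
  - by apply: filterS ur => y uy yS; rewrite /= enorm_polar_point// uy// enorm_polar_point.
apply: (@le_trans _ _ ((r `^ s)%:E * \int[mu]_(y in shell) ((f (polar_point (r, y)) - h r) ^+ 2)%:E)%E).
  by apply: lee_wpmul2l; [rewrite lee_fin powR_ge0|exact: spherical_mean_jensen mf fK].
rewrite -ge0_integralZl//; last 2 first.
- by move=> y _; rewrite lee_fin sqr_ge0.
- by rewrite lee_fin powR_ge0.
rewrite le_eqVlt; apply/orP; left; apply/eqP; apply: ae_eq_integral => //.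
- by mfun.
- exact: mslice.
by apply: filterS ur => y uy yS; rewrite /= enorm_polar_point// uy// enorm_polar_point.
Qed.

Lemma spherical_mean_cvg w (phi : nat -> 'rV[R]_n -> R) r : D12 a Om w ->
  (forall k, test_function Om (phi k)) ->
  (forall k, (dirichlet a Om (fun x => gradient (phi k) x - w.2 x)%R <= (k.+1%:R^-1)%:E)%E) ->
  0 < r -> spherical_mean (phi k) r @[k --> \oo] --> radial_mean w r.
Proof.
move=> Dw tphi cphi r0; apply/cvgrPdist_le => e e0.
have C0 : 0 <= @mean_const R n a * r `^ (- gam).
  by rewrite mulr_ge0 ?powR_ge0// mean_const_ge0.
have e1 : 0 < e ^+ 2 / (@mean_const R n a * r `^ (- gam) + 1) by rewrite divr_gt0 ?exprn_gt0// ltr_wpDl.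
apply: filterS (near_infty_natSinv_lt (PosNum e1)) => k /= ke.
rewrite -(@ler_pXn2r _ 2)// ?nnegrE// ?ltW// real_normK ?num_real//.
have Dk := D12_test a (tphi k).
rewrite (@spherical_mean_test _ _ a)//.
pose v : @grad_pair R n := (-1) *: (phi k, gradient (phi k)) + w.
have Dv : D12 a Om v by exact: D12ZD.
have -> : radial_mean w r - radial_mean (phi k, gradient (phi k)) r = radial_mean v r.
  by rewrite /v (radial_meanZD n_gt2 a_lt)// mulN1r addrC.
apply: le_lt_trans (radial_mean_sqr n_gt2 a_lt Dv r0) _.
have vk : inner a v v <= k.+1%:R^-1.
  rewrite -lee_fin; apply: le_trans (cphi k); rewrite dirichletB_sym.
  have -> : v = w - (phi k, gradient (phi k)) by rewrite /v scaleN1r addrC.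
  by rewrite (inner_subE n_gt2 a_lt).
apply: (@le_lt_trans _ _ ((@mean_const R n a * r `^ (- gam) + 1) * k.+1%:R^-1)).
  apply: le_trans (ler_wpM2l C0 vk) _.
  by rewrite ler_wpM2r ?invr_ge0// lerDl.
by rewrite mulrC -ltr_pdivlMr// ltr_wpDl.
Qed.

(** The approximating test functions are not radial, but passing to their spherical means does not
    increase the Hardy-weighted distance to the radial [w.1]. These means converge pointwise to
    [radial_mean w], so by Fatou its distance to [w.1] is [0]. *)
Lemma radial_representation w : D12rad a Om w ->
  {ae mu, forall x, Om x -> w.1 x = radial_mean w (enorm x)}.
Proof.
move=> [Dw [h wh]]; have [mw1 mw2 _] := Dw.
have /choice[phi phiP] : forall k, exists f, test_function Om f /\
    (dirichlet a Om (fun x => gradient f x - w.2 x)%R <= (k.+1%:R^-1)%:E)%E.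
  by move=> k; apply: D12_approx => //; rewrite invr_gt0.
have tphi k := (phiP k).1; have cphi k := (phiP k).2.
pose u (x : 'rV[R]_n) := \1_Om x * w.1 x.
have m_u : measurable_fun setT u.
  have := (measurable_restrict w.1 m1 measurableT).1; rewrite setTI => /(_ mw1).
  rewrite (_ : w.1 \_ Om = u)//; apply/funext => x.
  by rewrite patchE /u indicE; case: ifPn => _; rewrite ?mul1r ?mul0r.
have ru : radial setT u.
  exists (fun r => if r < 1 then h r else 0); apply: filterS wh => x wx _.
  rewrite /u; case: ifPn => xO; first by rewrite indicT1// mul1r wx.
  by rewrite indicF0 ?mul0r//; apply/negP.
pose s := - 2 * (a + 1).
have mphi k : measurable_fun setT (phi k) := measurable_test (tphi k).
have mM k : measurable_fun setT (fun x : 'rV[R]_n => spherical_mean (phi k) (enorm x)).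
  have [K fK] := test_function_bounded (tphi k).
  exact: (measurableT_comp (measurable_spherical_mean n_gt2 (mphi k) fK) me).
(* A measurable version of [radial_mean w (enorm x)], with which it agrees off the origin. *)
pose L := seq_limit (fun k (x : 'rV[R]_n) => spherical_mean (phi k) (enorm x)).
have mL : measurable_fun setT L by exact: measurable_seq_limit.
have cL (x : 'rV[R]_n) : x != 0 -> spherical_mean (phi k) (enorm x) @[k --> \oo] --> radial_mean w (enorm x).
  by move=> x0; apply: spherical_mean_cvg => //; rewrite enorm_gt0.
have LE (x : 'rV[R]_n) : x != 0 -> L x = radial_mean w (enorm x).
  move=> x0; rewrite -(cvg_lim (@Rhausdorff R) (cL x x0)); apply/esym/cvg_lim => //.
  by apply: seq_limitP; apply/cvg_ex; exists (radial_mean w (enorm x)); exact: cL.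
have bound k : (\int[mu]_x (enorm x `^ s * (spherical_mean (phi k) (enorm x) - u x) ^+ 2)%:E <=
    (8 / gam ^+ 2 * k.+1%:R^-1)%:E)%E.
  have [K fK] := test_function_bounded (tphi k).
  apply: le_trans (spherical_mean_closest s (mphi k) fK m_u ru) _.
  have Dk := D12_test a (tphi k).
  have := hardy_D12 n_gt2 a_lt (D12B Dk Dw).
  rewrite /hardy_integral -/s => H.
  apply: (@le_trans _ _ ((8 / gam ^+ 2)%:E * dirichlet a Om (fun x => gradient (phi k) x - w.2 x)%R)%E).
    apply: le_trans H; rewrite [leRHS]integral_indicM le_eqVlt; apply/orP; left; apply/eqP.
    apply: eq_integral => x _; congr (_%:E); rewrite /u.
    have [xO|xO] := pselect (Om x); first by rewrite !indicT1// !mul1r.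
    by rewrite !indicF0// (test_function_eq0 (tphi k) xO) !mul0r subrr expr0n mulr0.
  rewrite [leRHS]EFinM; apply: lee_wpmul2l => //.
  by rewrite lee_fin divr_ge0 ?sqr_ge0.
have fin e : 0 < e -> (\int[mu]_x (enorm x `^ s * (L x - u x) ^+ 2)%:E <= e%:E)%E.
  move=> e0.
  apply: (@fatou_ae _ _ _ mu setT (fun k x => (enorm x `^ s * (spherical_mean (phi k) (enorm x) - u x) ^+ 2)%:E)) => //.
  - by move=> k; have := mM k => mMk; mfun.
  - by mfun.
  - by move=> k x _; rewrite lee_fin mulr_ge0 ?powR_ge0 ?sqr_ge0.
  - by move=> x _; rewrite lee_fin mulr_ge0 ?powR_ge0 ?sqr_ge0.
  - apply: filterS (@ae_neq0 R n n_gt2) => x x0 _; apply: cvg_EFin; first exact: nearW.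
    apply: cvgM; first exact: cvg_cst.
    rewrite expr2; under eq_fun do rewrite expr2.
    by apply: cvgM; apply: cvgB; rewrite ?LE//; [exact: cL|exact: cvg_cst|exact: cL|exact: cvg_cst].
  have C0 : 0 < 8 / gam ^+ 2 by rewrite divr_gt0// exprn_gt0// gap_gt0.
  apply: filterS (near_infty_natSinv_lt (PosNum (divr_gt0 e0 C0))) => k /= ke.
  by apply: le_trans (bound k) _; rewrite lee_fin mulrC -ler_pdivlMr ?ltW.
have I0 : (\int[mu]_x `|(enorm x `^ s * (L x - u x) ^+ 2)%:E| = 0)%E.
  apply/eqP; rewrite eq_le integral_ge0// andbT; apply/lee_addgt0Pr => e e0; rewrite add0e.
  apply: le_trans (fin e e0); rewrite le_eqVlt; apply/orP; left; apply/eqP.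
  by apply: eq_integral => x _; rewrite gee0_abs// lee_fin mulr_ge0 ?powR_ge0 ?sqr_ge0.
have mI : measurable_fun setT (fun x : 'rV[R]_n => (enorm x `^ s * (L x - u x) ^+ 2)%:E) by mfun.
have := (ae_eq_integral_abs mu measurableT mI).1 I0.
apply: filterS2 (@ae_neq0 R n n_gt2) => x x0 /(_ I)[] /eqP.
rewrite mulf_eq0 powR_eq0 enorm_eq0 (negbTE x0)/= sqrf_eq0 subr_eq0 => /eqP Lu xO.
by rewrite -LE// Lu /u indicT1// mul1r.
Qed.

End representation.

(** * The critical and lower order terms *)

Section weighted_forms.
Context {R : realType} {n : nat} (a b c d q : R).
Notation mu := (@lebesgue_rV R n).
Notation Om := (@open_unit_ball R n).
Hypothesis n_gt2 : (2 < n)%N.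
Hypothesis a_lt : a < (n%:R - 2) / 2.
Hypothesis d_def : d = 1 + a - b.
Hypothesis d_itv : 0 < d <= 1.
Hypothesis q_def : q = 2 * n%:R / (n%:R - 2 * d).
Hypothesis c_gt0 : 0 < c.
Implicit Types (v w : @grad_pair R n) (D : set 'rV[R]_n).

Let m1 := @measurable_ball1 R n.
Let me := @measurable_enorm R n.
Let n0 : (0 < n)%N. Proof. exact: ltn_trans n_gt2. Qed.
Notation gam := (@gap R n a).
Let g0 : 0 < gam. Proof. exact: gap_gt0. Qed.

Let n2 : 2 < n%:R :> R. Proof. by rewrite ltr_nat. Qed.
Let nd0 : 0 < n%:R - 2 * d. Proof. by have := n2; case/andP : d_itv => d0 d1 ?; lra. Qed.

Lemma exponent_gt2 : 2 < q.
Proof. by rewrite q_def ltr_pdivlMr//; case/andP : d_itv => d0 d1; lra. Qed.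

Lemma exponent_gap : 2^-1 - q^-1 = d / n%:R.
Proof.
have nn : n%:R != 0 :> R by rewrite gt_eqF// (lt_trans _ n2).
have nd : n%:R - 2 * d != 0 by rewrite gt_eqF.
by rewrite q_def; field; rewrite nn nd.
Qed.

(** The scale invariance of the critical term: the critical weight times the power [(q - 2) / 2] of
    the pointwise weight [|x|^(-gam)] is exactly the Hardy weight. *)
Lemma exponent_hardy : - b * q - gam * ((q - 2) / 2) = - 2 * (a + 1).
Proof.
have nd : n%:R - 2 * d != 0 by rewrite gt_eqF.
have -> : b = 1 + a - d by rewrite d_def; ring.
by rewrite q_def /gap; field; rewrite nd.
Qed.

Lemma radial_pointwise w : D12rad a Om w ->
  {ae mu, forall x, Om x ->
     w.1 x ^+ 2 <= @mean_const R n a * enorm x `^ (- gam) * inner a w w}.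
Proof.
move=> Vw; have [Dw _] := Vw.
apply: filterS2 (@ae_neq0 R n n_gt2) (radial_representation n_gt2 a_lt Vw) => x x0 wx xO.
by rewrite wx//; apply: radial_mean_sqr; rewrite ?enorm_gt0.
Qed.

Definition crit (u : 'rV[R]_n -> R) (x : 'rV[R]_n) : R := enorm x `^ (- b * q) * `|u x| `^ q.

Definition crit_const (K : R) : R :=
  (@mean_const R n a * K) `^ ((q - 2) / 2) * (8 / gam ^+ 2 * K).

(** Write [|w|^q] as [(w^2)^((q-2)/2) * w^2]: the pointwise bound applies to the first factor and
    Hardy's inequality to the second, the exponents matching by [exponent_hardy]. This is a Sobolev
    inequality for radial functions, with a constant that is not sharp. *)
Lemma crit_le w (K : R) : D12rad a Om w -> inner a w w <= K ->
  (\int[mu]_(x in Om) (crit w.1 x)%:E <= (crit_const K)%:E)%E.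
Proof.
move=> Vw wK; have [Dw _] := Vw; have [mw _ _] := Dw.
have q2 := exponent_gt2.
have K0 : 0 <= K by apply: le_trans wK; rewrite innerE fine_ge0// dirichlet_ge0.
have mc0 := mean_const_ge0 n_gt2 a_lt.
have H := hardy_D12 n_gt2 a_lt Dw.
rewrite (D12_fin n_gt2 a_lt Dw) -innerE -EFinM in H.
apply: (@le_trans _ _ (((@mean_const R n a * K) `^ ((q - 2) / 2))%:E * hardy_integral a Om w.1)%E); last first.
  rewrite /crit_const EFinM; apply: lee_wpmul2l; first by rewrite lee_fin powR_ge0.
  apply: le_trans H _; rewrite lee_fin ler_wpM2l// divr_ge0// ?sqr_ge0//.
rewrite /hardy_integral -ge0_integralZl//; last 3 first.
- exact: measurable_hardy.
- by move=> x _; rewrite lee_fin mulr_ge0 ?powR_ge0 ?sqr_ge0.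
- by rewrite lee_fin powR_ge0.
apply: ae_ge0_le_integral => //.
- by move=> x _; rewrite lee_fin mulr_ge0 ?powR_ge0.
- by rewrite /crit; mfun.
- by move=> x _; apply: mule_ge0; rewrite lee_fin ?powR_ge0// mulr_ge0 ?powR_ge0 ?sqr_ge0.
- by have := measurable_hardy a mw => mH; mfun.
apply: filterS2 (@ae_neq0 R n n_gt2) (radial_pointwise Vw) => x x0 wx xO.
have e0 : 0 < enorm x by rewrite enorm_gt0.
rewrite -EFinM lee_fin /crit.
have -> : `|w.1 x| `^ q = (w.1 x ^+ 2) `^ ((q - 2) / 2) * w.1 x ^+ 2.
  rewrite -[w.1 x ^+ 2]real_normK ?num_real//.
  have [->|wn] := eqVneq `|w.1 x| 0.
    by rewrite expr0n/= mulr0 powR0// gt_eqF//; lra.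
  by rewrite -powR_mulrn// -powRrM -powRD ?(negbTE wn) ?implybT//; congr (_ `^ _); field.
apply: (@le_trans _ _ (enorm x `^ (- b * q) * ((@mean_const R n a * enorm x `^ (- gam) * K) `^ ((q - 2) / 2) * w.1 x ^+ 2))).
  apply: ler_wpM2l; first exact: powR_ge0.
  apply: ler_wpM2r; first exact: sqr_ge0.
  apply: ge0_ler_powR; rewrite ?nnegrE ?sqr_ge0//; first by lra.
    by apply: mulr_ge0 => //; rewrite mulr_ge0 ?powR_ge0.
  by apply: le_trans (wx xO) _; rewrite ler_wpM2l// mulr_ge0 ?powR_ge0.
have -> : (@mean_const R n a * enorm x `^ (- gam) * K) `^ ((q - 2) / 2) =
    (@mean_const R n a * K) `^ ((q - 2) / 2) * enorm x `^ (- gam * ((q - 2) / 2)).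
  rewrite (powRrM (enorm x) (- gam)) mulrAC; apply: powRM; first exact: mulr_ge0.
  exact: powR_ge0.
have -> : enorm x `^ (- 2 * (a + 1)) = enorm x `^ (- b * q) * enorm x `^ (- gam * ((q - 2) / 2)).
  by rewrite -powRD ?(gt_eqF e0) ?implybT// -exponent_hardy; congr (_ `^ _); ring.
by rewrite le_eqVlt; apply/orP; left; apply/eqP; ring.
Qed.

Lemma measurable_crit D (u : 'rV[R]_n -> R) : measurable_fun D u -> measurable_fun D (crit u).
Proof. by move=> mu'; rewrite /crit; mfun. Qed.

Lemma crit_ge0 u x : 0 <= crit u x.
Proof. by rewrite mulr_ge0 ?powR_ge0. Qed.

Lemma crit_integrable w : D12rad a Om w -> mu.-integrable Om (EFin \o crit w.1).
Proof.
move=> Vw; have [[mw _ _] _] := Vw; apply/integrableP; split.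
  by apply/measurable_EFinP; exact: measurable_crit.
apply: le_lt_trans (ltry (crit_const (inner a w w))).
apply: le_trans (crit_le Vw (lexx _)); rewrite le_eqVlt; apply/orP; left; apply/eqP.
by apply: eq_integral => x _; rewrite gee0_abs// lee_fin crit_ge0.
Qed.

Definition low (u v : 'rV[R]_n -> R) (x : 'rV[R]_n) : R :=
  enorm x `^ (- 2 * (a + 1) + c) * (u x * v x).

(** The weight of the lower order term times the pointwise weight [|x|^(-gam)] is [|x|^(c - n)],
    integrable on the ball because [c > 0]. *)
Definition low_bound (K : R) (x : 'rV[R]_n) : R := @mean_const R n a * K * enorm x `^ (c - n%:R).

Lemma low_bound_integrable K : mu.-integrable Om (EFin \o low_bound K).
Proof.
apply: (@integrableZl _ _ _ mu Om m1 (@mean_const R n a * K) (fun x => (enorm x `^ (c - n%:R))%:E)).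
apply/integrableP; split; first by mfun.
apply: le_lt_trans (ball_power_integral n0 c_gt0).
rewrite le_eqVlt; apply/orP; left; apply/eqP.
by apply: eq_integral => x _; rewrite gee0_abs// lee_fin powR_ge0.
Qed.

Lemma low_le v w (K : R) : D12rad a Om v -> D12rad a Om w ->
  inner a v v <= K -> inner a w w <= K ->
  {ae mu, forall x, Om x -> `|low v.1 w.1 x| <= low_bound K x}.
Proof.
move=> Vv Vw vK wK.
apply: filterS3 (@ae_neq0 R n n_gt2) (radial_pointwise Vv) (radial_pointwise Vw) => x x0 vx wx xO.
have e0 : 0 < enorm x by rewrite enorm_gt0.
rewrite /low /low_bound normrM ger0_norm ?powR_ge0//.
have -> : enorm x `^ (c - n%:R) = enorm x `^ (- 2 * (a + 1) + c) * enorm x `^ (- gam).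
  by rewrite -powRD ?(gt_eqF e0) ?implybT//; congr (_ `^ _); rewrite /gap; ring.
rewrite mulrCA; apply: ler_wpM2l; first exact: powR_ge0.
have mc0 : 0 <= @mean_const R n a * enorm x `^ (- gam).
  by rewrite mulr_ge0 ?powR_ge0// mean_const_ge0.
have vx' := le_trans (vx xO) (ler_wpM2l mc0 vK).
have wx' := le_trans (wx xO) (ler_wpM2l mc0 wK).
have := sqr_ge0 (`|v.1 x| - `|w.1 x|).
rewrite sqrrB !real_normK ?num_real// normrM => h; rewrite mulrAC; lra.
Qed.

Lemma measurable_low D (u v : 'rV[R]_n -> R) : measurable_fun D u -> measurable_fun D v ->
  measurable_fun D (low u v).
Proof. by move=> mu' mv'; rewrite /low; mfun. Qed.

Lemma low_integrable v w : D12rad a Om v -> D12rad a Om w ->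
  mu.-integrable Om (EFin \o low v.1 w.1).
Proof.
move=> Vv Vw; have [[mv _ _] _] := Vv; have [[mw _ _] _] := Vw.
pose K := Num.max (inner a v v) (inner a w w).
have mL : measurable_fun Om (EFin \o low v.1 w.1) by apply/measurable_EFinP; exact: measurable_low.
apply/integrableP; split => //.
have /integrableP[mB fB] := low_bound_integrable K.
apply: le_lt_trans fB; apply: ae_ge0_le_integral => //.
- exact: measurableT_comp.
- exact: measurableT_comp.
have := @low_le v w K Vv Vw; rewrite !le_max !lexx ?orbT => /(_ isT isT).
apply: filterS => x h xO; rewrite lee_fin; apply: le_trans (h xO) _; exact: ler_norm.
Qed.

Definition lowform v w : R := \int[mu]_(x in Om) low v.1 w.1 x.

Lemma lowformE w : power_integral (- 2 * (a + 1) + c) 2 Om w.1 = lowform w w.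
Proof.
apply: eq_Rintegral => x _; rewrite /low powR_mulrn//.
by rewrite real_normK ?num_real// expr2.
Qed.

Lemma lowformZD (k : R) u v w : D12rad a Om u -> D12rad a Om v -> D12rad a Om w ->
  lowform (k *: u + v) w = k * lowform u w + lowform v w.
Proof.
move=> Vu Vv Vw; have iu := low_integrable Vu Vw; have iv := low_integrable Vv Vw.
rewrite /lowform -(RintegralZl k m1 iu) -RintegralD//; last exact: (integrableZl m1 k iu).
by apply: eq_Rintegral => x _; rewrite /low (_ : (k *: u + v).1 x = k * u.1 x + v.1 x)//; ring.
Qed.

Lemma lowformC v w : lowform v w = lowform w v.
Proof. by apply: eq_Rintegral => x _; rewrite /low mulrA mulrAC -mulrA. Qed.

Lemma lowform_ge0 w : 0 <= lowform w w.
Proof.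
by apply: Rintegral_ge0 => x _; rewrite /low mulr_ge0 ?powR_ge0// -expr2 sqr_ge0.
Qed.

Lemma lowform_cvg (v w : nat -> @grad_pair R n) v0 w0 (K : R) :
  (forall k, D12rad a Om (v k)) -> (forall k, D12rad a Om (w k)) ->
  D12rad a Om v0 -> D12rad a Om w0 ->
  (forall k, inner a (v k) (v k) <= K) -> (forall k, inner a (w k) (w k) <= K) ->
  {ae mu, forall x, Om x -> (v k).1 x @[k --> \oo] --> v0.1 x} ->
  {ae mu, forall x, Om x -> (w k).1 x @[k --> \oo] --> w0.1 x} ->
  lowform (v k) (w k) @[k --> \oo] --> lowform v0 w0.
Proof.
move=> Vv Vw V0 W0 vK wK cv cw.
have mL k : measurable_fun Om (EFin \o low (v k).1 (w k).1).
  by have [[mv _ _] _] := Vv k; have [[mw _ _] _] := Vw k; apply/measurable_EFinP; exact: measurable_low.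
have mL0 : measurable_fun Om (EFin \o low v0.1 w0.1).
  by have [[mv _ _] _] := V0; have [[mw _ _] _] := W0; apply/measurable_EFinP; exact: measurable_low.
have ptw : {ae mu, forall x, Om x -> (EFin \o low (v k).1 (w k).1) x @[k --> \oo] --> (EFin \o low v0.1 w0.1) x}.
  apply: filterS2 cv cw => x vx wx xO; apply: cvg_EFin; first exact: nearW.
  by apply: cvgM; [exact: cvg_cst|apply: cvgM; [exact: vx|exact: wx]].
have dom : {ae mu, forall x, forall k, Om x -> (`|(EFin \o low (v k).1 (w k).1) x| <= (EFin \o low_bound K) x)%E}.
  apply/ae_foralln => k.
  by apply: filterS (low_le (Vv k) (Vw k) (vK k) (wK k)) => x h xO; rewrite lee_fin h.
have [_ _ h] := dominated_convergence m1 mL mL0 ptw (low_bound_integrable K) dom.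
have f0 : (\int[mu]_(x in Om) (low v0.1 w0.1 x)%:E)%E \is a fin_num.
  by apply: (integrable_fin_num m1); exact: low_integrable.
by rewrite /lowform /Rintegral; apply: fine_cvg; rewrite fineK.
Qed.

(** The same algebra of semi-inner products then scales and expands the energy form and the lower
    order form together, in [lambda1_le] and [frechetE]. *)
Lemma lowform_sip : semi_inner_product (D12rad a Om) lowform.
Proof.
split.
- by move=> k v w; exact: D12radZD.
- by move=> v w _ _; exact: lowformC.
- by move=> k u v w; exact: lowformZD.
- by move=> w _; exact: lowform_ge0.
Qed.

End weighted_forms.

(** * Inequalities with the constants [lambda1] and [S_R] *)

Section best_constants.
Context {R : realType} {n : nat} (a b c q : R).
Notation mu := (@lebesgue_rV R n).
Notation Om := (@open_unit_ball R n).
Hypothesis n_gt2 : (2 < n)%N.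
Hypothesis a_lt : a < (n%:R - 2) / 2.
Hypothesis c_gt0 : 0 < c.
Hypothesis q_gt0 : 0 < q.
Implicit Types (v w : @grad_pair R n).

Let m1 := @measurable_ball1 R n.

Lemma lambda1_le w : D12rad a Om w -> lambda1 a c Om * lowform a c w w <= inner a w w.
Proof.
move=> Vw; have PB := inner_sip n_gt2 a_lt; have PC := lowform_sip n_gt2 a_lt c_gt0.
have N0 : 0 <= inner a w w := sip_ge0 PB Vw.
have := sip_ge0 PC Vw; rewrite le_eqVlt => /orP[/eqP <-|C0]; first by rewrite mulr0.
pose k := (Num.sqrt (lowform a c w w))^-1.
have k2 : k ^+ 2 = (lowform a c w w)^-1 by rewrite exprVn sqr_sqrtr ?ltW.
have Vk : D12rad a Om (k *: w) := sip_scale PB k Vw.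
have scale (B : @grad_pair R n -> @grad_pair R n -> R) : semi_inner_product (D12rad a Om) B ->
    B (k *: w) (k *: w) = k ^+ 2 * B w w.
  by move=> P; rewrite (sip_Zl P)// (sip_sym P Vw Vk) (sip_Zl P)// mulrA expr2.
rewrite -ler_pdivlMr// mulrC -k2 -(scale _ PB); apply: ge_inf.
  by exists 0 => _ [v _ <-]; rewrite fine_ge0// dirichlet_ge0.
exists (k *: w); last by rewrite innerE.
by split; [case: Vk|rewrite lowformE (scale _ PC) k2 mulVf// gt_eqF].
Qed.

(** [S_R] is an infimum over functions on the whole space, so a function on the ball has to be
    extended before it can be a competitor. *)
Definition zero_extension w : @grad_pair R n :=
  (fun x => \1_Om x * w.1 x, fun x => \1_Om x *: w.2 x).

Lemma zero_extension_in w x : Om x ->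
  (zero_extension w).1 x = w.1 x /\ (zero_extension w).2 x = w.2 x.
Proof. by move=> xO; rewrite /zero_extension/= indicT1// mul1r scale1r. Qed.

Lemma zero_extension_out w x : ~ Om x ->
  (zero_extension w).1 x = 0 /\ (zero_extension w).2 x = 0.
Proof. by move=> xO; rewrite /zero_extension/= indicF0// mul0r scale0r. Qed.

Lemma zero_extension_dirichlet w (g : 'rV[R]_n -> 'rV[R]_n) : (forall x, ~ Om x -> g x = 0) ->
  dirichlet a setT (g \- (zero_extension w).2) = dirichlet a Om (g \- w.2).
Proof.
move=> g0; rewrite /dirichlet [RHS]integral_indicM; apply: eq_integral => x _; congr (_%:E).
have [xO|xO] := pselect (Om x).
  by rewrite indicT1// mul1r (_ : (g \- _) x = g x - (zero_extension w).2 x)// (zero_extension_in w xO).2.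
rewrite indicF0// mul0r (_ : (g \- _) x = g x - (zero_extension w).2 x)//.
by rewrite (zero_extension_out w xO).2 g0// subr0 enorm0 expr0n mulr0.
Qed.

Lemma zero_extension_dirichlet0 w : dirichlet a setT (zero_extension w).2 = dirichlet a Om w.2.
Proof.
rewrite /dirichlet [RHS]integral_indicM; apply: eq_integral => x _; congr (_%:E).
have [xO|xO] := pselect (Om x); first by rewrite indicT1// mul1r (zero_extension_in w xO).2.
by rewrite indicF0// mul0r (zero_extension_out w xO).2 enorm0 expr0n mulr0.
Qed.

Lemma zero_extension_power_integral w s :
  power_integral s q setT (zero_extension w).1 = power_integral s q Om w.1.
Proof.
rewrite /power_integral /Rintegral [in RHS]integral_indicM; congr fine; apply: eq_integral => x _.
congr (_%:E); have [xO|xO] := pselect (Om x); first by rewrite indicT1// mul1r (zero_extension_in w xO).1.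
by rewrite indicF0// mul0r (zero_extension_out w xO).1 normr0 powR0 ?mulr0// gt_eqF.
Qed.

Lemma zero_extension_D12rad w : D12rad a Om w -> D12rad a setT (zero_extension w).
Proof.
move=> [[mw1 mw2 [phi [tphi cphi dphi]]] [h wh]].
have restr (u : 'rV[R]_n -> R) : measurable_fun Om u -> measurable_fun setT (fun x => \1_Om x * u x).
  move=> mu'; have := (measurable_restrict u m1 measurableT).1; rewrite setTI => /(_ mu').
  rewrite (_ : u \_ Om = (fun x => \1_Om x * u x))//; apply/funext => x.
  by rewrite patchE indicE; case: ifPn => _; rewrite ?mul1r ?mul0r.
split; last first.
  exists (fun r => if r < 1 then h r else 0); apply: filterS wh => x wx _.
  case: ifPn => xO; first by rewrite (zero_extension_in w xO).1 wx.
  by rewrite (zero_extension_out w _).1//; apply/negP.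
split; first exact: restr.
  apply: measurable_fun_coorP => i.
  under eq_fun do rewrite mxE.
  by apply: restr; exact: measurable_fun_coor.
exists phi; split.
- by move=> k; have [sf cf _] := tphi k; split.
- apply: filterS cphi => x xc _; have [xO|xO] := pselect (Om x).
    by rewrite (zero_extension_in w xO).1; exact: xc.
  rewrite (zero_extension_out w xO).1 (_ : (fun k => phi k x) = cst 0); first exact: cvg_cst.
  by apply/funext => k; rewrite (test_function_eq0 (tphi k)).
have E k : dirichlet a setT (gradient (phi k) \- (zero_extension w).2) =
    dirichlet a Om (gradient (phi k) \- w.2).
  by apply: zero_extension_dirichlet => x; exact: gradient_eq0 (tphi k).
by under eq_fun do rewrite E.
Qed.

Lemma power_integral_ge0 s p D (u : 'rV[R]_n -> R) : 0 <= power_integral s p D u.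
Proof. by apply: Rintegral_ge0 => x _; rewrite mulr_ge0 ?powR_ge0. Qed.

Lemma power_integral_eq0 s (u : 'rV[R]_n -> R) : measurable_fun setT u ->
  {ae mu, forall x, u x = 0} -> power_integral s q setT u = 0.
Proof.
move=> m_u u0; rewrite /power_integral /Rintegral.
rewrite (@ae_eq_integral _ _ _ mu setT (cst 0%E)) ?integral0//; first by mfun.
by apply: filterS u0 => x -> _; rewrite normr0 powR0 ?mulr0// gt_eqF.
Qed.

Lemma S_R_le w : D12rad a Om w ->
  @S_R R n a b q * power_integral (- b * q) q Om w.1 `^ (2 / q) <= inner a w w.
Proof.
move=> Vw; have N0 : 0 <= inner a w w := sip_ge0 (inner_sip n_gt2 a_lt) Vw.
have Ve := zero_extension_D12rad Vw.
have q2 : 2 / q != 0 by rewrite gt_eqF// divr_gt0.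
have := power_integral_ge0 (- b * q) q Om w.1; rewrite le_eqVlt => /orP[/eqP B0|B0].
  have -> : power_integral (- b * q) q Om w.1 `^ (2 / q) = 0 by rewrite -[X in X `^ _]B0 powR0.
  by rewrite mulr0.
have B0' : 0 < power_integral (- b * q) q Om w.1 `^ (2 / q) := powR_gt0 _ B0.
rewrite -(ler_pdivlMr _ _ B0'); apply: ge_inf.
  by exists 0 => _ [v _ <-]; apply: divr_ge0; [apply/fine_ge0/dirichlet_ge0|exact: powR_ge0].
exists (zero_extension w).
  split => // w0; have [[mw0 _ _] _] := Ve.
  move: B0; rewrite -zero_extension_power_integral.
  by have -> := power_integral_eq0 (- b * q) mw0 w0; rewrite ltxx.
by rewrite zero_extension_power_integral zero_extension_dirichlet0 innerE.
Qed.

Lemma S_R_ge0 : 0 <= @S_R R n a b q.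
Proof.
set E := [set fine (dirichlet a setT w.2) /
           power_integral (- b * q) q setT w.1 `^ (2 / q) | w in
    [set w : @grad_pair R n | D12rad a setT w /\ ~ {ae mu, forall x, w.1 x = 0}]].
(* The infimum of the empty set is [0] by convention. *)
have [E0|/set0P En] := eqVneq E set0; first by rewrite /S_R -/E E0 inf0.
apply: lb_le_inf => // _ [v _ <-].
by apply: divr_ge0; [apply/fine_ge0/dirichlet_ge0|exact: powR_ge0].
Qed.

End best_constants.

(** * The Brezis-Lieb splitting *)

Section power_inequalities.
Context {R : realType}.
Implicit Types (p q x y z e : R).

Lemma young_powR q x y : 1 < q -> 0 <= x -> 0 <= y ->
  x `^ (q - 1) * y <= (1 - q^-1) * x `^ q + q^-1 * y `^ q.
Proof.
move=> q1 x0 y0.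
have q0 : 0 < q by lra.
have q10 : 0 < q - 1 by lra.
have pq : (q / (q - 1))^-1 + q^-1 = 1 by field; rewrite !gt_eqF.
have := conjugate_powR (powR_ge0 x (q - 1)) y0 (divr_gt0 q0 q10) q0 pq.
rewrite -powRrM (_ : (q - 1) * (q / (q - 1)) = q); last by field; rewrite gt_eqF.
have -> : x `^ q / (q / (q - 1)) = (1 - q^-1) * x `^ q by field; rewrite !gt_eqF.
by rewrite [y `^ q / q]mulrC.
Qed.

(** The derivative of [|x|^q / q]. *)
Definition signed_powR q x : R := `|x| `^ (q - 2) * x.

Lemma normrX_powR q x : 2 < q -> `|x| `^ (q - 2) * x ^+ 2 = `|x| `^ q.
Proof.
move=> q2; have [->|x0] := eqVneq x 0.
  by rewrite expr0n/= mulr0 normr0 powR0// gt_eqF//; lra.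
rewrite -[x ^+ 2]real_normK ?num_real// -powR_mulrn// -powRD; last by rewrite normr_eq0 x0 implybT.
by congr (_ `^ _); ring.
Qed.

Lemma signed_powR_self q x : 2 < q -> signed_powR q x * x = `|x| `^ q.
Proof. by move=> q2; rewrite /signed_powR -mulrA -expr2 normrX_powR. Qed.

Lemma norm_signed_powR q x : 2 < q -> `|signed_powR q x| = `|x| `^ (q - 1).
Proof.
move=> q2; rewrite /signed_powR normrM ger0_norm ?powR_ge0//.
have [->|x0] := eqVneq x 0.
  by rewrite normr0 mulr0 powR0// gt_eqF//; lra.
rewrite -[X in _ * X]powRr1// -powRD; last by rewrite normr_eq0 x0 implybT.
by congr (_ `^ _); ring.
Qed.

(** The convexity of [|x|^q], obtained from Young's inequality for [|x|^(q-1) |y|] instead of by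
    differentiation. *)
Lemma powR_tangent q x y : 2 < q ->
  `|x| `^ q + q * (signed_powR q x * (y - x)) <= `|y| `^ q.
Proof.
move=> q2; have q1 : 1 < q by lra.
have := young_powR q1 (normr_ge0 x) (normr_ge0 y).
rewrite -norm_signed_powR// -normrM => /(le_trans (ler_norm _)) h.
have q0 : 0 < q by lra.
rewrite mulrBr signed_powR_self//.
have := ler_wpM2l (ltW q0) h.
have -> : q * ((1 - q^-1) * `|x| `^ q + q^-1 * `|y| `^ q) =
    q * `|x| `^ q - `|x| `^ q + `|y| `^ q by field; rewrite gt_eqF.
rewrite [q * (_ - _)]mulrBr; lra.
Qed.

(** Choose [t] with [(1 + t)^p = 1 + e]. If [y <= t x] the sum is at most [(1 + t) x], and otherwise
    at most [(1 + t^-1) y]. *)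
Lemma powRD_le p e : 0 < p -> 0 < e -> exists C, 0 <= C /\
  forall x y, 0 <= x -> 0 <= y -> (x + y) `^ p <= (1 + e) * x `^ p + C * y `^ p.
Proof.
move=> p0 e0; pose t := (1 + e) `^ p^-1 - 1.
have t0 : 0 < t.
  have : 1 `^ p^-1 < (1 + e) `^ p^-1.
    by apply: gt0_ltr_powR; rewrite ?invr_gt0 ?nnegrE//; lra.
  by rewrite powR1 subr_gt0.
have te : (1 + t) `^ p = 1 + e.
  rewrite /t addrC subrK -powRrM mulVf ?gt_eqF// powRr1//; lra.
exists ((1 + t^-1) `^ p); split; first exact: powR_ge0.
have ti : 0 < t^-1 by rewrite invr_gt0.
have t1 : 0 <= 1 + t by rewrite addr_ge0 ?ltW.
have ti1 : 0 <= 1 + t^-1 by rewrite addr_ge0 ?(ltW ti).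
move=> x y x0 y0; rewrite -te -(powRM _ t1 x0) -(powRM _ ti1 y0).
have xy0 : 0 <= x + y by rewrite addr_ge0.
have [yx|xy] := leP y (t * x).
  apply: (@le_trans _ _ (((1 + t) * x) `^ p)); last by rewrite lerDl powR_ge0.
  apply: ge0_ler_powR; rewrite ?nnegrE ?(ltW p0)//; first exact: mulr_ge0.
  by rewrite mulrDl mul1r lerD2l.
apply: (@le_trans _ _ (((1 + t^-1) * y) `^ p)); last by rewrite lerDr powR_ge0.
apply: ge0_ler_powR; rewrite ?nnegrE ?(ltW p0)//; first exact: mulr_ge0.
by rewrite mulrDl mul1r addrC lerD2l -ler_pdivrMl ?invr_gt0// invrK ltW.
Qed.

(** [powRD_le] is used twice, to pass from [x] to [x + y] and back. The second use leaves an error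
    [e' |x + y|^p], re-expanded by the first; [e' <= 1] bounds it by [2 e' |x|^p] plus a multiple of
    [|y|^p], and [e' <= e / 2] absorbs this. *)
Lemma powR_norm_diff p e : 0 < p -> 0 < e -> exists C, 0 <= C /\
  forall x y, `| `|x + y| `^ p - `|x| `^ p| <= e * `|x| `^ p + C * `|y| `^ p.
Proof.
move=> p0 e0; pose e' := Num.min e 1 / 2.
have m0 : 0 < Num.min e 1 by rewrite lt_min e0 ltr01.
have e'0 : 0 < e' by rewrite divr_gt0.
have e'1 : e' <= 1 by rewrite /e' ler_pdivrMr// mul1r ge_min; apply/orP; right; lra.
have e'e : e' <= e / 2 by rewrite /e' ler_pM2r ?invr_gt0// ge_min lexx.
have [C [C0 H]] := powRD_le p0 e'0.
have mono x y : 0 <= x -> x <= y -> x `^ p <= y `^ p.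
  by move=> x0 xy; apply: ge0_ler_powR; rewrite ?nnegrE ?(ltW p0)// (le_trans x0).
exists (2 * C); split; first by rewrite mulr_ge0.
move=> x y; set X := `|x| `^ p; set Y := `|y| `^ p; set Z := `|x + y| `^ p.
have X0 : 0 <= X := powR_ge0 _ _.
have Y0 : 0 <= Y := powR_ge0 _ _.
have Z0 : 0 <= Z := powR_ge0 _ _.
have h1 : Z <= (1 + e') * X + C * Y.
  by apply: le_trans (H _ _ (normr_ge0 x) (normr_ge0 y)); apply: mono; rewrite ?ler_normD.
have h2 : X <= (1 + e') * Z + C * Y.
  apply: le_trans (H _ _ (normr_ge0 (x + y)) (normr_ge0 y)); apply: mono => //.
  by rewrite -{1}[x](addrK y) ler_normB.
have CY : 0 <= C * Y by rewrite mulr_ge0.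
have eX : e' * X <= e / 2 * X by rewrite ler_wpM2r.
have h3 : e' * Z <= 2 * (e' * X) + C * Y.
  apply: (@le_trans _ _ (e' * ((1 + e') * X + C * Y))); first by rewrite ler_wpM2l// ltW.
  rewrite mulrDr; apply: lerD; last by rewrite ler_piMl.
  rewrite mulrCA ler_wpM2r ?mulr_ge0// ?(ltW e'0)//; lra.
rewrite ler_norml; apply/andP; split; lra.
Qed.

Lemma cvg_powR_norm p (f : nat -> R) (l : R) : 0 < p -> f k @[k --> \oo] --> l ->
  `|f k| `^ p @[k --> \oo] --> `|l| `^ p.
Proof.
move=> p0 fl; apply/cvgrPdist_le => e e0.
have L0 : 0 <= `|l| `^ p := powR_ge0 _ _.
have e1 : 0 < e / 2 / (`|l| `^ p + 1) by rewrite !divr_gt0// ltr_wpDl.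
have [C [C0 H]] := powR_norm_diff p0 e1.
have t0 : 0 < (e / 2 / (C + 1)) `^ p^-1 by rewrite powR_gt0// !divr_gt0// ltr_wpDl.
have /cvgrPdist_le/(_ _ t0) := fl; apply: filterS => k fk.
rewrite distrC (_ : f k = l + (f k - l)); last by rewrite addrC subrK.
apply: le_trans (H _ _) _.
have h1 : e / 2 / (`|l| `^ p + 1) * `|l| `^ p <= e / 2.
  by rewrite mulrAC ler_pdivrMr ?ltr_wpDl// ler_pM2l ?divr_gt0// lerDl.
have h2 : `|f k - l| `^ p <= e / 2 / (C + 1).
  have e2 : 0 <= e / 2 / (C + 1) by rewrite ltW// !divr_gt0// ltr_wpDl.
  have -> : e / 2 / (C + 1) = ((e / 2 / (C + 1)) `^ p^-1) `^ p.
    by rewrite -powRrM mulVf ?lt0r_neq0// powRr1.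
  by apply: ge0_ler_powR; rewrite ?nnegrE ?(ltW p0) ?powR_ge0// distrC.
have h3 : C * `|f k - l| `^ p <= e / 2.
  apply: le_trans (ler_wpM2l C0 h2) _.
  by rewrite mulrCA ler_piMr ?divr_ge0 ?(ltW e0)// ler_pdivrMr ?ltr_wpDl// mul1r lerDl.
by rewrite [leRHS]splitr; exact: lerD.
Qed.

Lemma cvg_signed_powR q (f : nat -> R) (l : R) : 2 < q -> f k @[k --> \oo] --> l ->
  signed_powR q (f k) @[k --> \oo] --> signed_powR q l.
Proof. by move=> q2 fl; apply: cvgM => //; apply: cvg_powR_norm => //; lra. Qed.

Lemma powR_split_le q e : 2 < q -> 0 < e -> exists C, forall x y,
  `| `|x + y| `^ q - `|x| `^ q - `|y| `^ q| <= e * `|x| `^ q + C * `|y| `^ q.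
Proof.
move=> q2 e0; have q0 : 0 < q by lra.
have [C [C0 H]] := powR_norm_diff q0 e0.
exists (C + 1) => x y; apply: le_trans (ler_normB _ _) _.
by rewrite (ger0_norm (powR_ge0 `|y| _)) mulrDl mul1r addrA lerD2r.
Qed.

(** Where [|y| <= e / 2 * |x + y|], the factor [|y|] is absorbed in [|x + y|^q]; elsewhere [|x + y|]
    is controlled by [|y|]. Returning from [|x + y|^q] to [|x|^q] by [powR_norm_diff] costs a factor
    [2], whence [e / 2]. *)
Lemma signed_powR_split_le q e : 2 < q -> 0 < e -> exists C, forall x y,
  `|signed_powR q (x + y) * y - `|y| `^ q| <= e * `|x| `^ q + C * `|y| `^ q.
Proof.
move=> q2 e0; have q0 : 0 < q by lra.
have [C [C0 H]] := powR_norm_diff q0 ltr01.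
have e2 : 0 < e / 2 by rewrite divr_gt0.
exists (e / 2 * C + ((e / 2)^-1) `^ (q - 1) + 1) => x y; apply: le_trans (ler_normB _ _) _.
rewrite (ger0_norm (powR_ge0 `|y| _)) normrM norm_signed_powR//.
have X0 := powR_ge0 `|x| q; have Y0 := powR_ge0 `|y| q; have Z0 := powR_ge0 `|x + y| q.
have h : `|x + y| `^ (q - 1) * `|y| <= e / 2 * `|x + y| `^ q + ((e / 2)^-1) `^ (q - 1) * `|y| `^ q.
  have pq z : 0 <= z -> z `^ (q - 1) * z = z `^ q.
    move=> z0; have [->|zn] := eqVneq z 0.
      by rewrite mulr0 powR0// gt_eqF.
    rewrite -[X in _ * X]powRr1// -powRD ?zn ?implybT//; congr (_ `^ _); ring.
  have [yz|zy] := leP `|y| (e / 2 * `|x + y|).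
    apply: (@le_trans _ _ (e / 2 * `|x + y| `^ q)); last by rewrite lerDl mulr_ge0 ?powR_ge0.
    rewrite -[X in _ <= _ * X]pq// mulrCA; apply: ler_wpM2l => //; exact: powR_ge0.
  apply: (@le_trans _ _ (((e / 2)^-1) `^ (q - 1) * `|y| `^ q)); last first.
    by rewrite lerDr mulr_ge0// ltW.
  have i0 : 0 <= (e / 2)^-1 by rewrite invr_ge0 ltW.
  rewrite -[X in _ <= _ * X]pq// mulrA -powRM//; apply: ler_wpM2r => //.
  apply: ge0_ler_powR; rewrite ?nnegrE ?mulr_ge0//; first by lra.
  by rewrite ler_pdivlMl// ltW.
have := H x y; rewrite ler_norml => /andP[_ h2].
have h3 : e / 2 * `|x + y| `^ q <= e / 2 * (2 * `|x| `^ q + C * `|y| `^ q).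
  by rewrite ler_wpM2l ?(ltW e2)//; lra.
lra.
Qed.

End power_inequalities.

Section brezis_lieb.
Local Open Scope ereal_scope.
Context d (T : measurableType d) {R : realType} (mu : {measure set T -> \bar R}) (D : set T).

(* [max (|h_m| - e k_m) 0] is dominated by [C g], so dominated convergence
   applies to it although it does not apply to [h_m]. *)
Lemma brezis_lieb (h k : nat -> T -> R) (g : T -> R) (K : R) : measurable D ->
  (forall m, measurable_fun D (h m)) -> (forall m, measurable_fun D (k m)) ->
  (forall m x, D x -> (0 <= k m x)%R) ->
  (forall m, \int[mu]_(x in D) (k m x)%:E <= K%:E) ->
  mu.-integrable D (EFin \o g) ->
  (forall e : R, (0 < e)%R -> exists C : R, forall m x, D x ->
     (`|h m x| <= e * k m x + C * g x)%R) ->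
  {ae mu, forall x, D x -> h m x @[m --> \oo] --> (0 : R)%R} ->
  \int[mu]_(x in D) `|h m x|%:E @[m --> \oo] --> 0.
Proof.
move=> mD mh mk k0 kK ig hk h0.
have K0 : (0 <= K)%R.
  by rewrite -lee_fin; apply: le_trans (kK 0%N); apply: integral_ge0 => x xD; rewrite lee_fin k0.
apply/(cvge0P (fun m => _ : 0 <= \int[mu]_(x in D) `|h m x|%:E)) => [m|e e0].
  by apply: integral_ge0 => x _; rewrite lee_fin.
have e1 : (0 < e / 2 / (K + 1))%R by rewrite !divr_gt0// ltr_wpDl.
set t := (e / 2 / (K + 1))%R in e1.
have [C hC] := hk t e1.
pose f m x := Num.max (`|h m x| - t * k m x)%R 0%R.
have mf m : measurable_fun D (EFin \o f m).
  apply/measurable_EFinP; apply: measurable_maxr => //.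
  by have := mh m; have := mk m => mkm mhm; mfun.
have f0 : {ae mu, forall x, D x -> (EFin \o f m) x @[m --> \oo] --> (cst 0 : T -> \bar R) x}.
  apply: filterS h0 => x h0x xD; apply: cvg_EFin; first exact: nearW.
  apply: (@squeeze_cvgr _ _ _ _ (cst 0%R) (fun m => `|h m x|%R)).
  - apply: nearW => m; rewrite /= /f le_max lexx orbT/= ge_max normr_ge0 andbT.
    by rewrite gerBl mulr_ge0 ?k0// ltW.
  - exact: cvg_cst.
  - by apply/norm_cvg0P; exact: h0x.
have iC : mu.-integrable D (EFin \o (fun x => C * g x)%R) by exact: (integrableZl mD C ig).
have dom : {ae mu, forall x, forall m, D x -> `|(EFin \o f m) x| <= `|(EFin \o (fun x => C * g x)%R) x|}.
  apply: aeW => x m xD; rewrite /= lee_fin ger0_norm; last by rewrite le_max lexx orbT.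
  rewrite ge_max normr_ge0 andbT; apply: le_trans (ler_norm _).
  by rewrite lerBlDl hC.
have [_ _] := dominated_convergence mD mf (measurable_cst _) f0 (integrable_abse iC) dom.
have fge0 m x : (0 <= f m x)%R by rewrite le_max lexx orbT.
have If0 m : 0 <= \int[mu]_(x in D) (EFin \o f m) x.
  by apply: integral_ge0 => x _; rewrite lee_fin fge0.
rewrite integral0 => /(cvge0P If0) /(_ (e / 2)%R) /(_ (divr_gt0 e0 (ltr0n _ 2))).
apply: filterS => m fm.
have mfm : measurable_fun D (fun x => (f m x)%:E) := mf m.
have mtk : measurable_fun D (fun x => t%:E * (k m x)%:E) by have := mk m => mkm; mfun.
apply: (@le_trans _ _ (\int[mu]_(x in D) ((f m x)%:E + t%:E * (k m x)%:E))).
  apply: ge0_le_integral => //.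
  - by have := mh m => mhm; mfun.
  - exact: emeasurable_funD.
  - move=> x _; rewrite -EFinM -EFinD lee_fin -lerBlDr le_max; apply/orP; left.
    exact: lexx.
rewrite ge0_integralD//; last 2 first.
- by move=> x _; rewrite lee_fin fge0.
- by move=> x xD; rewrite -EFinM lee_fin mulr_ge0 ?k0// ltW.
have t0 : 0 <= t%:E by rewrite lee_fin ltW.
have mkE : measurable_fun D (fun x => (k m x)%:E) by apply/measurable_EFinP.
have kE0 x : D x -> 0 <= (k m x)%:E by move=> xD; rewrite lee_fin k0.
rewrite (ge0_integralZl mu mD mkE kE0 t0).
have -> : (e = e / 2 + e / 2)%R := splitr e.
rewrite EFinD; apply: leeD => //.
apply: le_trans (lee_wpmul2l t0 (kK m)) _; rewrite -EFinM lee_fin /t.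
by rewrite mulrAC ler_pdivrMr ?ltr_wpDl// ler_pM2l ?divr_gt0// lerDl.
Qed.

End brezis_lieb.

(** * The derivative of the energy *)

Section derivative.
Context {R : realType} {n : nat} (a b c d q lam : R).
Notation mu := (@lebesgue_rV R n).
Notation Om := (@open_unit_ball R n).
Hypothesis n_gt2 : (2 < n)%N.
Hypothesis a_lt : a < (n%:R - 2) / 2.
Hypothesis d_def : d = 1 + a - b.
Hypothesis d_itv : 0 < d <= 1.
Hypothesis q_def : q = 2 * n%:R / (n%:R - 2 * d).
Hypothesis c_gt0 : 0 < c.
Implicit Types (u v w : @grad_pair R n) (L : @grad_pair R n -> R) (t e : R).

Let m1 := @measurable_ball1 R n.
Let me := @measurable_enorm R n.
Let q2 : 2 < q := exponent_gt2 n_gt2 d_itv q_def.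
Let q0 : 0 < q. Proof. exact: lt_trans q2. Qed.
Let PB := inner_sip n_gt2 a_lt.
Let PC := lowform_sip n_gt2 a_lt c_gt0.
Notation V := (D12rad a Om).
Notation N w := (inner a w w).
Notation B w := (power_integral (- b * q) q Om w.1).
Notation C := (lowform a c).
Notation E := (energy a b c q lam Om).
Notation norm := (D12norm a Om).

Lemma energyE w : E w = 2^-1 * N w - q^-1 * B w - lam / 2 * C w w.
Proof. by rewrite /energy lowformE innerE. Qed.

Lemma D12normE w : norm w = Num.sqrt (N w).
Proof. by rewrite innerE. Qed.

Lemma D12norm_scale t v : V v -> norm (t *: v) = `|t| * norm v.
Proof.
move=> Vv; have Vt := sip_scale PB t Vv.
rewrite !D12normE (sip_Zl PB)// (sip_sym PB Vv Vt) (sip_Zl PB)// mulrA -expr2.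
by rewrite sqrtrM ?sqr_ge0// sqrtr_sqr.
Qed.

Definition crit_kernel u v (x : 'rV[R]_n) : R :=
  enorm x `^ (- b * q) * (signed_powR q (u.1 x) * v.1 x).

Lemma measurable_crit_kernel u v D : measurable_fun D u.1 -> measurable_fun D v.1 ->
  measurable_fun D (crit_kernel u v).
Proof. by move=> mu' mv'; rewrite /crit_kernel /signed_powR; mfun. Qed.

Lemma crit_kernel_le u v x : `|crit_kernel u v x| <= crit b q u.1 x + crit b q v.1 x.
Proof.
rewrite /crit_kernel /crit normrM ger0_norm ?powR_ge0// -mulrDr.
apply: ler_wpM2l; first exact: powR_ge0.
rewrite normrM norm_signed_powR//.
have q1 : 1 < q by have := q2; lra.
apply: le_trans (young_powR q1 (normr_ge0 _) (normr_ge0 _)) _.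
have qi : 0 < q^-1 by rewrite invr_gt0.
have qi1 : q^-1 <= 1 by rewrite invf_le1// ltW.
have X0 := powR_ge0 `|u.1 x| q; have Y0 := powR_ge0 `|v.1 x| q.
apply: lerD; first by rewrite ler_piMl//; lra.
by rewrite ler_piMl.
Qed.

Lemma crit_kernel_integrable u v : V u -> V v -> mu.-integrable Om (EFin \o crit_kernel u v).
Proof.
move=> Vu Vv; have [[mu' _ _] _] := Vu; have [[mv _ _] _] := Vv.
have iu := crit_integrable n_gt2 a_lt d_def d_itv q_def Vu.
have iv := crit_integrable n_gt2 a_lt d_def d_itv q_def Vv.
apply: (le_integrable m1 _ _ (integrableD m1 iu iv)).
  by apply/measurable_EFinP; exact: measurable_crit_kernel.
move=> x _; rewrite /= lee_fin; apply: le_trans (crit_kernel_le u v x) _; exact: ler_norm.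
Qed.

(** The derivative of [B / q] at [u] in the direction [v]. *)
Definition critform u v : R := \int[mu]_(x in Om) crit_kernel u v x.

Lemma critform_self u : critform u u = B u.
Proof.
by apply: eq_Rintegral => x _; rewrite /crit_kernel signed_powR_self.
Qed.

Lemma crit_tangent u v t : V u -> V v -> B u + q * (t * critform u v) <= B (u + t *: v).
Proof.
move=> Vu Vv; have Vt := sip_scale PB t Vv; have Vs := sip_add PB Vu Vt.
have iu : mu.-integrable Om (EFin \o crit b q u.1) := crit_integrable n_gt2 a_lt d_def d_itv q_def Vu.
have iS : mu.-integrable Om (EFin \o crit b q (u + t *: v).1) := crit_integrable n_gt2 a_lt d_def d_itv q_def Vs.
have ik := crit_kernel_integrable Vu Vv.
have ikt : mu.-integrable Om (EFin \o (fun x => q * t * crit_kernel u v x)) := integrableZl m1 (q * t) ik.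
rewrite (_ : B u + _ = \int[mu]_(x in Om) (crit b q u.1 x + q * t * crit_kernel u v x)).
  apply: le_Rintegral => //; first exact: (integrableD m1 iu ikt).
  move=> x _; rewrite /crit /crit_kernel.
  have := powR_tangent (u.1 x) ((u + t *: v).1 x) q2.
  rewrite (_ : (u + t *: v).1 x = u.1 x + t * v.1 x)// addrAC subrr add0r => h.
  have := ler_wpM2l (powR_ge0 (enorm x) (- b * q)) h; apply: le_trans.
  by rewrite le_eqVlt; apply/orP; left; apply/eqP; ring.
rewrite RintegralD// RintegralZl// /critform mulrA; congr (_ + _).
Qed.

Lemma frechetZ u L t v : is_frechet a Om E u L -> V v -> L (t *: v) = t * L v.
Proof.
move=> [lin _ _] Vv; have := lin (t - 1) v v Vv Vv.
rewrite -[X in L (_ + X)](scale1r v) -scalerDl subrK => ->; ring.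
Qed.

(* As [B] is convex, its tangent line alone determines the directional derivative. *)
Lemma frechetE u L v : V u -> V v -> is_frechet a Om E u L ->
  L v = inner a u v - critform u v - lam * C u v.
Proof.
move=> Vu Vv FL; have [lin _ dif] := FL.
pose l := inner a u v - lam * C u v - L v; pose j := critform u v.
pose kap := N v - lam * C v v.
(* Expanding the quadratic forms and using the tangent inequality for [B] bounds the remainder at
   [t *: v] above by [t * (l - j) + t ^+ 2 / 2 * kap]; differentiability bounds it below. Applied to
   [t] and [-t], this encloses [l - j] on both sides. *)
have key t e r : 0 < e -> (forall v, V v -> norm v <= r -> `|E (u + v) - E u - L v| <= e * norm v) ->
    `|t| * norm v <= r -> - (e * (`|t| * norm v)) <= t * (l - j) + t ^+ 2 / 2 * kap.
  move=> e0 he tr; have Vt := sip_scale PB t Vv; have Vs := sip_add PB Vu Vt.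
  have := he _ Vt; rewrite D12norm_scale// => /(_ tr); rewrite ler_norml => /andP[+ _].
  move=> /le_trans; apply.
  rewrite (frechetZ t FL Vv) !energyE.
  have expand (P : @grad_pair R n -> @grad_pair R n -> R) : semi_inner_product V P ->
      P (u + t *: v) (u + t *: v) = P u u + 2 * t * P u v + t ^+ 2 * P v v.
    move=> HP; rewrite (sip_Dl HP)// !(sip_sym HP _ Vs)// !(sip_Dl HP)// !(sip_Zl HP)//.
    by rewrite (sip_sym HP Vu Vt) (sip_sym HP Vv Vt) !(sip_Zl HP)// (sip_sym HP Vv Vu); ring.
  rewrite (expand _ PB) (expand _ PC).
  have qi : 0 < q^-1 by rewrite invr_gt0.
  have h := ler_wpM2l (ltW qi) (crit_tangent t Vu Vv).
  have hE : q^-1 * (B u + q * (t * critform u v)) = q^-1 * B u + t * j.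
    by rewrite -/j; field; rewrite gt_eqF.
  rewrite hE in h; rewrite /l /kap; lra.
suff : forall e, 0 < e -> `|l - j| <= e.
  move=> H; have /eqP : l - j = 0.
    apply/eqP; rewrite -normr_le0; apply/ler_addgt0Pr => e e0; rewrite add0r; exact: H.
  by rewrite /l /j; lra.
move=> e e0.
have nv0 : 0 <= norm v by rewrite D12normE sqrtr_ge0.
have [e' [e1 ev]] : exists e', 0 < e' /\ e' * norm v <= e / 2.
  exists (e / 2 / (norm v + 1)); split; first by rewrite !divr_gt0// ltr_wpDl.
  by rewrite mulrAC ler_pdivrMr ?ltr_wpDl// ler_pM2l ?divr_gt0// lerDl.
have [r r0 hr] := dif _ e1.
(* The first bound keeps [t *: v] within the radius [r], the second makes the quadratic term at most
   [t * e / 2]. *)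
pose t := Num.min (r / (norm v + 1)) (e / (`|kap| + 1)).
have t0 : 0 < t by rewrite lt_min !divr_gt0// ltr_wpDl.
have tr : t * norm v <= r.
  apply: (@le_trans _ _ (r / (norm v + 1) * norm v)).
    by rewrite ler_wpM2r// ge_min lexx.
  by rewrite mulrAC ler_pdivrMr ?ltr_wpDl// ler_pM2l// lerDl.
have tk : t * `|kap| <= e.
  apply: (@le_trans _ _ (e / (`|kap| + 1) * `|kap|)).
    by rewrite ler_wpM2r// ge_min lexx orbT.
  by rewrite mulrAC ler_pdivrMr ?ltr_wpDl// ler_pM2l// lerDl.
have k1 := key t _ r e1 hr; have k2 := key (- t) _ r e1 hr.
rewrite normrN in k2; rewrite (gtr0_norm t0) in k1 k2.
have {}k1 := k1 tr; have {}k2 := k2 tr.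
have kk : t * kap <= e by apply: le_trans tk; rewrite ler_wpM2l ?ler_norm ?ltW.
have h1 := ler_wpM2l (ltW t0) ev; have h2 := ler_wpM2l (ltW t0) kk.
rewrite ler_norml -(ler_pM2l t0) -[X in _ && X](ler_pM2l t0).
by apply/andP; split; lra.
Qed.

Lemma frechet_le u L e v : V u -> V v -> is_frechet a Om E u L ->
  (dual_norm a Om L <= e%:E)%E -> `|L v| <= e * norm v.
Proof.
move=> Vu Vv FL Le; have [_ [K hK] _] := FL.
have nv0 : 0 <= norm v by rewrite D12normE sqrtr_ge0.
move: nv0; rewrite le_eqVlt => /orP[/eqP nv|nv].
  (* A null vector cannot be normalised, but the boundedness of [L] makes it vanish there. *)
  by have := hK _ Vv; rewrite -nv !mulr0.
have Vz := sip_scale PB (norm v)^-1 Vv.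
have : (`|L ((norm v)^-1 *: v)|%:E <= e%:E)%E.
  apply: le_trans Le; apply: ereal_sup_ubound; exists ((norm v)^-1 *: v) => //; split => //.
  by rewrite D12norm_scale// gtr0_norm ?invr_gt0// mulVf// gt_eqF.
rewrite lee_fin (frechetZ _ FL Vv) normrM gtr0_norm ?invr_gt0//.
by rewrite mulrC ler_pdivrMr.
Qed.

Lemma dual_norm_ge0 L u : V u -> (0 <= dual_norm a Om L)%E.
Proof.
move=> Vu; have V0 := sip_P0 PB Vu.
apply: (@le_trans _ _ `|L 0|%:E); first by rewrite lee_fin.
apply: ereal_sup_ubound; exists 0 => //; split => //.
by rewrite D12normE (sip_B0l PB Vu V0) sqrtr0.
Qed.

End derivative.

(** * The critical terms along an almost everywhere convergent sequence *)

Section compactness.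
Context {R : realType} {n : nat} (a b c d q lam : R).
Notation mu := (@lebesgue_rV R n).
Notation Om := (@open_unit_ball R n).
Hypothesis n_gt2 : (2 < n)%N.
Hypothesis a_lt : a < (n%:R - 2) / 2.
Hypothesis d_def : d = 1 + a - b.
Hypothesis d_itv : 0 < d <= 1.
Hypothesis q_def : q = 2 * n%:R / (n%:R - 2 * d).
Hypothesis c_gt0 : 0 < c.
Implicit Types (v w : @grad_pair R n) (L : @grad_pair R n -> R) (t e : R).

Let m1 := @measurable_ball1 R n.
Let me := @measurable_enorm R n.
Let q2 : 2 < q := exponent_gt2 n_gt2 d_itv q_def.
Let q0 : 0 < q. Proof. exact: lt_trans q2. Qed.
Let PB := inner_sip n_gt2 a_lt.
Let PC := lowform_sip n_gt2 a_lt c_gt0.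
Notation V := (D12rad a Om).
Notation N w := (inner a w w).
Notation B w := (power_integral (- b * q) q Om w.1).
Notation C := (lowform a c).
Notation E := (energy a b c q lam Om).
Notation norm := (D12norm a Om).

Lemma radial_mean_cvg_ae (u : nat -> @grad_pair R n) w : (forall k, V (u k)) -> V w ->
  (forall r : R, 0 < r -> radial_mean (u k) r @[k --> \oo] --> radial_mean w r) ->
  {ae mu, forall x, Om x -> (u k).1 x @[k --> \oo] --> w.1 x}.
Proof.
move=> Vu Vw cv.
have : {ae mu, forall x, forall k, Om x -> (u k).1 x = radial_mean (u k) (enorm x)}.
  by apply/ae_foralln => k; exact: (radial_representation n_gt2 a_lt (Vu k)).
apply: filterS3 (@ae_neq0 R n n_gt2) (radial_representation n_gt2 a_lt Vw) => x x0 wx ux xO.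
rewrite wx// (_ : (fun k => (u k).1 x) = fun k => radial_mean (u k) (enorm x)).
  by apply: cv; rewrite enorm_gt0.
by apply/funext => k; exact: ux.
Qed.

Lemma Rintegral_cvg0 (h : nat -> 'rV[R]_n -> R) :
  (forall k, mu.-integrable Om (EFin \o h k)) ->
  (\int[mu]_(x in Om) `|h k x|%:E @[k --> \oo] --> 0)%E ->
  \int[mu]_(x in Om) h k x @[k --> \oo] --> (0 : R).
Proof.
move=> ih.
have p k : (0 <= \int[mu]_(x in Om) `|h k x|%:E)%E.
  by apply: integral_ge0 => x _; rewrite lee_fin.
move=> /(cvge0P p) H; apply/cvgrPdist_le => e e0; apply: filterS (H e e0) => k hk.
rewrite sub0r normrN -lee_fin EFin_normr_Rintegral//; apply: le_trans hk.
apply: le_abse_integral => //; by case/integrableP : (ih k).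
Qed.

Section splitting.
Variables (u : nat -> @grad_pair R n) (w : @grad_pair R n) (K : R).
Hypothesis Vu : forall k, V (u k).
Hypothesis Vw : V w.
Hypothesis uK : forall k, N (u k) <= K.
Hypothesis cu : {ae mu, forall x, Om x -> (u k).1 x @[k --> \oo] --> w.1 x}.

Let v k : @grad_pair R n := u k - w.
Let Vv k : V (v k) := sip_sub PB (Vu k) Vw.
Let K' := 2 * K + 2 * N w.

Let vK k : N (v k) <= K'.
Proof.
have h : N (v k) = N (u k) - 2 * inner a (u k) w + N w := sip_NB PB (Vu k) Vw.
have Vs := sip_add PB (Vu k) Vw.
have h2 : 0 <= N (u k) + 2 * inner a (u k) w + N w.
  rewrite (_ : _ + N w = N (u k + w)); first exact: (sip_ge0 PB Vs).
  rewrite (sip_Dl PB)// !(sip_sym PB _ Vs)// !(sip_Dl PB)//.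
  by rewrite (sip_sym PB Vw (Vu k)); ring.
by have := uK k; rewrite h /K'; lra.
Qed.

Let vE k x : (u k).1 x = (v k).1 x + w.1 x.
Proof. by rewrite (_ : (v k).1 x = (u k).1 x - w.1 x)// subrK. Qed.

Let mu1 k : measurable_fun Om (u k).1. Proof. by have [[]] := Vu k. Qed.
Let mv1 k : measurable_fun Om (v k).1. Proof. by have [[]] := Vv k. Qed.
Let mw1 : measurable_fun Om w.1. Proof. by have [[]] := Vw. Qed.
Let icrit (z : @grad_pair R n) (Vz : V z) : mu.-integrable Om (EFin \o crit b q z.1) :=
  crit_integrable n_gt2 a_lt d_def d_itv q_def Vz.

(** The role of [k_m] in [brezis_lieb] is played by the critical density of [v k]: its integrals are
    bounded by [crit_le], since [N (v k) <= K'], while the fixed density of [w] is integrable. *)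
Let weighted_cvg0 (h : nat -> 'rV[R]_n -> R) :
  (forall k, mu.-integrable Om (EFin \o h k)) ->
  (forall e, 0 < e -> exists C0 : R, forall k x, `|h k x| <=
     enorm x `^ (- b * q) * (e * `|(v k).1 x| `^ q + C0 * `|w.1 x| `^ q)) ->
  {ae mu, forall x, Om x -> h k x @[k --> \oo] --> (0 : R)} ->
  \int[mu]_(x in Om) h k x @[k --> \oo] --> (0 : R).
Proof.
move=> ih he h0; apply: Rintegral_cvg0 => //.
apply: (@brezis_lieb _ _ _ mu Om h (fun k => crit b q (v k).1) (crit b q w.1) (crit_const a q K')) => //.
- by move=> k; apply/measurable_EFinP; case/integrableP : (ih k).
- by move=> k; exact: measurable_crit.
- by move=> k x _; exact: crit_ge0.
- by move=> k; exact: (crit_le n_gt2 a_lt d_def d_itv q_def (Vv k) (vK k)).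
- exact: icrit.
move=> e e0; have [C0 hC] := he e e0; exists C0 => k x _; apply: le_trans (hC k x) _.
by rewrite /crit le_eqVlt; apply/orP; left; apply/eqP; ring.
Qed.

Lemma brezis_lieb_crit : B (u k) - B (u k - w) @[k --> \oo] --> B w.
Proof.
pose h k x : R := crit b q (u k).1 x - crit b q (v k).1 x - crit b q w.1 x.
have ih k : mu.-integrable Om (EFin \o h k).
  exact: (integrableB m1 (integrableB m1 (icrit (Vu k)) (icrit (Vv k))) (icrit Vw)).
have : \int[mu]_(x in Om) h k x @[k --> \oo] --> (0 : R).
  apply: weighted_cvg0 => //.
    move=> e e0; have [C0 hC] := powR_split_le q2 e0; exists C0 => k x.
    rewrite /h /crit vE -!mulrBr normrM ger0_norm ?powR_ge0//.
    by apply: ler_wpM2l; [exact: powR_ge0|exact: hC].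
  apply: filterS cu => x ux xO; have {}ux := ux xO.
  rewrite (_ : 0 = enorm x `^ (- b * q) * `|w.1 x| `^ q - enorm x `^ (- b * q) * `|0 : R| `^ q -
     enorm x `^ (- b * q) * `|w.1 x| `^ q); last first.
    by rewrite normr0 powR0 ?gt_eqF// mulr0 subr0 subrr.
  apply: cvgB; last exact: cvg_cst.
  apply: cvgB; apply: cvgM; try exact: cvg_cst; apply: cvg_powR_norm => //.
  rewrite -[X in _ --> X](subrr (w.1 x)); apply: cvgB => //; exact: cvg_cst.
move=> H; rewrite -[X in _ --> X]add0r.
have -> : (fun k => B (u k) - B (u k - w)) = (fun k => \int[mu]_(x in Om) h k x + B w).
  apply/funext => k.
  have iuv : mu.-integrable Om (EFin \o (fun x => crit b q (u k).1 x - crit b q (v k).1 x)).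
    exact: (integrableB m1 (icrit (Vu k)) (icrit (Vv k))).
  by rewrite /h (RintegralB m1 iuv (icrit Vw)) (RintegralB m1 (icrit (Vu k)) (icrit (Vv k))) subrK.
by apply: cvgD => //; exact: cvg_cst.
Qed.

(** The same splitting argument passes to the limit in the derivative tested with the fixed [w]: by
    [signed_powR_split_le] the error is small relative to the density of [v k], up to a multiple of
    that of [w]. *)
Lemma critform_cvg : critform b q (u k) w @[k --> \oo] --> B w.
Proof.
pose h k x : R := crit_kernel b q (u k) w x - crit b q w.1 x.
have ik k : mu.-integrable Om (EFin \o crit_kernel b q (u k) w).
  exact: (crit_kernel_integrable n_gt2 a_lt d_def d_itv q_def (Vu k) Vw).
have ih k : mu.-integrable Om (EFin \o h k) by exact: (integrableB m1 (ik k) (icrit Vw)).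
have : \int[mu]_(x in Om) h k x @[k --> \oo] --> (0 : R).
  apply: weighted_cvg0 => //.
    move=> e e0; have [C0 hC] := signed_powR_split_le q2 e0; exists C0 => k x.
    rewrite /h /crit /crit_kernel vE -!mulrBr normrM ger0_norm ?powR_ge0//.
    by apply: ler_wpM2l; [exact: powR_ge0|exact: hC].
  apply: filterS cu => x ux xO; have {}ux := ux xO.
  rewrite (_ : 0 = enorm x `^ (- b * q) * (signed_powR q (w.1 x) * w.1 x) - enorm x `^ (- b * q) * `|w.1 x| `^ q); last first.
    by rewrite signed_powR_self// subrr.
  apply: cvgB; last exact: cvg_cst.
  by apply: cvgM; [exact: cvg_cst|apply: cvgM; [exact: cvg_signed_powR|exact: cvg_cst]].
move=> H; rewrite -[X in _ --> X]add0r.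
have -> : (fun k => critform b q (u k) w) = (fun k => \int[mu]_(x in Om) h k x + B w).
  by apply/funext => k; rewrite /h (RintegralB m1 (ik k) (icrit Vw)) subrK.
by apply: cvgD => //; exact: cvg_cst.
Qed.

End splitting.

End compactness.

(** * The Palais-Smale condition *)

Lemma homo_ltn_ge (s : nat -> nat) : {homo s : i j / (i < j)%N} -> forall k, (k <= s k)%N.
Proof. by move=> hs; elim=> // k IH; exact: leq_ltn_trans IH (hs _ _ (ltnSn k)). Qed.

Lemma cvg_homo_ltn (s : nat -> nat) (m0 : nat) : {homo s : i j / (i < j)%N} ->
  (s k + m0)%N @[k --> \oo] --> \oo.
Proof.
move=> hs A [m _ mA]; exists m => // k /= mk; apply: mA => /=.
by rewrite (leq_trans mk)// (leq_trans (homo_ltn_ge hs k))// leq_addr.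
Qed.

(* With [l = lim N(v_m) = lim B(v_m)], the Sobolev inequality gives [S l^(2/q) <= l];
   below the threshold this forces [l = 0]. *)
Lemma sobolev_threshold (R : realType) (S l p r : R) : 0 <= S -> 0 <= l -> 0 < p -> 0 < r ->
  (1 - p) * r = 1 -> S * l `^ p <= l -> l < S `^ r -> l = 0.
Proof.
move=> S0 l0 p0 r0 pr Sl lS; apply/eqP; apply: contraT => ln.
have {}l0 : 0 < l by rewrite lt_neqAle eq_sym ln.
suff : S `^ r <= l by rewrite leNgt lS.
have h : S <= l `^ (1 - p).
  rewrite -(ler_pM2r (powR_gt0 p l0)) -powRD; last by rewrite (gt_eqF l0) implybT.
  by rewrite subrK (powRr1 (ltW l0)).
have lE : (l `^ (1 - p)) `^ r = l by rewrite -powRrM pr (powRr1 (ltW l0)).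
rewrite -[leRHS]lE.
exact: (ge0_ler_powR (ltW r0) S0 (powR_ge0 l (1 - p)) h).
Qed.

Section compactness_below_threshold.
Context {R : realType} {n : nat} (a b c d q lam : R).
Notation mu := (@lebesgue_rV R n).
Notation Om := (@open_unit_ball R n).
Hypothesis n_gt2 : (2 < n)%N.
Hypothesis a_lt : a < (n%:R - 2) / 2.
Hypothesis d_def : d = 1 + a - b.
Hypothesis d_itv : 0 < d <= 1.
Hypothesis q_def : q = 2 * n%:R / (n%:R - 2 * d).
Hypothesis c_gt0 : 0 < c.
Hypothesis lam_itv : 0 < lam < lambda1 a c Om.
Implicit Types (v w : @grad_pair R n) (t e : R).

Let q2 : 2 < q := exponent_gt2 n_gt2 d_itv q_def.
Let q0 : 0 < q. Proof. exact: lt_trans q2. Qed.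
Let PB := inner_sip n_gt2 a_lt.
Let PC := lowform_sip n_gt2 a_lt c_gt0.
Notation V := (D12rad a Om).
Notation N w := (inner a w w).
Notation B w := (power_integral (- b * q) q Om w.1).
Notation C := (lowform a c).
Notation E := (energy a b c q lam Om).
Notation norm := (D12norm a Om).
Let dn : 2^-1 - q^-1 = d / n%:R := exponent_gap n_gt2 d_itv q_def.
Let dn0 : 0 < d / n%:R.
Proof. by case/andP : d_itv => d0 _; rewrite divr_gt0// ltr0n (ltn_trans _ n_gt2). Qed.

Section sequence.
Variables (M : R) (u : nat -> @grad_pair R n) (L : nat -> @grad_pair R n -> R).
Hypothesis Vu : forall m, V (u m).
Hypothesis EM : E (u m) @[m --> \oo] --> M.
Hypothesis FL : forall m, is_frechet a Om E (u m) (L m).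
Hypothesis L0 : forall e, 0 < e -> \forall m \near \oo, forall v, V v -> `|L m v| <= e * norm v.

(** In [E u - q^-1 * L u] the critical term cancels and [d / n * (N u - lam * C u u)] remains. By
    [lam < lambda1] this is at least [th * N u], whereas the left-hand side grows at most like the
    square root of [N u]. *)
Lemma palais_smale_bounded : exists K, \forall m \near \oo, N (u m) <= K.
Proof.
case/andP : lam_itv => lam0 lam1; set l1 := lambda1 a c Om in lam1.
have l10 : 0 < l1 by exact: lt_trans lam1.
pose th := d / n%:R * (1 - lam / l1).
have th0 : 0 < th by rewrite mulr_gt0// subr_gt0 ltr_pdivrMr// mul1r.
pose A := `|M| + 1; exists (2 / th * (A + (2 * th)^-1)).
have EA : \forall m \near \oo, E (u m) <= A.
  have /cvgrPdist_le/(_ _ ltr01) := EM; apply: filterS => m; rewrite ler_norml => /andP[h _].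
  by have := ler_norm M; rewrite /A; lra.
apply: filterS2 EA (L0 ltr01) => m Em /(_ _ (Vu m)).
rewrite mul1r D12normE => Lm.
set x := Num.sqrt (N (u m)) in Lm.
have x0 : 0 <= x := sqrtr_ge0 _.
have x2 : x ^+ 2 = N (u m) by rewrite sqr_sqrtr// (sip_ge0 PB (Vu m)).
have C0 : 0 <= C (u m) (u m) := sip_ge0 PC (Vu m).
have qi : 0 < q^-1 by rewrite invr_gt0.
have qi1 : q^-1 <= 1 by rewrite invf_le1//; have := q2; lra.
have lC : lam * C (u m) (u m) <= lam / l1 * x ^+ 2.
  rewrite -mulrA; apply: ler_wpM2l; first exact: ltW.
  by rewrite mulrC ler_pdivlMr// mulrC x2 (lambda1_le n_gt2 a_lt c_gt0 (Vu m)).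
have LE := frechetE n_gt2 a_lt d_def d_itv q_def c_gt0 (Vu m) (Vu m) (FL m).
rewrite (critform_self b n_gt2 d_itv q_def) in LE.
have key : d / n%:R * (N (u m) - lam * C (u m) (u m)) = E (u m) - q^-1 * L m (u m).
  by rewrite -dn energyE LE; field; rewrite gt_eqF.
have h1 : th * x ^+ 2 <= A + x.
  apply: (@le_trans _ _ (E (u m) - q^-1 * L m (u m))).
    by rewrite -key /th -mulrA; apply: ler_wpM2l; [exact: ltW|rewrite -x2; lra].
  apply: lerD => //; rewrite -mulrN; apply: (@le_trans _ _ (q^-1 * x)); last by rewrite ler_piMl.
  by apply: ler_wpM2l; [exact: ltW|apply: le_trans Lm; rewrite -normrN ler_norm].
rewrite -x2 mulrAC mulrC ler_pdivlMl//.
(* From [x <= th / 2 * x^2 + 1 / (2 * th)], half of [th * x^2] is absorbed; this gives the announced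
   bound. *)
have -> : (2 * th)^-1 = (th^-1) / 2 by field; rewrite gt_eqF.
have := sqr_ge0 (x - th^-1); rewrite sqrrB => h2.
have h3 := ler_wpM2l (ltW th0) h2.
have h4 : th * (x ^+ 2 - x * th^-1 *+ 2 + th^-1 ^+ 2) = th * x ^+ 2 - 2 * x + th^-1.
  by field; rewrite gt_eqF.
rewrite mulr0 h4 in h3; lra.
Qed.

Variables (w : @grad_pair R n) (K : R).
Hypothesis Vw : V w.
Hypothesis uK : forall m, N (u m) <= K.
Hypothesis weak : forall l, bounded_functional V (inner a) l -> l (u m) @[m --> \oo] --> l w.
Hypothesis M_lt : M < d / n%:R * @S_R R n a b q `^ (n%:R / (2 * d)).

Let cu : {ae mu, forall x, Om x -> (u m).1 x @[m --> \oo] --> w.1 x}.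
Proof.
apply: (radial_mean_cvg_ae n_gt2 a_lt Vu Vw) => r r0.
exact: weak (radial_mean_functional n_gt2 a_lt r0).
Qed.

Let cI : inner a (u m) w @[m --> \oo] --> N w.
Proof. exact: weak (bounded_functional_sip PB Vw). Qed.

Let cw (z : @grad_pair R n) : {ae mu, forall x, Om x -> z.1 x @[_ --> \oo] --> z.1 x}.
Proof. by apply: aeW => x _; exact: cvg_cst. Qed.

Let cCuu : C (u m) (u m) @[m --> \oo] --> C w w.
Proof. exact: (lowform_cvg n_gt2 a_lt c_gt0 Vu Vu Vw Vw uK uK cu cu). Qed.

Let cCuw : C (u m) w @[m --> \oo] --> C w w.
Proof.
pose K1 := Num.max K (N w).
have uK1 m : N (u m) <= K1 by rewrite le_max uK.
have wK1 (m : nat) : N w <= K1 by rewrite le_max lexx orbT.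
exact: (lowform_cvg n_gt2 a_lt c_gt0 Vu (fun=> Vw) Vw Vw uK1 wK1 cu (cw w)).
Qed.

Let cB : B (u m) - B (u m - w) @[m --> \oo] --> B w.
Proof. exact: (brezis_lieb_crit n_gt2 a_lt d_def d_itv q_def Vu Vw uK cu). Qed.

Let cJ : critform b q (u m) w @[m --> \oo] --> B w.
Proof. exact: (critform_cvg n_gt2 a_lt d_def d_itv q_def Vu Vw uK cu). Qed.

Let L_cvg0 (z : nat -> @grad_pair R n) (K1 : R) : (forall m, V (z m)) ->
  (forall m, norm (z m) <= K1) -> L m (z m) @[m --> \oo] --> (0 : R).
Proof.
move=> Vz zK; apply/cvgrPdist_le => e e0.
have K10 : 0 <= K1 by apply: le_trans (zK 0%N); rewrite D12normE sqrtr_ge0.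
have e1 : 0 < e / (K1 + 1) by rewrite divr_gt0// ltr_wpDl.
apply: filterS (L0 e1) => m /(_ _ (Vz m)) h; rewrite sub0r normrN; apply: le_trans h _.
apply: le_trans (ler_wpM2l (ltW e1) (zK m)) _.
by rewrite mulrAC ler_pdivrMr ?ltr_wpDl// ler_pM2l// lerDl.
Qed.

Let nehari : N w - B w - lam * C w w = 0.
Proof.
have h : L m w @[m --> \oo] --> (0 : R).
  by apply: (@L_cvg0 (fun=> w) (norm w)).
have h' : L m w @[m --> \oo] --> N w - B w - lam * C w w.
  rewrite (_ : (fun m => L m w) = fun m => inner a (u m) w - critform b q (u m) w - lam * C (u m) w).
    apply: cvgB; last by apply: cvgM => //; exact: cvg_cst.
    exact: cvgB.
  apply/funext => m.
  exact: (frechetE n_gt2 a_lt d_def d_itv q_def c_gt0 (Vu m) Vw (FL m)).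
by rewrite -(cvg_lim (@Rhausdorff R) h') (cvg_lim (@Rhausdorff R) h).
Qed.

Let defect : L m (u m) @[m --> \oo] --> (0 : R).
Proof.
apply: (@L_cvg0 u (Num.sqrt K)) => // m; rewrite D12normE; exact: ler_wsqrtr.
Qed.

Let LE m : L m (u m) = N (u m) - B (u m) - lam * C (u m) (u m).
Proof.
rewrite (frechetE n_gt2 a_lt d_def d_itv q_def c_gt0 (Vu m) (Vu m) (FL m)).
by rewrite (critform_self b n_gt2 d_itv q_def).
Qed.

Let NE m : N (u m - w) = N (u m) - 2 * inner a (u m) w + N w.
Proof. exact: (sip_NB PB (Vu m) Vw). Qed.

(** Written through [L m (u m)], every term of the difference has a known limit, and these limits
    add up to minus the left-hand side of [nehari]. *)
Let cPQ : N (u m - w) - B (u m - w) @[m --> \oo] --> (0 : R).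
Proof.
rewrite (_ : (fun m => _) = fun m => L m (u m) - 2 * inner a (u m) w + N w +
    (B (u m) - B (u m - w)) + lam * C (u m) (u m)); last first.
  by apply/funext => m; rewrite LE NE; move: (N (u m)) (inner a (u m) w) (N w) (B (u m)) (B (u m - w)) (C (u m) (u m)) => ? ? ? ? ? ?; ring.
rewrite (_ : 0 = 0 - 2 * N w + N w + B w + lam * C w w); last by have := nehari; lra.
apply: cvgD; last by apply: cvgM => //; exact: cvg_cst.
apply: cvgD => //; apply: cvgD; last exact: cvg_cst.
by apply: cvgB => //; apply: cvgM => //; exact: cvg_cst.
Qed.

(** Subtracting [q^-1] times the vanishing quantity of [cPQ] removes [B (u m - w)], so that
    [N (u m - w)] keeps the coefficient [1/2 - 1/q = d/n]. *)
Let cP : d / n%:R * N (u m - w) @[m --> \oo] --> M - E w.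
Proof.
rewrite (_ : (fun m => _) = fun m => E (u m) - inner a (u m) w + 2^-1 * N w +
    q^-1 * (B (u m) - B (u m - w)) + lam / 2 * C (u m) (u m) - q^-1 * (N (u m - w) - B (u m - w))); last first.
  by apply/funext => m; rewrite -dn energyE NE; move: (N (u m)) (inner a (u m) w) (N w) (B (u m)) (B (u m - w)) (C (u m) (u m)) => ? ? ? ? ? ?; field; rewrite gt_eqF.
rewrite (_ : M - E w = M - N w + 2^-1 * N w + q^-1 * B w + lam / 2 * C w w - q^-1 * 0); last first.
  by rewrite energyE; field; rewrite gt_eqF.
apply: cvgB; last by apply: cvgM => //; exact: cvg_cst.
apply: cvgD; last by apply: cvgM => //; exact: cvg_cst.
apply: cvgD; last by apply: cvgM => //; exact: cvg_cst.
by apply: cvgD; [apply: cvgB|exact: cvg_cst].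
Qed.

(** On the Nehari identity the energy reduces to [d / n * B w]. *)
Let energy_ge0 : 0 <= E w.
Proof.
have -> : E w = d / n%:R * B w.
  by rewrite energyE -dn (_ : N w = B w + lam * C w w); [field; rewrite gt_eqF|have := nehari; lra].
apply: mulr_ge0; first exact: ltW.
by apply: Rintegral_ge0 => x _; rewrite mulr_ge0 ?powR_ge0.
Qed.

Lemma palais_smale_strong : norm (u m - w) @[m --> \oo] --> 0.
Proof.
have Vv m : V (u m - w) := sip_sub PB (Vu m) Vw.
pose l := (M - E w) / (d / n%:R).
have cN : N (u m - w) @[m --> \oo] --> l.
  rewrite (_ : (fun m => _) = fun m => d / n%:R * N (u m - w) / (d / n%:R)); last first.
    by apply/funext => m; rewrite mulrAC divff ?mul1r// gt_eqF.
  by apply: cvgM => //; exact: cvg_cst.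
have l0 : 0 <= l.
  by apply: (ler_cvg_to (cvg_cst 0) cN); apply: nearW => m; exact: (sip_ge0 PB (Vv m)).
have cBl : B (u m - w) @[m --> \oo] --> l.
  rewrite (_ : (fun m => _) = fun m => N (u m - w) - (N (u m - w) - B (u m - w))); last first.
    by apply/funext => m; rewrite subKr.
  by rewrite -[X in _ --> X]subr0; exact: cvgB.
have S0 := @S_R_ge0 R n a b q.
have d0 : 0 < d by case/andP : d_itv.
have nn : 0 < n%:R :> R by rewrite ltr0n (ltn_trans _ n_gt2).
have q2i : 0 < 2 / q by rewrite divr_gt0.
have lS : l < @S_R R n a b q `^ (n%:R / (2 * d)).
  by rewrite ltr_pdivrMr// mulrC; apply: le_lt_trans M_lt; rewrite gerBl.
have Sl : @S_R R n a b q * l `^ (2 / q) <= l.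
  have c1 : @S_R R n a b q * `|B (u m - w)| `^ (2 / q) @[m --> \oo] --> @S_R R n a b q * `|l| `^ (2 / q).
    by apply: cvgM; [exact: cvg_cst|exact: cvg_powR_norm].
  rewrite ger0_norm// in c1.
  apply: (ler_cvg_to c1 cN); apply: nearW => m.
  rewrite ger0_norm; first exact: (S_R_le b n_gt2 a_lt q0 (Vv m)).
  by apply: Rintegral_ge0 => x _; rewrite mulr_ge0 ?powR_ge0.
have r0 : 0 < n%:R / (2 * d) by rewrite divr_gt0// mulr_gt0.
(* The exponent of the threshold is the inverse of [1 - 2 / q = 2 d / n]. *)
have pr : (1 - 2 / q) * (n%:R / (2 * d)) = 1.
  rewrite (_ : 1 - 2 / q = 2 * (2^-1 - q^-1)); last by field; rewrite gt_eqF.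
  by rewrite dn; field; rewrite !gt_eqF.
have lE : l = 0 := sobolev_threshold S0 l0 q2i r0 pr Sl lS.
rewrite lE in cN.
rewrite (_ : (fun m => _) = fun m => Num.sqrt (N (u m - w))); last first.
  by apply/funext => m; rewrite D12normE.
rewrite -[X in _ --> X](@sqrtr0 R); apply: continuous_cvg => //; exact: sqrt_continuous.
Qed.

End sequence.

End compactness_below_threshold.

Theorem theorem4p3 (R : realType) (n : nat) (a b c d q lam M : R)
    (n_gt2 : (2 < n)%N)
    (a_lt : a < (n%:R - 2) / 2)
    (b_itv : a <= b <= a + 1)
    (d_def : d = 1 + a - b)
    (d_itv : 0 < d <= 1)
    (q_def : q = 2 * n%:R / (n%:R - 2 * d))
    (c_gt0 : 0 < c)
    (lam_itv : 0 < lam < lambda1 a c (@open_unit_ball R n))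
    (M_lt : M < d / n%:R * @S_R R n a b q `^ (n%:R / (2 * d))) :
  palais_smale a (@open_unit_ball R n)
    (energy a b c q lam (@open_unit_ball R n)) M.
Proof.
move=> u Vu EM [L [FL /(cvge0P (fun m => dual_norm_ge0 n_gt2 a_lt (L m) (Vu m))) L0]].
have {}L0 e : 0 < e -> \forall m \near \oo, forall v, D12rad a (@open_unit_ball R n) v ->
    `|L m v| <= e * D12norm a (@open_unit_ball R n) v.
  move=> e0; apply: filterS (L0 e e0) => m Lm v Vv.
  exact: (frechet_le n_gt2 a_lt (Vu m) Vv (FL m) Lm).
(* The bound holds from [m0] on, so the extraction is made from the shifted sequence. *)
have [K [m0 _ uK]] := palais_smale_bounded n_gt2 a_lt d_def d_itv q_def c_gt0 lam_itv Vu EM FL L0.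
have [s [w [hs Vw weak]]] := weak_compactness (inner_sip n_gt2 a_lt)
  (D12rad_complete n_gt2 a_lt) (fun i => Vu (i + m0)%N) (fun i => uK _ (leq_addl i m0)).
exists (fun k => (s k + m0)%N); split; first by move=> i j ij; rewrite ltn_add2r; exact: hs.
exists w => //.
have cs := cvg_homo_ltn m0 hs.
apply: (palais_smale_strong n_gt2 a_lt d_def d_itv q_def c_gt0 (fun k => Vu (s k + m0)%N)
  (cvg_comp _ _ cs EM) (fun k => FL (s k + m0)%N) _ Vw (fun k => uK _ (leq_addl (s k) m0)) weak M_lt).
by move=> e /L0; exact: cs.
Qed.
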